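(* Let $\{B^H(t),t\in[0,1]\}$ be a $d$-dimensional fractional Brownian motion with Hurst index $H\in(0,1)$, let $f\in C^H(\mathbf{I})$, and let $F\subseteq\mathbb{R}^d$ and $E\subset\mathbf{I}$ be compact sets such that $0<\dim(F)\le\overline{\dim}_M(F)<d$. Then for all $\gamma$ and $\gamma'$ such that $0<\gamma<\dim(F)\le\overline{\dim}_M(F)<\gamma'<d$, $$\mathtt{c}_4^{-1}\,\mathcal{C}^{H(d-\gamma)}(E)\le\mathbb{P}\{(B^H+f)(E)\cap F\ne\emptyset\}\le\mathtt{c}_4\,\mathcal{H}^{H(d-\gamma')}(E),$$ where $\mathtt{c}_4$ is a positive constant which depends on $E$, $F$, $H$, $\mathrm{K}_f$, $\gamma$ and $\gamma'$.
   Context: $\mathbf{I}=[a,b]$ with fixed $0<a<b\le 1$. A real fractional Brownian motion $B_0^H$ is a centered Gaussian process with continuous paths and covariance $\frac12(|t|^{2H}+|s|^{2H}-|t-s|^{2H})$; $B^H$ has $d$ independent copies of $B_0^H$ as components and is defined on a complete probability space $(\Omega,\mathcal{F},\mathbb{P})$. $C^H(\mathbf{I})$ is the space of $H$-Hölder functions $f:\mathbf{I}\to\mathbb{R}^d$, with norm $\|f\|_H=\sup_{s\in\mathbf{I}}\|f(s)\|+\sup_{s\ne t}\|f(t)-f(s)\|/|t-s|^H$; $\mathrm{K}_f$ denotes $\|f\|_H$. $\dim$ is the Euclidean Hausdorff dimension and $\overline{\dim}_M$ the Euclidean upper Minkowski (box) dimension. For $\beta>0$, $\mathcal{H}^\beta$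 is the Euclidean Hausdorff measure $\mathcal{H}^\beta(G)=\lim_{\delta\to0}\inf\{\sum_n(2r_n)^\beta: G\subseteq\bigcup_n B(r_n),\ r_n\le\delta\}$ (open balls $B(r_n)$ of radius $r_n$), and $\mathcal{C}^\beta(G)=\big[\inf_{\mu\in\mathcal{P}(G)}\iint|u-v|^{-\beta}\mu(du)\mu(dv)\big]^{-1}$, with $\mathcal{P}(G)$ the probability measures carried by $G$ ($0^{-\beta}=\infty$, $1/\infty=0$, $\inf\emptyset=\infty$). *)

(* Defs.v *)
From HB Require Import structures.
From mathcomp Require Import all_boot all_order all_algebra.
From mathcomp Require Import all_classical all_reals all_analysis.

Set Implicit Arguments.
Unset Strict Implicit.
Unset Printing Implicit Defensive.

Import Order.TTheory GRing.Theory Num.Theory.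
Import numFieldNormedType.Exports.

Local Open Scope classical_set_scope.
Local Open Scope ring_scope.

(* The library norm on ['rV[R]_d] is the sup norm, hence this definition. *)
Definition euclidean_norm (R : realType) (d : nat) (x : 'rV[R]_d) : R :=
  Num.sqrt (\sum_(i < d) x ord0 i ^+ 2).

Definition real_dist (R : realType) (x y : R) : R := `|x - y|.

Definition euclidean_dist (R : realType) (d : nat) (x y : 'rV[R]_d) : R :=
  euclidean_norm (x - y).

Section metric_dimensions.
Variables (R : realType) (T : Type) (dist : T -> T -> R).

Definition metric_ball (x : T) (r : R) : set T := [set y | dist x y < r].

(* A ball of radius 0 is empty and contributes [0 `^ beta = 0] when
   [0 < beta], so finite covers are included. *)
Definition hausdorff_content (beta : R) (G : set T) (delta : R) : \bar R :=
  ereal_inf [set s | exists (x : nat -> T) (r : nat -> R),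
    [/\ G `<=` \bigcup_n metric_ball (x n) (r n),
        (forall n, 0 <= r n <= delta) &
        s = (\sum_(0 <= n <oo) ((2 * r n) `^ beta)%:E)%E]].

Definition hausdorff_measure (beta : R) (G : set T) : \bar R :=
  lim (hausdorff_content beta G delta @[delta --> 0^'+]).

Definition hausdorff_dim (G : set T) : \bar R :=
  ereal_inf [set beta%:E | beta in
    [set beta : R | 0 < beta /\ hausdorff_measure beta G = 0%E]].

Definition covering_number (G : set T) (r : R) : \bar R :=
  ereal_inf [set (n%:R)%:E | n in
    [set n : nat | exists x : 'I_n -> T,
       G `<=` \bigcup_i metric_ball (x i) r]].

Definition upper_minkowski_dim (G : set T) : \bar R :=
  limf_esup (fun r : R => lne (covering_number G r) * ((ln r^-1)^-1)%:E)%E 0^'+.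

End metric_dimensions.

Section capacity.
Variable R : realType.
Local Open Scope ereal_scope.

(* [powR 0 (- beta)] is 0, so the value at 0 is set separately. *)
Definition riesz_kernel (beta : R) (u v : R) : \bar R :=
  if u == v then +oo else (`|u - v| `^ (- beta))%:E.

Definition energy (beta : R) (mu : probability R R) : \bar R :=
  \int[mu]_u \int[mu]_v riesz_kernel beta u v.

Definition capacity (beta : R) (G : set R) : \bar R :=
  (ereal_inf [set energy beta mu | mu in
    [set mu : probability R R | mu G = 1]])^-1.

End capacity.

Section holder.
Variables (R : realType) (d : nat) (a b H : R).

Definition is_holder (f : R -> 'rV[R]_d) : Prop :=
  exists C : R, forall s t : R, s \in `[a, b] -> t \in `[a, b] ->
    euclidean_norm (f t - f s) <= C * `|t - s| `^ H.

Definition holder_norm (f : R -> 'rV[R]_d) : \bar R :=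
  (ereal_sup [set (euclidean_norm (f s))%:E | s in `[a, b]] +
   ereal_sup [set x | exists s t : R, [/\ s \in `[a, b], t \in `[a, b], s != t &
     x = (euclidean_norm (f t - f s) / `|t - s| `^ H)%:E]])%E.

End holder.

(* The library's [normal_prob m 0] is the uniform law on [0, 1]; the degenerate
   Gaussian law has to be the Dirac mass. *)
Definition gaussian_law (R : realType) (m s : R) (A : set R) : \bar R :=
  if s == 0 then \d_m A else normal_prob m s A.

Section fractional_brownian_motion.
Context (R : realType) (disp : measure_display) (T : measurableType disp).
Variable P : probability T R.

(* Processes have time set [0, 1]; their values at other times are junk. *)
Implicit Type X : R -> {RV P >-> R}.

Definition gaussian_process X : Prop :=
  forall (n : nat) (t : 'I_n -> R) (c : 'I_n -> R),
    (forall i, t i \in `[0, 1]) ->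
    exists m s : R, forall A : set R, measurable A ->
      P ((fun w => \sum_(i < n) c i * X (t i) w) @^-1` A) = gaussian_law m s A.

Definition is_fbm (H : R) X : Prop :=
  [/\ gaussian_process X,
      (forall t : R, t \in `[0, 1] -> ('E_P[X t] = 0)%E),
      (forall s t : R, s \in `[0, 1] -> t \in `[0, 1] ->
        covariance P (X s) (X t) =
        (2^-1 * (`|t| `^ (2 * H) + `|s| `^ (2 * H)
                 - `|t - s| `^ (2 * H)))%:E) &
      (forall w, {within `[0, 1], continuous (fun t => X t w)})].

Definition process_sigma_algebra X : set (set T) :=
  <<s [set C | exists (t : R) (A : set R),
        [/\ t \in `[0, 1], measurable A & C = X t @^-1` A]] >>.

Definition independent_processes (d : nat) (B : 'I_d -> R -> {RV P >-> R}) :=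
  forall (J : {set 'I_d}) (C : 'I_d -> set T),
    (forall i, i \in J -> process_sigma_algebra (B i) (C i)) ->
    P (\bigcap_(i in [set` J]) C i) = (\prod_(i in J) P (C i))%E.

Definition is_fbm_vector (d : nat) (H : R)
    (B : 'I_d -> R -> {RV P >-> R}) : Prop :=
  (forall i, is_fbm H (B i)) /\ independent_processes B.

Definition sample_path (d : nat) (B : 'I_d -> R -> {RV P >-> R})
  (w : T) (t : R) : 'rV[R]_d := \row_i B i t w.

Definition hitting_event (d : nat) (B : 'I_d -> R -> {RV P >-> R})
    (f : R -> 'rV[R]_d) (E : set R) (F : set 'rV[R]_d) : set T :=
  [set w | ((fun t => sample_path B w t + f t) @` E) `&` F !=set0].

End fractional_brownian_motion.

(* Main.v *)
(* Lower bound.  If [F] has positive [gamma]-dimensional Hausdorff measure, a max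
   flow argument on dyadic cubes gives, at each scale [r], a finitely supported
   Frostman measure [w] on [F].  For a probability measure [mu] of finite energy on
   [E], discretized at scale [r^(1/H)], count with weight [mu x w] the pairs [(s, x)]
   such that [B + f] at time [s] is within [r] of [x].  The first moment is of order
   [r^d].  Conditioning [B t] on [B s] bounds the probability of two such events by
   [(C r^2 / L)^d exp(- c |x - y|^2 / L^2)] with [L^2 = |t - s|^(2H) + r^2], where the
   Hoelder drift only changes the constants; integrating in [x] and [y] against the
   Frostman measure leaves [L^(gamma - d) <= C |t - s|^(- H (d - gamma))], so the
   second moment is at most [C r^(2 d)] times the energy of [mu].  By the second
   moment method [B + f] comes within [r] of [F] with probability at least
   [c / energy mu], uniformly in [r], and compactness lets [r] tend to 0.

   Upper bound.  As the constant may depend on [E], only the case of a null set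
   [E] matters.  Choose [g' < gamma'] with [N(F, r) <= 2 r^(- g')] and
   [h = H (d - gamma') / (d - g') < H].  Up to a small probability [B] has modulus of
   continuity [C 2^(- n h)] along dyadic times, so a time interval of length [2^(- n)]
   contains a hitting time with probability at most
   [C N(F, 2^(- n h)) 2^(- n h d) <= C 2^(- n h (d - g')) = C 2^(- n H (d - gamma'))];
   summing over covers of [E] of arbitrarily small total weight gives probability 0. *)

Require Import Defs.
From HB Require Import structures.
From mathcomp Require Import all_boot all_order all_algebra.
From mathcomp Require Import all_classical all_reals all_analysis measurable_realfun.
From mathcomp Require Import ring lra zify.

Import Order.TTheory GRing.Theory Num.Theory.
Import numFieldNormedType.Exports.

Set Implicit Arguments.
Unset Strict Implicit.
Unset Printing Implicit Defensive.

Local Open Scope classical_set_scope.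
Local Open Scope ring_scope.

(** * Gaussian integrals *)

(** [gaussian_process] gives only the laws of linear combinations, so there is no joint density to
    condition on. Conditioning is replaced by the residual [D = X t - rho X s], uncorrelated with
    [X s]: the joint characteristic function of the pair factorizes, and indicators are dominated by
    Gaussian kernels, which are averages of cosines. The characteristic function itself comes from
    Stein's identity, hence the integrals below. The two-point bound would degenerate unless [D]
    kept a variance of order [|t - s|^(2H)]; it does because times stay above [a > 0], where
    [|t^H - s^H|] is at most a fixed fraction, smaller than 1, of [|t - s|^H]. Both measures of the
    second moment argument are finite sums of atoms, fine enough for the scale [r], so no weak limit
    of measures is taken; in exchange every constant has to be fixed before the scale, the process
    and the drift. In the upper bound a uniform modulus of exponent [H] is out of reach for the
    paths; the loss in passing to [h < H] is paid for by the room between [g'] and [gamma']. *)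

Section integral_of_derivative.
Context {R : realType}.
Local Notation mu := (@lebesgue_measure R).

(** Integration by parts over the whole line, for Stein's identity: the integrals over [[-n-1, n+1]]
    are boundary terms, and dominated convergence with bound [|f|] passes to the limit. *)
Lemma Rintegral_derivative_eq0 (F f : R -> R) :
  (forall x : R, is_derive x 1 F (f x)) -> continuous f ->
  mu.-integrable setT (EFin \o f) ->
  F n%:R @[n --> \oo] --> 0 -> F (- n%:R) @[n --> \oo] --> 0 ->
  (\int[mu]_x f x = 0)%R.
Proof.
move=> dF cf intf Fy FNy.
have cF x : {for x, continuous F}.
  by apply: differentiable_continuous; apply/derivable1_diffP.
pose I n : set R := `[- n.+1%:R, n.+1%:R]%classic.
have FI n : (\int[mu]_(x in I n) (f x)%:E = (F n.+1%:R - F (- n.+1%:R))%:E)%E.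
  rewrite /I (@continuous_FTC2 _ f F)//.
  - by rewrite (lt_le_trans (y := 0))// ?oppr_lt0 ?ltr0n.
  - exact: continuous_subspaceT.
  - split.
    + by move=> x _.
    + exact/cvg_at_right_filter/cF.
    + exact/cvg_at_left_filter/cF.
  - by move=> x _; rewrite derive1E derive_val.
have mI n : measurable (I n) by exact: measurable_itv.
have := @dominated_cvg _ _ _ mu setT measurableT (fun n x => ((f \_ (I n)) x)%:E)
  (EFin \o f) (fun x => `|f x|%:E).
have lhs : (\int[mu]_x ((f \_ (I n)) x)%:E)%E @[n --> \oo] --> 0%E.
  rewrite (_ : (fun n => _) = (fun n => (F n.+1%:R - F (- n.+1%:R))%:E)); last first.
    by apply/funext => n; rewrite -FI [RHS]integral_mkcond/= restrict_EFin.
  apply: cvg_EFin; first exact: nearW.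
  rewrite -(subr0 0); apply: cvgB.
  - by move: Fy; rewrite -cvg_shiftS.
  - by move: FNy; rewrite -cvg_shiftS.
move=> H.
suff -> : (\int[mu]_x f x = fine 0%E)%R by [].
rewrite /Rintegral; congr fine; apply: cvg_unique lhs => //.
apply: H => //.
- move=> n; apply/measurable_EFinP.
  apply/(measurable_restrictT f (mI n)); apply: measurable_funTS.
  exact: continuous_measurable_fun.
- move=> x _; apply: cvg_EFin; first exact: nearW.
  apply: cvg_near_cst; near=> n; rewrite /= patchE ifT//.
  have xn : `|x| <= n.+1%:R.
    apply: (@le_trans _ _ n%:R); last by rewrite ler_nat.
    by near: n; exact: nbhs_infty_ger.
  by rewrite inE /I/= in_itv/= -ler_norml.
- exact: integrable_norm intf.
- move=> n x _ /=; rewrite lee_fin patchE; case: ifP => // _.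
  by rewrite normr0.
Unshelve. all: end_near. Qed.

End integral_of_derivative.

Section normal_integrals.
Context {R : realType}.
Local Notation mu := (@lebesgue_measure R).
Implicit Types (m s : R).

(** The Radon-Nikodym derivative of [normal_prob] has the same integral as [normal_pdf] over every
    measurable set, so the two agree a.e. and the change of variables for the former applies. *)
Lemma ge0_integral_normal_prob m s (h : R -> \bar R) :
  measurable_fun [set: R] h -> (forall x, 0 <= h x)%E ->
  (\int[normal_prob m s]_x h x = \int[mu]_x (h x * (normal_pdf m s x)%:E))%E.
Proof.
move=> mh h0.
have dom := @normal_prob_dominates R m s.
rewrite -(Radon_Nikodym_SigmaFinite.change_of_variables dom)//.
apply: ae_eq_integral => //.
- apply: emeasurable_funM => //.
  exact: measurable_int (Radon_Nikodym_SigmaFinite.f_integrable _).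
- apply: emeasurable_funM => //; apply/measurable_EFinP.
  exact: measurable_normal_pdf.
- apply: ae_eqe_mul2l; apply: integral_ae_eq => //.
  + exact: Radon_Nikodym_SigmaFinite.f_integrable.
  + by apply/measurable_EFinP; exact: measurable_normal_pdf.
  + by move=> E _ mE; rewrite -Radon_Nikodym_SigmaFinite.f_integral.
Qed.

Lemma integrable_normal_prob m s (h : R -> R) : measurable_fun [set: R] h ->
  (normal_prob m s).-integrable setT (EFin \o h) <->
  mu.-integrable setT (EFin \o (fun x => h x * normal_pdf m s x)).
Proof.
move=> mh.
have mh' : measurable_fun setT (fun x : measurableTypeR R => `|(h x)%:E|%E).
  by apply: measurableT_comp => //; exact/measurable_EFinP.
have E : (\int[normal_prob m s]_x `|(h x)%:E| =
    \int[mu]_x `|(h x * normal_pdf m s x)%:E|)%E.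
  rewrite ge0_integral_normal_prob//; apply: eq_integral => x _.
  by rewrite EFinM abseM (gee0_abs (x:= (normal_pdf _ _ _)%:E))// lee_fin normal_pdf_ge0.
split=> /integrableP[_ hi]; apply/integrableP; split => //=.
- apply/measurable_EFinP; apply: measurable_funM => //.
  exact: measurable_normal_pdf.
- by move: hi; rewrite /= E.
- exact/measurable_EFinP.
- by move: hi; rewrite /= E.
Qed.

Lemma integral_normal_prob m s (h : R -> R) : measurable_fun [set: R] h ->
  mu.-integrable setT (EFin \o (fun x => h x * normal_pdf m s x)) ->
  (\int[normal_prob m s]_x h x = \int[mu]_x (h x * normal_pdf m s x))%R.
Proof.
move=> mh ih; have ih' := (integrable_normal_prob m s mh).2 ih.
have mh1 : measurable_fun setT (EFin \o h) by exact/measurable_EFinP.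
rewrite /Rintegral; congr fine.
rewrite integralE (ge0_integral_normal_prob _ _ (measurable_funepos _))//.
rewrite (ge0_integral_normal_prob _ _ (measurable_funeneg _))//.
rewrite [RHS]integralE; congr (_ - _)%E; apply: eq_integral => x _.
- rewrite !funeposE /=; have p := normal_pdf_ge0 m s x.
  by rewrite EFinM maxe_pMl// ?mul0e// lee_fin.
- rewrite !funenegE /=; have p := normal_pdf_ge0 m s x.
  by rewrite maxe_pMl// ?mul0e ?lee_fin//= -EFinM mulNr.
Qed.

End normal_integrals.

(** * Stein's identity for the normal law *)

Section stein.
Context {R : realType}.
Local Notation mu := (@lebesgue_measure R).
Variables (m s : R).
Hypothesis s0 : s != 0.

Let s2_gt0 : 0 < s ^+ 2.
Proof. by rewrite exprn_even_gt0. Qed.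

Lemma is_derive_normal_pdf (x : R) :
  is_derive x 1 (normal_pdf m s) (- (x - m) / s ^+ 2 * normal_pdf m s x).
Proof.
have d1 : is_derive x 1 (fun y : R => - (y - m) ^+ 2 / (s ^+ 2 *+ 2))
    (- (x - m) / s ^+ 2).
  apply: is_derive_eq.
  rewrite /GRing.scale/= !(scaler0, addr0, subr0, mulr1, mulr0, add0r).
  by field.
have d2 := @is_derive1_comp _ expR _ _ _ _ (is_derive_expR _) d1.
rewrite normal_pdfE//.
have := is_deriveZ (normal_peak s) d2; rewrite /GRing.scale/= => d3.
apply: (is_derive_eq d3).
by rewrite /normal_fun/=; ring.
Qed.

(** Doubling the deviation absorbs a quadratic factor. The exponents differ by [z = 3 y / (8 s^2)],
    and [z exp(-z) <= 1] leaves [8 s^2 / 3], rounded up to [3 s^2]; the halved peak turns 3 into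
    6. *)
Lemma normal_pdf_sqr_le x :
  (x - m) ^+ 2 * normal_pdf m s x <= 6 * s ^+ 2 * normal_pdf m (2 * s) x.
Proof.
have s20 : 2 * s != 0 by rewrite mulf_neq0.
rewrite !normal_pdfE// /normal_fun /normal_peak.
have -> : Num.sqrt ((2 * s) ^+ 2 * pi *+ 2) = 2 * Num.sqrt (s ^+ 2 * pi *+ 2).
  rewrite (_ : _ *+ 2 = 2 ^+ 2 * (s ^+ 2 * pi *+ 2)); last by ring.
  by rewrite sqrtrM ?exprn_ge0// sqrtr_sqr ger0_norm.
rewrite invfM; set p := (Num.sqrt _)^-1.
have p0 : 0 <= p by rewrite invr_ge0.
set y := (x - m) ^+ 2.
have y0 : 0 <= y by rewrite sqr_ge0.
pose z := 3 * y / (8 * s ^+ 2).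
have z0 : 0 <= z by rewrite divr_ge0// mulr_ge0// ltW.
have -> : - y / (s ^+ 2 *+ 2) = - z + - y / ((2 * s) ^+ 2 *+ 2).
  by rewrite /z; field.
rewrite expRD; set e := expR (_ / _).
have e0 : 0 <= e by exact: expR_ge0.
have ze : y * expR (- z) <= 3 * s ^+ 2.
  have : z * expR (- z) <= 1.
    rewrite expRN ler_pdivrMr ?expR_gt0// mul1r.
    by apply: le_trans (expR_ge1Dx z); rewrite lerDr.
  have -> : y * expR (- z) = z * expR (- z) * (8 * s ^+ 2 / 3).
    by rewrite {2}/z; field.
  move=> h; apply: (@le_trans _ _ (1 * (8 * s ^+ 2 / 3))).
    by apply: ler_wpM2r => //; rewrite divr_ge0// mulr_ge0// ltW.
  by have := s2_gt0; lra.
have -> : y * (p * (expR (- z) * e)) = (y * expR (- z)) * (p * e) by ring.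
have -> : 6 * s ^+ 2 * (2^-1 * p * e) = (3 * s ^+ 2) * (p * e) by field.
by apply: ler_wpM2r => //; exact: mulr_ge0.
Qed.

Lemma integrable_normal_pdfM (h : R -> R) (C : R) : measurable_fun setT h ->
  (forall x, `|h x| <= C * (1 + (x - m) ^+ 2)) ->
  mu.-integrable setT (EFin \o (fun x => h x * normal_pdf m s x)).
Proof.
move=> mh hC.
have C0 : 0 <= C.
  have := hC m; rewrite subrr expr0n/= addr0 mulr1; exact: le_trans.
have i1 : mu.-integrable setT (EFin \o (fun x => C * normal_pdf m s x +
    C * (6 * s ^+ 2) * normal_pdf m (2 * s) x)).
  have e t c : mu.-integrable [set: R] (EFin \o (fun x => c * normal_pdf m t x)).
    exact: (integrableZl _ _ (integrable_normal_pdf m t)).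
  exact: integrableD (e _ _) (e _ _).
apply: le_integrable i1 => //.
  apply/measurable_EFinP; apply: measurable_funM => //.
  exact: measurable_normal_pdf.
move=> x _ /=; rewrite lee_fin normrM (ger0_norm (normal_pdf_ge0 _ _ _)).
apply: (le_trans _ (ler_norm _)).
apply: (@le_trans _ _ (C * (1 + (x - m) ^+ 2) * normal_pdf m s x)).
  by apply: ler_wpM2r => //; exact: normal_pdf_ge0.
have := normal_pdf_sqr_le x.
move=> /(ler_wpM2l C0); lra.
Qed.

(** Once [|u n - m| >= 1], [normal_pdf_sqr_le] bounds the product times [|u n - m|] by the constant
    [K], so the product is at most [K / |u n - m|]. *)
Lemma normal_pdf_decay (h : R -> R) (C : R) (u : R^nat) :
  (forall x, `|h x| <= C * (1 + `|x - m|)) ->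
  (forall n, n%:R <= `|u n|) ->
  h (u n) * normal_pdf m s (u n) @[n --> \oo] --> 0.
Proof.
move=> hC un.
have C0 : 0 <= C.
  have := hC m; rewrite subrr normr0 addr0 mulr1; exact: le_trans.
pose K := 2 * C * (6 * s ^+ 2 * normal_peak (2 * s)).
have K0 : 0 <= K.
  apply: mulr_ge0; first by rewrite mulr_ge0.
  by rewrite mulr_ge0 ?normal_peak_ge0// mulr_ge0// ltW.
apply/cvgr0Pnorm_le => e e0.
near=> n.
have bign : `|m| + 1 + K / e <= `|u n|.
  by apply: le_trans (un n); near: n; exact: nbhs_infty_ger.
have un1 : 1 + K / e <= `|u n - m|.
  by have := ler_normD (u n - m) m; rewrite subrK; lra.
have K1 : 0 <= K / e by rewrite divr_ge0// ltW.
set v := u n in un1 *.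
have v0 : 0 < `|v - m| by lra.
rewrite normrM (ger0_norm (normal_pdf_ge0 _ _ _)).
have h1 : `|h v| <= 2 * C * `|v - m|.
  apply: le_trans (hC v) _; rewrite [2 * C]mulrC -mulrA.
  by apply: ler_wpM2l => //; lra.
have h2 : (v - m) ^+ 2 * normal_pdf m s v <= 6 * s ^+ 2 * normal_peak (2 * s).
  apply: le_trans (normal_pdf_sqr_le v) _.
  apply: ler_wpM2l; first by rewrite mulr_ge0// ltW.
  by apply: normal_pdf_ub; rewrite mulf_neq0.
have h3 : `|h v| * normal_pdf m s v * `|v - m| <= K.
  apply: (@le_trans _ _ (2 * C * ((v - m) ^+ 2 * normal_pdf m s v))).
    rewrite -[(v - m) ^+ 2]real_normK ?num_real// expr2.
    rewrite (_ : 2 * C * _ = 2 * C * `|v - m| * normal_pdf m s v * `|v - m|); last ring.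
    by apply: ler_wpM2r => //; apply: ler_wpM2r => //; exact: normal_pdf_ge0.
  by apply: ler_wpM2l => //; rewrite mulr_ge0.
have h4 : K <= e * `|v - m|.
  by rewrite mulrC -ler_pdivrMr//; lra.
by rewrite -(ler_pM2r v0); exact: le_trans h3 h4.
Unshelve. all: end_near. Qed.

(** The function [h * normal_pdf] has derivative [(h' - (x - m) h / s^2) normal_pdf] and vanishes at
    infinity, so that derivative has integral 0. *)
Lemma normal_prob_stein (h h' : R -> R) (C : R) :
  (forall x : R, is_derive x 1 h (h' x)) -> continuous h' ->
  (forall x, `|h x| <= C * (1 + `|x - m|)) -> (forall x, `|h' x| <= C) ->
  (\int[normal_prob m s]_x ((x - m) * h x) =
   s ^+ 2 * \int[normal_prob m s]_x h' x)%R.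
Proof.
move=> dh ch' hC h'C.
have C0 : 0 <= C by exact: le_trans (h'C 0).
have ch : continuous h.
  by move=> x; apply: differentiable_continuous; apply/derivable1_diffP.
have cg : continuous (normal_pdf m s) by exact: continuous_normal_pdf.
have cxm : continuous (fun x : R => x - m).
  by move=> x; apply: cvgB; [exact: cvg_id|exact: cvg_cst].
have mxh : measurable_fun [set: R] (fun x : R => (x - m) * h x).
  apply: continuous_measurable_fun => x; apply: cvgM; [exact: cxm|exact: ch].
have mh' : measurable_fun [set: R] h' by exact: continuous_measurable_fun.
have i1 : mu.-integrable setT (EFin \o (fun x => (x - m) * h x * normal_pdf m s x)).
  apply: (@integrable_normal_pdfM _ (2 * C)) => // x.
  rewrite normrM; have := hC x; set y := `|x - m|.
  rewrite -[(x - m) ^+ 2]real_normK ?num_real// -/y => hy.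
  have y0 : 0 <= y by exact: normr_ge0.
  apply: (@le_trans _ _ (y * (C * (1 + y)))); first exact: ler_wpM2l.
  have : 0 <= C * ((1 - y) ^+ 2 + (y + 1)).
    by rewrite mulr_ge0// addr_ge0 ?sqr_ge0// addr_ge0.
  lra.
have i2 : mu.-integrable setT (EFin \o (fun x => h' x * normal_pdf m s x)).
  apply: (@integrable_normal_pdfM _ C) => // x; apply: le_trans (h'C x) _.
  by rewrite ler_peMr// lerDl sqr_ge0.
rewrite !integral_normal_prob//.
pose F x := h x * normal_pdf m s x.
pose f x := h' x * normal_pdf m s x - (s ^+ 2)^-1 * ((x - m) * h x * normal_pdf m s x).
have i3 : mu.-integrable [set: R]
    (EFin \o (fun x => (s ^+ 2)^-1 * ((x - m) * h x * normal_pdf m s x))).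
  exact: (integrableZl _ _ i1).
have : (\int[mu]_x f x = 0)%R.
  apply: (@Rintegral_derivative_eq0 _ F f).
  - move=> x; have := is_deriveM (dh x) (is_derive_normal_pdf x) => d.
    apply: (is_derive_eq d).
    by rewrite /f /GRing.scale/=; field.
  - move=> x; apply: cvgB.
      by apply: cvgM; [exact: ch'|exact: cg].
    apply: cvgM; first exact: cvg_cst.
    by apply: cvgM; [apply: cvgM; [exact: cxm|exact: ch]|exact: cg].
  - exact: (integrableB measurableT i2 i3).
  - by apply: (normal_pdf_decay hC) => n; rewrite ger0_norm.
  - by apply: (normal_pdf_decay hC) => n; rewrite normrN ger0_norm.
rewrite /f RintegralB// RintegralZl// => /eqP; rewrite subr_eq0 => /eqP ->.
by field.
Qed.

End stein.

Section gaussian_transfer.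
Context {R : realType} {disp : measure_display} {T : measurableType disp}.
Variables (P : probability T R) (W : T -> R) (m s : R).
Hypothesis mW0 : measurable_fun setT W.
Hypothesis lawW : forall A : set R, measurable A ->
  P (W @^-1` A) = gaussian_law m s A.

(* The Borel structures on [R] and on [measurableTypeR R] have the same
   measurable sets but are not convertible; [normal_prob] lives on the latter. *)
Let mW : measurable_fun setT (W : T -> measurableTypeR R).
Proof. exact: mW0. Qed.

Let W_mixin := isMeasurableFun.Build _ _ _ _ _ mW.
Let W' : {mfun T >-> measurableTypeR R} :=
  HB.pack (W : T -> measurableTypeR R) W_mixin.

Let law0 : s = 0 -> forall A : set (measurableTypeR R), measurable A ->
  distribution P W' A = \d_m A.
Proof. by move=> s0 A mA; rewrite [LHS]lawW// /gaussian_law s0 eqxx. Qed.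

Let law1 : s != 0 -> forall A : set (measurableTypeR R), measurable A ->
  distribution P W' A = normal_prob m s A.
Proof. by move=> s0 A mA; rewrite [LHS]lawW// /gaussian_law (negbTE s0). Qed.

Lemma ge0_gaussian_integral (h : R -> \bar R) : measurable_fun [set: R] h ->
  (forall x, 0 <= h x)%E ->
  (\int[P]_w h (W w) = if s == 0%R then h m else \int[normal_prob m s]_x h x)%E.
Proof.
move=> mh h0; rewrite -(ge0_integral_distribution W' mh h0).
case: ifPn => [/eqP s0|s0].
- rewrite (eq_measure_integral (@dirac _ (measurableTypeR R) m R)).
    by rewrite integral_dirac// diracT mul1e.
  by move=> A mA _; exact: law0.
- by apply: eq_measure_integral => A mA _; exact: law1.
Qed.

Lemma gaussian_integrable (h : R -> R) : measurable_fun [set: R] h ->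
  (s != 0 -> (normal_prob m s).-integrable setT (EFin \o h)) ->
  P.-integrable setT (EFin \o (h \o W)).
Proof.
move=> mh ih; apply/integrableP; split.
  by apply/measurable_EFinP; exact: measurableT_comp.
have mah : measurable_fun [set: R] (fun x => `|(h x)%:E|%E).
  by apply: measurableT_comp => //; exact/measurable_EFinP.
have -> := ge0_gaussian_integral mah (fun=> abse_ge0 _).
case: ifPn => [_|/ih /integrableP[_]//]; exact: ltry.
Qed.

Lemma gaussian_Rintegral (h : R -> R) : measurable_fun [set: R] h ->
  (s != 0 -> (normal_prob m s).-integrable setT (EFin \o h)) ->
  (\int[P]_w h (W w) = if s == 0 then h m else \int[normal_prob m s]_x h x)%R.
Proof.
move=> mh ih; rewrite /Rintegral.
have mEh : measurable_fun [set: R] (EFin \o h) by exact/measurable_EFinP.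
rewrite -[integral P _ _](integral_distribution (X := W') mEh (gaussian_integrable mh ih)).
case: ifPn => [/eqP s0|s0].
- rewrite (eq_measure_integral (@dirac _ (measurableTypeR R) m R)).
    by rewrite integral_dirac// diracT mul1e.
  by move=> A mA _; exact: law0.
- by congr fine; apply: eq_measure_integral => A mA _; exact: law1.
Qed.

End gaussian_transfer.

Section normal_moments.
Context {R : realType}.
Local Notation mu := (@lebesgue_measure R).
Variables (m s : R).
Hypothesis s0 : s != 0.

Let C1 (C : R) : 0 <= C -> forall x, C <= C * (1 + (x - m) ^+ 2).
Proof. by move=> C0 x; rewrite ler_peMr// lerDl sqr_ge0. Qed.

Lemma integrable_normal_prob_quad (h : R -> R) (C : R) :
  measurable_fun [set: R] h -> (forall x, `|h x| <= C * (1 + (x - m) ^+ 2)) ->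
  (normal_prob m s).-integrable setT (EFin \o h).
Proof.
by move=> mh hC; apply/integrable_normal_prob => //; exact: integrable_normal_pdfM hC.
Qed.

Lemma measurable_subm : measurable_fun [set: R] (fun x : R => x - m).
Proof. by apply: measurable_funB. Qed.

Lemma normal_prob_mean : (\int[normal_prob m s]_x (x - m) = 0)%R.
Proof.
have := @normal_prob_stein _ m s s0 (cst 1) (cst 0) 1.
rewrite (_ : (fun x => (x - m) * cst 1 x) = (fun x => x - m)); last first.
  by apply/funext => x; rewrite /= mulr1.
move=> ->.
- by rewrite Rintegral_cst// mul0r mulr0.
- by move=> x; exact: cvg_cst.
- by move=> x; rewrite normr1 mul1r lerDl.
- by move=> x; rewrite normr0.
Qed.

Lemma normal_prob_variance : (\int[normal_prob m s]_x ((x - m) * (x - m)) = s ^+ 2)%R.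
Proof.
transitivity (s ^+ 2 * \int[normal_prob m s]_x cst 1 x).
  apply: (@normal_prob_stein _ m s s0 (fun x => x - m) (cst 1) 1).
  - move=> x; have d := is_deriveB (is_derive_id x 1) (is_derive_cst m x 1).
    by apply: (is_derive_eq d); rewrite subr0.
  - by move=> x; exact: cvg_cst.
  - by move=> x; rewrite mul1r lerDr.
  - by move=> x; rewrite normr1.
by rewrite Rintegral_cst//= probability_setT/= !mulr1.
Qed.

(* The function [xi |-> int cos (xi (x - m) + c)] solves [C' = - s^2 xi C]. *)
Lemma normal_prob_cos (xi c : R) :
  (\int[normal_prob m s]_x cos (xi * (x - m) + c) =
   cos c * expR (- (s ^+ 2 * xi ^+ 2 / 2)))%R.
Proof.
pose f (t x : R) := cos (t * (x - m) + c).
pose C t := (\int[normal_prob m s]_x f t x)%R.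
have dx (t x : R) : is_derive t 1 (fun t => t * (x - m) + c) (x - m).
  apply: is_derive_eq.
  by rewrite /GRing.scale/= !(scaler0, mulr1, mulr0, add0r, addr0).
have dt (t x : R) : is_derive x 1 (fun x => t * (x - m) + c) t.
  apply: is_derive_eq.
  by rewrite /GRing.scale/= !(scaler0, mulr1, mulr0, add0r, addr0, subr0).
have df (t x : R) : is_derive t 1 (f ^~ x) (- sin (t * (x - m) + c) * (x - m)).
  exact: (@is_derive1_comp _ cos _ _ _ _ (is_derive_cos _) (dx t x)).
have ct (t : R) : continuous (fun x : R => t * (x - m) + c).
  by move=> x; apply: differentiable_continuous; apply/derivable1_diffP.
have mcos t : measurable_fun [set: R] (f t).
  apply: continuous_measurable_fun => x.
  by apply: continuous_comp; [exact: ct|exact: continuous_cos].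
have If t : (normal_prob m s).-integrable setT (EFin \o f t).
  apply: (@integrable_normal_prob_quad _ 1) => // x.
  by apply: le_trans (C1 ler01 x); rewrite ler_norml cos_geN1 cos_le1.
have d1E (t x : R) : partial1of2 f t x = - sin (t * (x - m) + c) * (x - m).
  by rewrite /partial1of2 derive1E; exact: derive_val.
have IG : (normal_prob m s).-integrable setT (EFin \o (fun x => `|x - m|)).
  apply: (@integrable_normal_prob_quad _ 1) => [|x].
    by apply: measurableT_comp => //; exact: measurable_subm.
  rewrite normr_id mul1r -[(x - m) ^+ 2]real_normK ?num_real//.
  by have := sqr_ge0 (`|x - m| - 2^-1); lra.
(* The left side is minus the derivative of [C], taken under the integral sign; Stein's identity for
   the sine expresses it through [C] again. *)
have stein t : (\int[normal_prob m s]_x ((x - m) * sin (t * (x - m) + c)) = s ^+ 2 * (t * C t))%R.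
  rewrite /C -(RintegralZl t measurableT (If t)).
  apply: (@normal_prob_stein _ m s s0 _ (fun x => t * f t x) (1 + `|t|)).
  - move=> x; rewrite mulrC.
    exact: (@is_derive1_comp _ sin _ _ _ _ (is_derive_sin _) (dt t x)).
  - move=> x; apply: cvgM; first exact: cvg_cst.
    by apply: continuous_comp; [exact: ct|exact: continuous_cos].
  - move=> x; apply: (@le_trans _ _ 1).
      by rewrite ler_norml sin_geN1 sin_le1.
    by have := normr_ge0 t; have := normr_ge0 (x - m); nra.
  - move=> x; rewrite normrM.
    have : `|f t x| <= 1 by rewrite ler_norml cos_geN1 cos_le1.
    by have := normr_ge0 t; nra.
have dC (t : R) : is_derive t 1 C (- (s ^+ 2 * (t * C t))).
  have It : `](t - 1), (t + 1)[%classic t.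
    by rewrite /= in_itv/=; lra.
  have H := @derivable_under_integral _ _ _ (normal_prob m s) f setT measurableT t _ _ It
    (fun x _ => If x) (fun x y _ _ => @ex_derive _ _ _ _ _ _ _ (df x y))
    (fun y => `|y - m|) (fun=> normr_ge0 _) IG.
  have H' := @differentiation_under_integral _ _ _ (normal_prob m s) f setT measurableT t _ _ It
    (fun x _ => If x) (fun x y _ _ => @ex_derive _ _ _ _ _ _ _ (df x y))
    (fun y => `|y - m|) (fun=> normr_ge0 _) IG.
  have ub (x y : R) : `](t - 1), (t + 1)[%classic x -> setT y ->
      `|partial1of2 f x y| <= `|y - m|.
    move=> _ _; rewrite d1E normrM normrN ler_piMl//.
    by rewrite ler_norml sin_geN1 sin_le1.
  apply: DeriveDef; first exact: H.
  rewrite -derive1E H'// -stein.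
  under eq_Rintegral do rewrite d1E mulNr mulrC -mulN1r.
  rewrite RintegralZl ?mulN1r//.
  apply: (le_integrable _ _ _ IG) => //.
    apply/measurable_EFinP; apply: measurable_funM; first exact: measurable_subm.
    apply: continuous_measurable_fun => x.
    by apply: continuous_comp; [exact: ct|exact: continuous_sin].
  move=> x _ /=; rewrite lee_fin normr_id normrM ler_piMr//.
  by rewrite ler_norml sin_geN1 sin_le1.
(* The exponential is the integrating factor of the equation, so the product keeps its value [cos c]
   at 0. *)
have dE (t : R) : is_derive t 1 (fun t => C t * expR (s ^+ 2 * t ^+ 2 / 2)) 0.
  have e1 : is_derive t 1 (fun t : R => s ^+ 2 * t ^+ 2 / 2) (s ^+ 2 * t).
    apply: is_derive_eq.
    by rewrite /GRing.scale/= !(scaler0, mulr1, mulr0, add0r, addr0); field.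
  have e2 := @is_derive1_comp _ expR _ _ _ _ (is_derive_expR _) e1.
  have d := is_deriveM (dC t) e2; apply: (is_derive_eq d).
  by rewrite /GRing.scale/=; ring.
have := is_derive_0_is_cst xi 0 dE.
rewrite expr0n/= mulr0 mul0r expR0 mulr1 => CE.
have C0 : C 0 = cos c.
  rewrite /C (@eq_Rintegral _ _ _ _ _ (cst (cos c))); last first.
    by move=> x _; rewrite /f mul0r add0r.
  by rewrite Rintegral_cst//= probability_setT/= mulr1.
by rewrite expRN -C0 -CE mulfK// gt_eqF// expR_gt0.
Qed.

End normal_moments.

Section gaussian_variable.
Context {R : realType} {disp : measure_display} {T : measurableType disp}.
Variables (P : probability T R) (W : T -> R) (m s : R).
Hypothesis mW : measurable_fun setT W.
Hypothesis lawW : forall A : set R, measurable A ->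
  P (W @^-1` A) = gaussian_law m s A.

Let quad (h : R -> R) (C : R) : measurable_fun [set: R] h ->
  (forall x, `|h x| <= C * (1 + (x - m) ^+ 2)) ->
  s != 0 -> (normal_prob m s).-integrable setT (EFin \o h).
Proof. by move=> mh hC s0; exact: integrable_normal_prob_quad hC. Qed.

Lemma gaussian_integrable_id : P.-integrable setT (EFin \o W).
Proof.
apply: (gaussian_integrable mW lawW (h := id)) => //.
apply: (@quad _ (1 + `|m|)) => // x.
have h1 := ler_normD (x - m) m; rewrite subrK in h1.
rewrite -[(x - m) ^+ 2]real_normK ?num_real//.
have := normr_ge0 (x - m); have := normr_ge0 m.
have := sqr_ge0 (`|x - m| - 2^-1); nra.
Qed.

Lemma gaussian_integrable_sqr : P.-integrable setT (EFin \o (fun w => W w * W w)).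
Proof.
apply: (gaussian_integrable mW lawW (h := fun x => x * x)).
  by apply: measurable_funM.
apply: (@quad _ (2 * (1 + m ^+ 2))); first by apply: measurable_funM.
move=> x; rewrite ger0_norm -?expr2 ?sqr_ge0//.
by have := sqr_ge0 (x - m - m); have := sqr_ge0 m; have := sqr_ge0 (x - m); nra.
Qed.

Lemma gaussian_mean : (\int[P]_w W w = m)%R.
Proof.
have i1 : P.-integrable setT (EFin \o (fun w => W w - m)).
  exact: (integrableB _ gaussian_integrable_id (finite_measure_integrable_cst _ _ _)).
suff : (\int[P]_w (W w - m) = 0)%R.
  rewrite RintegralB//; last 2 first.
  - exact: gaussian_integrable_id.
  - exact: finite_measure_integrable_cst.
  by rewrite Rintegral_cst//= probability_setT/= mulr1 => /subr0_eq.
rewrite (gaussian_Rintegral mW lawW (h := fun x => x - m)).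
- by case: ifPn => [_|s0]; [rewrite subrr|exact: normal_prob_mean].
- exact: measurable_subm.
- apply: (@quad _ 1); first exact: measurable_subm.
  move=> x; rewrite mul1r -[(x - m) ^+ 2]real_normK ?num_real//.
  by have := sqr_ge0 (`|x - m| - 2^-1); lra.
Qed.

Lemma gaussian_sqr : m = 0 -> (\int[P]_w (W w * W w) = s ^+ 2)%R.
Proof.
move=> m0.
rewrite (gaussian_Rintegral mW lawW (h := fun x => x * x)).
- case: ifPn => [/eqP ->|s0]; first by rewrite m0 mul0r expr0n.
  rewrite -(normal_prob_variance m s0).
  by apply: eq_Rintegral => x _; rewrite m0 !subr0.
- by apply: measurable_funM.
- apply: (@quad _ 1); first by apply: measurable_funM.
  by move=> x; rewrite m0 subr0 ger0_norm -?expr2 ?sqr_ge0// mul1r lerDr.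
Qed.

Lemma gaussian_cos (c : R) : m = 0 ->
  (\int[P]_w cos (W w + c) = cos c * expR (- (s ^+ 2 / 2)))%R.
Proof.
move=> m0.
have mc : measurable_fun [set: R] (fun x : R => cos (x + c)).
  apply: continuous_measurable_fun => x.
  apply: continuous_comp; last exact: continuous_cos.
  by apply: cvgD; [exact: cvg_id|exact: cvg_cst].
rewrite (gaussian_Rintegral mW lawW (h := fun x => cos (x + c)))//.
- case: ifPn => [/eqP ->|s0].
    by rewrite m0 add0r expr0n/= mul0r oppr0 expR0 mulr1.
  have := normal_prob_cos m s0 1 c; rewrite expr1n mulr1 => <-.
  by apply: eq_Rintegral => x _; rewrite m0 subr0 mul1r.
- apply: (@quad _ 1) => // x; apply: (@le_trans _ _ 1).
    by rewrite ler_norml cos_geN1 cos_le1.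
  by rewrite mul1r lerDl sqr_ge0.
Qed.

End gaussian_variable.

(** * Two-point probabilities from characteristic functions *)

Section gaussian_kernel.
Context {R : realType}.
Local Notation mu := (@lebesgue_measure R).
Local Notation N := (normal_prob (0 : R) 1).

Lemma measurable_cosM (y c : R) : measurable_fun [set: R] (fun u : R => cos (u * y + c)).
Proof.
apply: continuous_measurable_fun => u.
apply: continuous_comp; last exact: continuous_cos.
by apply: cvgD; [apply: cvgM; [exact: cvg_id|exact: cvg_cst]|exact: cvg_cst].
Qed.

Lemma cos_norm_le1 (x : R) : `|cos x| <= 1.
Proof. by rewrite ler_norml cos_geN1 cos_le1. Qed.

(** The characteristic function of the standard normal law read backwards: a Gaussian kernel is an
    average of cosines, whose expectations under the process are computable. *)
Lemma expR_mix_cos (z : R) : expR (- z ^+ 2 / 2) = (\int[N]_u cos (u * z))%R.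
Proof.
have := @normal_prob_cos R 0 1 (oner_neq0 _) z 0.
rewrite cos0 mul1r expr1n mul1r mulNr => <-.
by apply: eq_Rintegral => u _; rewrite subr0 addr0 mulrC.
Qed.

(** The damping factor times the standard density is [s] times the centered normal density of
    deviation [s = (1 + k^2)^(-1/2)]; what remains is the characteristic function of that law. *)
Lemma damped_mix_cos (k y : R) :
  (\int[N]_u (cos (u * y) * expR (- (u ^+ 2 * k ^+ 2 / 2))) =
   (Num.sqrt (1 + k ^+ 2))^-1 * expR (- y ^+ 2 / (2 * (1 + k ^+ 2))))%R.
Proof.
have k1 : 0 < 1 + k ^+ 2 by rewrite ltr_pwDl// sqr_ge0.
pose s := (Num.sqrt (1 + k ^+ 2))^-1.
have s_gt0 : 0 < s by rewrite invr_gt0 sqrtr_gt0.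
have s0 : s != 0 by rewrite gt_eqF.
have s2 : s ^+ 2 = (1 + k ^+ 2)^-1 by rewrite exprVn sqr_sqrtr// ltW.
have mc : measurable_fun [set: R] (fun u : R => cos (u * y)).
  by have := measurable_cosM y 0; under eq_fun do rewrite addr0.
have me : measurable_fun [set: R] (fun u : R => expR (- (u ^+ 2 * k ^+ 2 / 2))).
  apply: measurableT_comp => //; apply: measurableT_comp => //.
  by apply: measurable_funM => //; apply: measurable_funM.
have pdfE u : cos (u * y) * expR (- (u ^+ 2 * k ^+ 2 / 2)) * normal_pdf 0 1 u =
    s * (cos (u * y) * normal_pdf 0 s u).
  rewrite !normal_pdfE// ?oner_neq0// /normal_fun /normal_peak.
  rewrite expr1n mul1r subr0 s2.
  have -> : Num.sqrt ((1 + k ^+ 2)^-1 * pi *+ 2) = s * Num.sqrt (pi *+ 2).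
    rewrite -mulrnAr sqrtrM ?invr_ge0 1?ltW//; congr (_ * _).
    by rewrite -s2 sqrtr_sqr gtr0_norm.
  have -> : - u ^+ 2 / ((1 + k ^+ 2)^-1 *+ 2) = - (u ^+ 2 * k ^+ 2 / 2) + - u ^+ 2 / 2.
    by field; rewrite gt_eqF.
  rewrite expRD invfM -[LHS]mul1r -(mulfV s0); ring.
have b1 x : 1 <= 1 * (1 + (x - 0) ^+ 2) :> R by rewrite mul1r lerDl sqr_ge0.
have ic : mu.-integrable setT (EFin \o (fun u => cos (u * y) * normal_pdf 0 s u)).
  apply: (@integrable_normal_pdfM _ 0 s s0 _ 1) => // x.
  by apply: le_trans (b1 x); exact: cos_norm_le1.
rewrite integral_normal_prob; last 2 first.
- exact: measurable_funM.
- apply: (@integrable_normal_pdfM _ 0 1 (oner_neq0 _) _ 1).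
    exact: measurable_funM.
  move=> x; apply: le_trans (b1 x); rewrite normrM.
  rewrite mulr_ile1 ?cos_norm_le1// ger0_norm ?expR_ge0// -expR0 ler_expR oppr_le0.
  by rewrite divr_ge0// mulr_ge0 ?sqr_ge0.
under eq_Rintegral do rewrite pdfE.
rewrite RintegralZl// -integral_normal_prob//.
have := normal_prob_cos 0 s0 y 0.
rewrite cos0 mul1r s2 => h.
rewrite -/s; congr (_ * _).
transitivity (\int[normal_prob 0 s]_x cos (y * (x - 0) + 0)).
  by apply: eq_Rintegral => u _; rewrite subr0 addr0 mulrC.
by rewrite h; congr expR; field; rewrite gt_eqF.
Qed.

End gaussian_kernel.

Section Rfubini.
Context {R : realType} {d1 d2 : measure_display}.
Context {T1 : measurableType d1} {T2 : measurableType d2}.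
Variables (P1 : probability T1 R) (P2 : probability T2 R).
Variable f : T1 * T2 -> R.
Hypothesis mf : measurable_fun setT f.
Hypothesis f1 : forall z, `|f z| <= 1.

Let int_f : (P1 \x P2)%E.-integrable setT (EFin \o f).
Proof.
apply/integrable12ltyP; first exact/measurable_EFinP.
apply: (@le_lt_trans _ _ (\int[P1]_x \int[P2]_y (cst 1%E y))%E).
  have mn : measurable_fun setT (fun z : T1 * T2 => `|(f z)%:E|%E).
    by apply: measurableT_comp => //; exact/measurable_EFinP.
  apply: ge0_le_integral => //.
  - by move=> x _; exact: integral_ge0.
  - exact: (measurable_fun_fubini_tonelli_F (fun z => `|(f z)%:E|%E)).
  move=> x _; apply: ge0_le_integral => //.
  - exact: (measurableT_comp mn).
  - by move=> y _; rewrite lee_fin.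
have I1 d (S : measurableType d) (Q : probability S R) :
    (\int[Q]_y cst 1%E y)%E = 1%E :> \bar R.
  by rewrite integral_cst//= probability_setT mule1.
by under eq_integral do rewrite I1; rewrite I1 ltry.
Qed.

Lemma bounded_Rfubini :
  (\int[P1]_x \int[P2]_y f (x, y) = \int[P2]_y \int[P1]_x f (x, y))%R.
Proof.
have E1 x : (\int[P2]_y f (x, y))%:E = (\int[P2]_y (f (x, y))%:E)%E.
  rewrite /Rintegral fineK//; apply: integrable_fin_num => //.
  apply: (@le_integrable _ _ _ P2 setT _ _ (cst 1%E)) => //.
  - by apply/measurable_EFinP; exact: (measurableT_comp mf).
  - by move=> y _; rewrite /= normr1 lee_fin.
  - exact: (finite_measure_integrable_cst _ 1).
have E2 y : (\int[P1]_x f (x, y))%:E = (\int[P1]_x (f (x, y))%:E)%E.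
  rewrite /Rintegral fineK//; apply: integrable_fin_num => //.
  apply: (@le_integrable _ _ _ P1 setT _ _ (cst 1%E)) => //.
  - by apply/measurable_EFinP; exact: (measurableT_comp mf).
  - by move=> x _; rewrite /= normr1 lee_fin.
  - exact: (finite_measure_integrable_cst _ 1).
rewrite [LHS]/Rintegral [RHS]/Rintegral; congr fine.
under eq_integral do rewrite E1.
under [RHS]eq_integral do rewrite E2.
exact: (Fubini int_f).
Qed.

End Rfubini.

Section uncorrelated_pair.
Context {R : realType} {disp : measure_display} {T : measurableType disp}.
Variable P : probability T R.
Local Notation N := (normal_prob (0 : R) 1).

Let bounded_integrable (h : T -> R) : measurable_fun setT h ->
  (forall w, `|h w| <= 1) -> P.-integrable setT (EFin \o h).
Proof.
move=> mh h1; apply: (@le_integrable _ _ _ P setT _ _ (cst 1%E)) => //.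
- exact/measurable_EFinP.
- by move=> w _; rewrite /= normr1 lee_fin.
- exact: (finite_measure_integrable_cst _ 1).
Qed.

Let gauss_le1 (z : R) : 0 <= expR (- z ^+ 2 / 2) <= 1.
Proof.
rewrite expR_ge0/= -expR0 ler_expR mulNr oppr_le0.
by rewrite divr_ge0// sqr_ge0.
Qed.

Let measurable_cosX (Z : T -> R) (u : R) : measurable_fun setT Z ->
  measurable_fun setT (fun w => cos (u * Z w)).
Proof.
move=> mZ; apply: (@measurableT_comp _ _ _ _ _ _ (fun x : R => cos (u * x))) => //.
apply: continuous_measurable_fun => x.
apply: continuous_comp; last exact: continuous_cos.
by apply: cvgM; [exact: cvg_cst|exact: cvg_id].
Qed.

Let measurable_gaussX (Z : T -> R) : measurable_fun setT Z ->
  measurable_fun setT (fun w => expR (- Z w ^+ 2 / 2)).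
Proof.
move=> mZ; apply: measurableT_comp => //; apply: measurable_funM => //.
by apply: measurableT_comp => //; exact: measurable_funX.
Qed.

(** The bounded factor [U] allows the formula to be applied twice, once to each of two kernels. *)
Lemma integral_gauss_mix (U Z : T -> R) :
  measurable_fun setT U -> (forall w, `|U w| <= 1) -> measurable_fun setT Z ->
  (\int[P]_w (U w * expR (- Z w ^+ 2 / 2)) =
   \int[N]_u \int[P]_w (U w * cos (u * Z w)))%R.
Proof.
move=> mU U1 mZ.
have mc : measurable_fun setT (fun z : T * R => cos (z.2 * Z z.1)).
  have : measurable_fun [set: R] (cos : R -> R).
    by apply: continuous_measurable_fun; exact: continuous_cos.
  move=> h; apply: (measurableT_comp h).
  apply: measurable_funM; first exact: measurable_snd.
  by apply: measurableT_comp mZ _; exact: measurable_fst.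
pose f (z : T * measurableTypeR R) := U z.1 * cos (z.2 * Z z.1).
rewrite -(@bounded_Rfubini R _ _ _ _ P N f).
- apply: eq_Rintegral => w _; rewrite expR_mix_cos -RintegralZl//.
  have b1 x : 1 <= 1 * (1 + (x - 0) ^+ 2) :> R by rewrite mul1r lerDl sqr_ge0.
  apply: (@integrable_normal_prob_quad _ 0 1 (oner_neq0 _) _ 1) => [|x].
    by have := measurable_cosM (Z w) 0; under eq_fun do rewrite addr0.
  by apply: le_trans (b1 x); exact: cos_norm_le1.
- apply: measurable_funM; last exact: mc.
  by apply: measurableT_comp mU _; exact: measurable_fst.
- by move=> z; rewrite normrM mulr_ile1 ?cos_norm_le1.
Qed.

Variables (X D : T -> R) (s t : R).
Hypothesis (mX : measurable_fun setT X) (mD : measurable_fun setT D).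
(** The form in which independence of [X] and [D] enters, with centered normal laws of deviations
    [s] and [t]. The phase [c] carries the centers [x] and [y] of the balls. *)
Hypothesis char_XD : forall u v c : R,
  (\int[P]_w cos (u * X w + v * D w + c) =
   cos c * expR (- ((u ^+ 2 * s ^+ 2 + v ^+ 2 * t ^+ 2) / 2)))%R.

Let cos_cosE (a b : R) : cos a * cos b = 2^-1 * (cos (a + b) + cos (a - b)).
Proof. by rewrite cosB cosD; field. Qed.

Let measurable_XD (u v c : R) :
  measurable_fun setT (fun w => cos (u * X w + v * D w + c)).
Proof.
have mc : measurable_fun [set: R] (cos : R -> R).
  by apply: continuous_measurable_fun; exact: continuous_cos.
apply: (measurableT_comp mc); apply: measurable_funD => //.
by apply: measurable_funD; apply: measurable_funM.
Qed.

Lemma integral_cos_cos (a b x y : R) :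
  (\int[P]_w (cos (a * (X w - x)) * cos (b * (D w - y))) =
   cos (a * x) * expR (- (a ^+ 2 * s ^+ 2 / 2)) *
   (cos (b * y) * expR (- (b ^+ 2 * t ^+ 2 / 2))))%R.
Proof.
have e w : cos (a * (X w - x)) * cos (b * (D w - y)) =
    2^-1 * (cos (a * X w + b * D w + - (a * x + b * y)) +
            cos (a * X w + (- b) * D w + - (a * x - b * y))).
  by rewrite cos_cosE; congr (_ * (cos _ + cos _)); ring.
under eq_Rintegral do rewrite e.
have i u v c : P.-integrable setT (EFin \o (fun w => cos (u * X w + v * D w + c))).
  by apply: bounded_integrable => // w; exact: cos_norm_le1.
rewrite RintegralZl//; last exact: (integrableD _ (i _ _ _) (i _ _ _)).
rewrite RintegralD// !char_XD !cosN sqrrN cosB cosD.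
set A := a ^+ 2 * _; set B := b ^+ 2 * _.
have -> : - ((A + B) / 2) = - (A / 2) + - (B / 2) by field.
by rewrite expRD; field.
Qed.

(** Each kernel in turn becomes an average of cosines while the other factor serves as bounded
    weight; the mean of the product of two cosines factorizes, and so does the double average. *)
Lemma integral_gauss_gauss (r q x y : R) : r != 0 -> q != 0 ->
  (\int[P]_w (expR (- ((X w - x) / r) ^+ 2 / 2) * expR (- ((D w - y) / q) ^+ 2 / 2)) =
   (Num.sqrt (1 + (s / r) ^+ 2))^-1 *
     expR (- (x / r) ^+ 2 / (2 * (1 + (s / r) ^+ 2))) *
   ((Num.sqrt (1 + (t / q) ^+ 2))^-1 *
     expR (- (y / q) ^+ 2 / (2 * (1 + (t / q) ^+ 2)))))%R.
Proof.
move=> r0 q0.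
have mX' : measurable_fun setT (fun w => (X w - x) / r).
  by apply: measurable_funM => //; exact: measurable_funB.
have mD' : measurable_fun setT (fun w => (D w - y) / q).
  by apply: measurable_funM => //; exact: measurable_funB.
have inorm k z : N.-integrable setT
    (EFin \o (fun u : R => cos (u * z) * expR (- (u ^+ 2 * k ^+ 2 / 2)))).
  apply: (@integrable_normal_prob_quad _ 0 1 (oner_neq0 _) _ 1).
    apply: measurable_funM.
      by have := measurable_cosM z 0; under eq_fun do rewrite addr0.
    apply: measurableT_comp => //; apply: measurableT_comp => //.
    by apply: measurable_funM => //; apply: measurable_funM.
  move=> u; apply: (@le_trans _ _ 1); last by rewrite mul1r lerDl sqr_ge0.
  rewrite normrM mulr_ile1 ?cos_norm_le1// ger0_norm ?expR_ge0//.
  by rewrite -expR0 ler_expR oppr_le0 divr_ge0// mulr_ge0 ?sqr_ge0.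
under eq_Rintegral do rewrite mulrC.
rewrite integral_gauss_mix//; last 2 first.
- exact: measurable_gaussX.
- by move=> w; have /andP[h1 h2] := gauss_le1 ((D w - y) / q); rewrite ger0_norm.
rewrite -(damped_mix_cos (t / q) (y / q)) -(damped_mix_cos (s / r) (x / r)).
rewrite -RintegralZr//.
apply: eq_Rintegral => u _.
under eq_Rintegral do rewrite mulrC.
rewrite integral_gauss_mix//; last 2 first.
- exact: measurable_cosX.
- by move=> w; exact: cos_norm_le1.
rewrite -RintegralZl//.
apply: eq_Rintegral => v _.
transitivity (\int[P]_w (cos (u / r * (X w - x)) * cos (v / q * (D w - y)))).
  by apply: eq_Rintegral => w _; congr (cos _ * cos _); ring.
rewrite integral_cos_cos.
by congr (cos _ * expR _ * (cos _ * expR _)); ring.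
Qed.

(* Only the laws of linear combinations of [X] and [D] are known: the indicators are
   bounded by Gaussian kernels, and these are mixtures of cosines. *)
Lemma prob_pair_le (r q x y : R) : 0 < r -> 0 < q -> 0 < s ->
  (P [set w | (`|X w - x| <= r)%R /\ (`|D w - y| <= q)%R]%classic <=
   (expR 1 * (r / s) * ((Num.sqrt (1 + (t / q) ^+ 2))^-1 *
     expR (- (y / q) ^+ 2 / (2 * (1 + (t / q) ^+ 2)))))%:E)%E.
Proof.
move=> r0 q0 s0.
have mX' : measurable_fun setT (fun w => (X w - x) / r).
  by apply: measurable_funM => //; exact: measurable_funB.
have mD' : measurable_fun setT (fun w => (D w - y) / q).
  by apply: measurable_funM => //; exact: measurable_funB.
set A := [set w | _].
have mA : measurable A.
  have m1 (Z : T -> R) z e : measurable_fun setT Z -> measurable [set w | `|Z w - z| <= e].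
    move=> mZ; have mn : measurable_fun setT (fun w => `|Z w - z|).
      by apply: measurableT_comp => //; exact: measurable_funB.
    rewrite (_ : [set _ | _] = (fun w => `|Z w - z|) @^-1` `]-oo, e]).
      by rewrite -[X in measurable X]setTI; exact: mn.
    by apply/seteqP; split => w /=; rewrite in_itv.
  exact: measurableI (m1 _ x r mX) (m1 _ y q mD).
pose g w := expR (- ((X w - x) / r) ^+ 2 / 2) * expR (- ((D w - y) / q) ^+ 2 / 2).
have g1 w : `|g w| <= 1.
  rewrite /g normrM; have /andP[h1 h2] := gauss_le1 ((X w - x) / r).
  have /andP[h3 h4] := gauss_le1 ((D w - y) / q).
  by rewrite !ger0_norm// mulr_ile1.
have ig : P.-integrable setT (EFin \o g).
  by apply: bounded_integrable => //; apply: measurable_funM; exact: measurable_gaussX.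
have ig' : P.-integrable setT (EFin \o (fun w => expR 1 * g w)).
  exact: (integrableZl _ _ ig).
have iA : P.-integrable setT (EFin \o (\1_A : T -> R)).
  apply: bounded_integrable => // w; rewrite indicE.
  by case: (_ \in _); rewrite ?normr1 ?normr0.
have PA : P A = (\int[P]_w (\1_A : T -> R) w)%:E.
  rewrite /Rintegral fineK; last exact: integrable_fin_num.
  by rewrite integral_indic// setIT.
rewrite PA lee_fin.
apply: (@le_trans _ _ (\int[P]_w (expR 1 * g w))).
  apply: le_Rintegral => // w _; rewrite indicE.
  have [/set_mem[/= hX hD]|_] := boolP (w \in A); last first.
    by rewrite mulr_ge0 ?expR_ge0// /g mulr_ge0 ?expR_ge0.
  (* On the event both kernels are at least [exp(-1/2)]; this is the origin of the factor
     [expR 1]. *)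
  have h (z e : R) : 0 < e -> `|z| <= e -> - 2^-1 <= - (z / e) ^+ 2 / 2.
    move=> e0 ze; rewrite mulNr lerN2 ler_pdivrMr// mulVf//.
    rewrite -[(z / e) ^+ 2]real_normK ?num_real// exprn_ile1// normrM.
    by rewrite normfV (gtr0_norm e0) ler_pdivrMr// mul1r.
  rewrite /g -!expRD/= -[leLHS]expR0 ler_expR.
  by have := h _ _ r0 hX; have := h _ _ q0 hD; lra.
rewrite RintegralZl// /g integral_gauss_gauss ?gt_eqF// -[leRHS]mulrA.
apply: ler_wpM2l; first exact: expR_ge0.
apply: ler_wpM2r.
  by rewrite mulr_ge0 ?expR_ge0// invr_ge0.
have sr0 : 0 < s / r by rewrite divr_gt0.
(* For the first coordinate only the prefactor is kept, with [1 + (s/r)^2 >= (s/r)^2]; its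
   exponential is bounded by 1. *)
rewrite -[leRHS]mulr1; apply: ler_pM; rewrite ?expR_ge0 ?invr_ge0//.
  rewrite -[leRHS]invrK lef_pV2 ?posrE ?sqrtr_gt0 ?invf_div//; last first.
    by rewrite ltr_pwDl// sqr_ge0.
  rewrite -[leLHS]gtr0_norm// -sqrtr_sqr ler_sqrt ?lerDr//.
  by rewrite addr_ge0// sqr_ge0.
rewrite -expR0 ler_expR mulNr oppr_le0 divr_ge0 ?sqr_ge0//.
by rewrite mulr_ge0// addr_ge0// sqr_ge0.
Qed.

End uncorrelated_pair.

(** * One-dimensional ball and tail estimates *)

Section gaussian_ball.
Context {R : realType} {disp : measure_display} {T : measurableType disp}.
Local Notation mu := (@lebesgue_measure R).
Variables (P : probability T R) (W : T -> R) (s : R).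
Hypothesis s_gt0 : 0 < s.
Hypothesis lawW : forall A : set R, measurable A ->
  P (W @^-1` A) = gaussian_law 0 s A.

Let s0 : s != 0. Proof. by rewrite gt_eqF. Qed.

Lemma normal_peak_le : normal_peak s <= (2 * s)^-1.
Proof.
rewrite /normal_peak lef_pV2 ?posrE ?mulr_gt0//; last first.
  by rewrite sqrtr_gt0 mulrn_wgt0// mulr_gt0 ?pi_gt0// exprn_gt0.
rewrite -[leLHS]gtr0_norm ?mulr_gt0// -sqrtr_sqr ler_sqrt.
  rewrite exprMn -mulrnAr mulrC ler_pM2l ?exprn_gt0//.
  by have := @pi_ge2 R; lra.
by rewrite mulrn_wge0// mulr_ge0 ?pi_ge0// sqr_ge0.
Qed.

Let ballE (y r : R) : [set w | `|W w - y| <= r] = W @^-1` `[y - r, y + r]%classic.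
Proof.
by apply/seteqP; split => w /=; rewrite in_itv/= ler_distl.
Qed.

Let lawE (y r : R) : P [set w | `|W w - y| <= r] =
  (\int[mu]_(x in `[(y - r)%R, (y + r)%R]) (normal_pdf 0 s x)%:E)%E.
Proof. by rewrite ballE lawW// /gaussian_law (negbTE s0). Qed.

Let int_cst (y r c : R) : 0 <= r ->
  (\int[mu]_(x in `[(y - r)%R, (y + r)%R]) (cst c%:E x) = (c * (2 * r))%:E)%E.
Proof.
move=> r0; rewrite integral_cst//= lebesgue_measure_itv/= lte_fin.
case: ifPn => h; rewrite -?EFinD -?EFinM; first by congr EFin; ring.
congr EFin; suff -> : r = 0 by rewrite !mulr0.
by apply/eqP; rewrite eq_le r0 andbT; move: h; rewrite -leNgt; lra.
Qed.

Lemma gaussian_ball_le (y r : R) : 0 <= r ->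
  (P [set w | (`|W w - y| <= r)%R] <= (r / s)%:E)%E.
Proof.
move=> r0; rewrite lawE.
have h : (normal_peak s * (2 * r)) <= r / s.
  have := normal_peak_le; rewrite invfM => /(ler_wpM2r (_ : 0 <= 2 * r)).
  rewrite mulr_ge0// => /(_ isT)/le_trans; apply.
  by rewrite le_eqVlt; apply/orP; left; apply/eqP; field.
apply: le_trans (_ : (normal_peak s * (2 * r))%:E <= _)%E; last by rewrite lee_fin.
rewrite -(@int_cst y)//; apply: ge0_le_integral => //.
- by move=> x _; rewrite lee_fin normal_pdf_ge0.
- by apply/measurable_EFinP/measurable_funTS; exact: measurable_normal_pdf.
- by move=> x _; rewrite lee_fin normal_pdf_ub.
Qed.

(** For deviations in [[s1, 1]] the peak is smallest at 1 and the exponential factor at [s1], so one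
    constant serves all of them. *)
Lemma gaussian_ball_ge (y r M s1 : R) : 0 <= r -> `|y| + r <= M ->
  0 < s1 -> s1 <= s -> s <= 1 ->
  ((2 * normal_peak 1 * expR (- (M / s1) ^+ 2 / 2) * r)%:E <=
   P [set w | (`|W w - y| <= r)%R])%E.
Proof.
move=> r0 yM s1_gt0 s1s s1'; rewrite lawE.
set c := normal_peak 1 * expR (- (M / s1) ^+ 2 / 2).
have -> : 2 * normal_peak 1 * expR (- (M / s1) ^+ 2 / 2) * r = c * (2 * r).
  by rewrite /c; ring.
rewrite -(@int_cst y)//; apply: ge0_le_integral => //.
- by move=> x _; rewrite lee_fin /c mulr_ge0 ?expR_ge0 ?normal_peak_ge0.
- by apply/measurable_EFinP/measurable_funTS; exact: measurable_normal_pdf.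
move=> x /=; rewrite in_itv/= -ler_distl => hx.
rewrite lee_fin normal_pdfE// /c /normal_fun subr0.
have xM : `|x| <= M.
  by have := ler_normD (x - y) y; rewrite subrK; lra.
apply: ler_pM; rewrite ?expR_ge0 ?normal_peak_ge0//.
  rewrite /normal_peak lef_pV2 ?posrE ?sqrtr_gt0 ?mulrn_wgt0 ?mulr_gt0 ?pi_gt0 ?exprn_gt0//.
  rewrite ler_sqrt ?mulrn_wge0 ?mulr_ge0 ?pi_ge0 ?expr1n//.
  by rewrite lerMn2r/= ler_wpM2r ?pi_ge0// exprn_ile1// ltW.
rewrite ler_expR -[s ^+ 2 *+ 2]mulr_natr invfM mulrA ler_wpM2r//.
rewrite !mulNr lerN2 -exprVn -exprMn.
rewrite -[leLHS]real_normK ?num_real// lerXn2r ?nnegrE//.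
  by rewrite divr_ge0 ?(le_trans _ xM)// ltW.
rewrite normrM (gtr0_norm (x := s^-1)) ?invr_gt0//.
apply: ler_pM => //; first by rewrite invr_ge0 ltW.
by rewrite lef_pV2 ?posrE.
Qed.

(** Comparison with the density of deviation [2 s], which has total mass 1: the peaks have ratio 2,
    and the spare exponent [3 y^2 / (8 s^2)] is at least [(x/s)^2 / 4] where [x < |y|]. *)
Lemma gaussian_tail_le (x : R) : 0 <= x ->
  (P [set w | (x < `|W w|)%R] <= (2 * expR (- (x / s) ^+ 2 / 4))%:E)%E.
Proof.
move=> x0.
have -> : [set w | x < `|W w|] = W @^-1` [set y | x < `|y|] by [].
have mA : measurable [set y : R | x < `|y|].
  rewrite (_ : [set _ | _] = (fun y : R => `|y|) @^-1` `]x, +oo[%classic).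
    rewrite -[X in measurable X]setTI.
    have mn : measurable_fun [set: R] (fun y : R => `|y|) by exact: measurableT_comp.
    exact: mn.
  by apply/seteqP; split => w /=; rewrite in_itv/= andbT.
rewrite lawW// /gaussian_law (negbTE s0) /normal_prob.
set e := 2 * _.
have e0 : 0 <= e by rewrite mulr_ge0// expR_ge0.
have mpdf t : measurable_fun [set: R] (fun y : R => (normal_pdf 0 t y)%:E).
  by apply/measurable_EFinP; exact: measurable_normal_pdf.
apply: (@le_trans _ _ (\int[mu]_(y in [set y : R | (x < `|y|)%R])
    (e%:E * (normal_pdf 0 (2 * s) y)%:E))%E).
  apply: ge0_le_integral => //.
  - by move=> y _; rewrite lee_fin normal_pdf_ge0.
  - exact: (measurable_funTS (mpdf s)).
  - by apply: measurable_funTS; apply: emeasurable_funM => //; exact: mpdf.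
  move=> y /= xy; rewrite -EFinM lee_fin !normal_pdfE ?mulf_neq0// /normal_fun /normal_peak.
  have -> : Num.sqrt ((2 * s) ^+ 2 * pi *+ 2) = 2 * Num.sqrt (s ^+ 2 * pi *+ 2).
    rewrite (_ : _ *+ 2 = 2 ^+ 2 * (s ^+ 2 * pi *+ 2)); last by ring.
    by rewrite sqrtrM ?exprn_ge0// sqrtr_sqr ger0_norm.
  rewrite invfM subr0; set p := (Num.sqrt _)^-1.
  have p0 : 0 <= p by rewrite invr_ge0.
  rewrite /e.
  have -> (E1 E3 : R) : 2 * E1 * (2^-1 * p * E3) = p * (E1 * E3) by field.
  apply: ler_wpM2l => //; rewrite -expRD ler_expR.
  have x2 : (x / s) ^+ 2 <= y ^+ 2 / s ^+ 2.
    rewrite exprMn exprVn; apply: ler_wpM2r; first by rewrite invr_ge0 sqr_ge0.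
    by rewrite -[y ^+ 2]real_normK ?num_real// lerXn2r ?nnegrE// ltW.
  have -> : - y ^+ 2 / (s ^+ 2 *+ 2) = - (y ^+ 2 / s ^+ 2) / 2 by field.
  have -> : - y ^+ 2 / ((2 * s) ^+ 2 *+ 2) = - (y ^+ 2 / s ^+ 2) / 8 by field.
  have : 0 <= y ^+ 2 / s ^+ 2 by rewrite divr_ge0 ?sqr_ge0.
  by move: x2; set a := (x / s) ^+ 2; set b := _ / _; lra.
apply: (@le_trans _ _ (\int[mu]_y (e%:E * (normal_pdf 0 (2 * s) y)%:E))%E).
  apply: ge0_subset_integral => //; first by apply: emeasurable_funM => //; exact: mpdf.
  by move=> y _; rewrite -EFinM lee_fin mulr_ge0// normal_pdf_ge0.
rewrite ge0_integralZl//; first 1 last.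
- exact: mpdf.
- by move=> y _; rewrite lee_fin normal_pdf_ge0.
by rewrite integral_normal_pdf mule1.
Qed.

End gaussian_ball.

(** * Small ball probabilities of fractional Brownian motion *)

Section fbm_law.
Context {R : realType} {disp : measure_display} {T : measurableType disp}.
Variables (P : probability T R) (H : R) (X : R -> {RV P >-> R}).
Hypothesis fbmX : is_fbm H X.

Definition fbm_cov (s t : R) : R :=
  2^-1 * (`|t| `^ (2 * H) + `|s| `^ (2 * H) - `|t - s| `^ (2 * H)).

(** The variance of [u * X s + v * X t]. *)
Definition fbm_var2 (s t u v : R) : R :=
  u ^+ 2 * fbm_cov s s + 2 * u * v * fbm_cov s t + v ^+ 2 * fbm_cov t t.

Let comb_law (s t u v : R) : s \in `[0, 1] -> t \in `[0, 1] ->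
  exists m sg : R, forall A : set R, measurable A ->
    P ((fun w => u * X s w + v * X t w) @^-1` A) = gaussian_law m sg A.
Proof.
move=> s01 t01; case: fbmX => gX _ _ _.
pose tt (i : 'I_2) := if val i == 0%N then s else t.
pose cc (i : 'I_2) := if val i == 0%N then u else v.
have [|m [sg law]] := gX 2%N tt cc.
  by move=> i; rewrite /tt; case: ifP.
exists m, sg => A mA; rewrite -law//.
suff -> : (fun w => u * X s w + v * X t w) =
    (fun w => \sum_(i < 2) cc i * X (tt i) w) by [].
by apply/funext => w; rewrite !big_ord_recl big_ord0 addr0.
Qed.

Lemma measurable_fbm_comb (s t u v : R) : measurable_fun setT (fun w => u * X s w + v * X t w).
Proof. by apply: measurable_funD; apply: measurable_funM. Qed.

Let int1 s : s \in `[0, 1] -> P.-integrable setT (EFin \o X s).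
Proof.
move=> s01; have [m [sg law]] := comb_law 1 0 s01 s01.
have := gaussian_integrable_id (measurable_fbm_comb s s 1 0) law.
by apply: eq_integrable => // w _; rewrite /= mul0r addr0 mul1r.
Qed.

Let int2 s : s \in `[0, 1] -> P.-integrable setT (EFin \o (fun w => X s w * X s w)).
Proof.
move=> s01; have [m [sg law]] := comb_law 1 0 s01 s01.
have := gaussian_integrable_sqr (measurable_fbm_comb s s 1 0) law.
by apply: eq_integrable => // w _; rewrite /= mul0r addr0 mul1r.
Qed.

Let int12 s t : s \in `[0, 1] -> t \in `[0, 1] ->
  P.-integrable setT (EFin \o (fun w => X s w * X t w)).
Proof.
move=> s01 t01.
apply: (le_integrable _ _ _ (integrableD _ (int2 s01) (int2 t01))) => //.
  by apply/measurable_EFinP; apply: measurable_funM.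
move=> w _ /=; rewrite lee_fin.
rewrite (ger0_norm (x := _ + _)); last by rewrite addr_ge0// -expr2 sqr_ge0.
by rewrite ler_norml; apply/andP; split;
  have := sqr_ge0 (X s w + X t w); have := sqr_ge0 (X s w - X t w);
  have := sqr_ge0 (X s w); have := sqr_ge0 (X t w); nra.
Qed.

Let mean0 s : s \in `[0, 1] -> (\int[P]_w X s w = 0)%R.
Proof.
by move=> s01; case: fbmX => _ /(_ _ s01) + _ _; rewrite expectation_def /Rintegral => ->.
Qed.

Let covE s t : s \in `[0, 1] -> t \in `[0, 1] ->
  (\int[P]_w (X s w * X t w) = fbm_cov s t)%R.
Proof.
move=> s01 t01; case: fbmX => _ mean /(_ _ _ s01 t01) + _.
rewrite unlock (mean _ s01) (mean _ t01) /= unlock => h.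
rewrite /Rintegral -[RHS]/(fine (fbm_cov s t)%:E) -h; congr fine.
apply: eq_integral => w _.
by rewrite [X in _ = X%:E]/GRing.mul/= !subr0.
Qed.

(** The law is Gaussian with unspecified parameters; its mean and second moment, computed from those
    of the process, identify them. *)
Lemma fbm_comb_law (s t u v : R) : s \in `[0, 1] -> t \in `[0, 1] ->
  0 <= fbm_var2 s t u v /\ forall A : set R, measurable A ->
    P ((fun w => u * X s w + v * X t w) @^-1` A) =
    gaussian_law 0 (Num.sqrt (fbm_var2 s t u v)) A.
Proof.
move=> s01 t01; have [m [sg law]] := comb_law u v s01 t01.
have i k r (r01 : r \in `[0, 1]) : P.-integrable setT (EFin \o (fun w => k * X r w)).
  exact: (integrableZl _ _ (int1 r01)).
have m0 : m = 0.
  rewrite -(gaussian_mean (measurable_fbm_comb s t u v) law).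
  rewrite RintegralD//; [|exact: i|exact: i].
  rewrite !RintegralZl//; [|exact: int1|exact: int1].
  by rewrite !mean0// !mulr0 addr0.
have sgE : sg ^+ 2 = fbm_var2 s t u v.
  rewrite -(gaussian_sqr (measurable_fbm_comb s t u v) law m0).
  have e w : (u * X s w + v * X t w) * (u * X s w + v * X t w) =
     u ^+ 2 * (X s w * X s w) + 2 * u * v * (X s w * X t w) +
       v ^+ 2 * (X t w * X t w) by ring.
  under eq_Rintegral do rewrite e.
  have j k r q (r01 : r \in `[0, 1]) (q01 : q \in `[0, 1]) :
      P.-integrable setT (EFin \o (fun w => k * (X r w * X q w))).
    exact: (integrableZl _ _ (int12 r01 q01)).
  rewrite RintegralD//; [|exact: integrableD (j _ _ _ _ _) (j _ _ _ _ _)|exact: j].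
  rewrite RintegralD//; [|exact: j|exact: j].
  rewrite !RintegralZl//; [|exact: int12|exact: int12|exact: int12].
  by rewrite !covE.
split; first by rewrite -sgE sqr_ge0.
(* The deviation [sg] may be negative, but the density depends on its square only. *)
move=> A mA; rewrite law// -sgE sqrtr_sqr m0 /gaussian_law normr_eq0.
case: ifPn => // sg0; rewrite /normal_prob; apply: eq_integral => x _.
rewrite !normal_pdfE// ?normr_eq0// /normal_peak /normal_fun.
by rewrite real_normK// num_real.
Qed.

Lemma fbm_cos (s t u v c : R) : s \in `[0, 1] -> t \in `[0, 1] ->
  (\int[P]_w cos (u * X s w + v * X t w + c) =
   cos c * expR (- (fbm_var2 s t u v / 2)))%R.
Proof.
move=> s01 t01; have [V0 law] := fbm_comb_law u v s01 t01.
by rewrite (gaussian_cos (measurable_fbm_comb s t u v) law)// sqr_sqrtr.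
Qed.

End fbm_law.

(** * Power increments and local nondeterminism *)

Section power_increments.
Context {R : realType}.
Variables (a H : R).
Hypotheses (a_gt0 : 0 < a) (H01 : 0 < H < 1).

Let H0 : 0 < H. Proof. by case/andP: H01. Qed.
Let H1 : H < 1. Proof. by case/andP: H01. Qed.

(** Young's inequality with conjugate exponents [1/H] and [1/(1-H)], applied to [(1 + v)^H] and
    1. *)
Lemma powR_bernoulli (v : R) : 0 <= v -> (1 + v) `^ H <= 1 + H * v.
Proof.
move=> v0.
have v1 : 0 <= 1 + v by rewrite addr_ge0.
have Hn : H != 0 by rewrite gt_eqF.
have := @conjugate_powR R ((1 + v) `^ H) 1 H^-1 (1 - H)^-1 (powR_ge0 _ _) ler01.
rewrite !invrK invr_gt0 H0 invr_gt0 subr_gt0 H1 subrKC => /(_ isT isT erefl).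
rewrite powR1 mul1r mulr1 -powRrM mulfV// powRr1// => /le_trans; apply.
by rewrite le_eqVlt; apply/orP; left; apply/eqP; ring.
Qed.

Lemma powR_le_self (u : R) : 0 <= u <= 1 -> u <= u `^ H.
Proof.
case/andP; rewrite le_eqVlt => /predU1P[<- _|u0 u1]; first exact: powR_ge0.
by rewrite ger1_powR ?u0// ltW.
Qed.

(** Subadditivity would give the factor 1; a factor below 1 is what keeps the residual variance
    positive. Bernoulli's inequality is applied around the larger of [s] and [h = t - s]. If
    [h <= s], the factor [H] already suffices; otherwise the gain is [(1 - H) s^H], and
    [s^H >= a^H >= a^H h^H]. *)
Lemma powR_increment (s t : R) : a <= s -> s <= t -> t <= 1 ->
  t `^ H - s `^ H <= (1 - (1 - H) * a `^ H) * (t - s) `^ H.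
Proof.
move=> as_ st t1.
have s0 : 0 < s by exact: lt_le_trans as_.
have t0 : 0 < t by exact: lt_le_trans st.
have le1 (x : R) : 0 <= x -> x <= 1 -> x `^ H <= 1.
  move=> x0 x1; have -> : 1 = 1 `^ H :> R by rewrite powR1.
  by apply: ge0_ler_powR; rewrite ?nnegrE// ltW.
have aH1 : a `^ H <= 1.
  by apply: le1; [exact: ltW|lra].
have aH0 : 0 < a `^ H by exact: powR_gt0.
set h := t - s.
have h0 : 0 <= h by rewrite subr_ge0.
have tE : t = s + h by rewrite /h; ring.
have hH0 : 0 <= h `^ H by exact: powR_ge0.
have HH1 := H1; have HH0 := H0.
have [hs|sh] := lerP h s.
- have u01 : 0 <= h / s <= 1 by rewrite divr_ge0 ?(ltW s0)//= ler_pdivrMr// mul1r.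
  have -> : t = s * (1 + h / s) by rewrite tE; field; rewrite gt_eqF.
  have /andP[u0 u1] := u01.
  rewrite powRM ?(ltW s0) ?addr_ge0//.
  have h1 : s `^ H * (1 + h / s) `^ H <= s `^ H * (1 + H * (h / s)).
    by apply: ler_wpM2l; [exact: powR_ge0|exact: powR_bernoulli].
  have h2 : s `^ H * (h / s) <= h `^ H.
    have -> : h `^ H = s `^ H * (h / s) `^ H.
      by rewrite -powRM ?(ltW s0)//; congr (_ `^ _); field; rewrite gt_eqF.
    by apply: ler_wpM2l; [exact: powR_ge0|exact: powR_le_self].
  apply: (@le_trans _ _ (H * h `^ H)); first by nra.
  by apply: ler_wpM2r => //; nra.
- have h_gt0 : 0 < h by exact: lt_trans sh.
  have u01 : 0 <= s / h <= 1.
    by rewrite divr_ge0 ?(ltW s0)//= ler_pdivrMr// mul1r ltW.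
  have -> : t = h * (1 + s / h) by rewrite tE; field; rewrite gt_eqF.
  have /andP[u0 u1] := u01.
  have u2 : 0 <= 1 + s / h by rewrite addr_ge0.
  rewrite powRM//.
  have h1 : h `^ H * (1 + s / h) `^ H <= h `^ H * (1 + H * (s / h)).
    by apply: ler_wpM2l => //; exact: powR_bernoulli.
  have h2 : h `^ H * (s / h) <= s `^ H.
    have -> : s `^ H = h `^ H * (s / h) `^ H.
      by rewrite -powRM//; congr (_ `^ _); field; rewrite gt_eqF.
    by apply: ler_wpM2l => //; exact: powR_le_self.
  have h3 : a `^ H <= s `^ H.
    by apply: ge0_ler_powR; rewrite ?nnegrE//; exact: ltW.
  have h4 : h `^ H <= 1.
    by apply: le1 => //; rewrite /h; lra.
  have m1 : H * (h `^ H * (s / h)) <= H * s `^ H by apply: ler_wpM2l => //; exact: ltW.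
  have m2 : 0 <= (1 - H) * (s `^ H - a `^ H) by rewrite mulr_ge0// subr_ge0// ltW.
  have m3 : 0 <= (1 - H) * a `^ H * (1 - h `^ H).
    by rewrite !mulr_ge0 ?subr_ge0// ltW.
  lra.
Qed.

End power_increments.

Section two_point_covariance.
Context {R : realType}.
Variables (a H : R).
Hypotheses (a_gt0 : 0 < a) (a_le1 : a <= 1) (H01 : 0 < H < 1).

Let H0 : 0 < H. Proof. by case/andP: H01. Qed.
Let H1 : H < 1. Proof. by case/andP: H01. Qed.
Let aH0 : 0 < a `^ H. Proof. exact: powR_gt0. Qed.

Lemma powR2M (x : R) : x `^ (2 * H) = (x `^ H) ^+ 2.
Proof. by rewrite mulrC powRrM -powR_mulrn// powR_ge0. Qed.

Lemma fbm_covE (s t : R) : 0 <= s -> 0 <= t ->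
  fbm_cov H s t = 2^-1 * ((t `^ H) ^+ 2 + (s `^ H) ^+ 2 - (`|t - s| `^ H) ^+ 2).
Proof. by move=> s0 t0; rewrite /fbm_cov !powR2M (ger0_norm s0) (ger0_norm t0). Qed.

Lemma fbm_covss (s : R) : 0 <= s -> fbm_cov H s s = (s `^ H) ^+ 2.
Proof.
by move=> s0; rewrite fbm_covE// subrr normr0 powR0 ?gt_eqF// expr0n/= subr0; field.
Qed.

Let powH_le (x y : R) : 0 <= x -> x <= y -> x `^ H <= y `^ H.
Proof.
move=> x0 xy; apply: ge0_ler_powR; rewrite ?nnegrE ?(ltW H0)//.
exact: le_trans xy.
Qed.

Let powH_le1 (x : R) : 0 <= x -> x <= 1 -> x `^ H <= 1.
Proof. by move=> x0 x1; have := powH_le x0 x1; rewrite powR1. Qed.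

(** The constant of local nondeterminism: the lower bounds [a^(2H)] and [(1 - H) a^H] of the two
    Heron factors, over 4. *)
Definition lnd_const : R := (1 - H) * (a `^ H) ^+ 3 / 4.

Lemma lnd_const_gt0 : 0 < lnd_const.
Proof. by rewrite /lnd_const divr_gt0// mulr_gt0 ?subr_gt0// exprn_gt0. Qed.

Lemma lnd_const_le1 : lnd_const <= 1.
Proof.
rewrite /lnd_const ler_pdivrMr// mul1r.
have h : (a `^ H) ^+ 3 <= 1 by rewrite exprn_ile1 ?powH_le1// ltW.
have h' : 0 < (a `^ H) ^+ 3 by rewrite exprn_gt0.
by have := H0; nra.
Qed.

(** Subtracting the best multiple of [X s] from [X t] leaves no more variance than subtracting [X s]
    itself; the difference of the two variances is a square. *)
Let residual_variance_le (sg ta th : R) : 0 < sg ->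
  ta ^+ 2 - (2^-1 * (ta ^+ 2 + sg ^+ 2 - th ^+ 2)) ^+ 2 / sg ^+ 2 <= th ^+ 2.
Proof.
move=> sg0; rewrite -subr_ge0.
set c := 2^-1 * _.
have -> : th ^+ 2 = sg ^+ 2 + ta ^+ 2 - 2 * c by rewrite /c; field.
have -> : sg ^+ 2 + ta ^+ 2 - 2 * c - (ta ^+ 2 - c ^+ 2 / sg ^+ 2) =
  (sg - c / sg) ^+ 2 by field; rewrite gt_eqF.
exact: sqr_ge0.
Qed.

Definition residual_var (s t : R) : R :=
  fbm_cov H t t - fbm_cov H s t ^+ 2 / fbm_cov H s s.

(* [X t - rho X s] is the part of [X t] uncorrelated with [X s]; by Heron's
   formula its variance is
   [((sg + ta)^2 - th^2) (th^2 - (sg - ta)^2) / (4 sg^2)] with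
   [sg = s^H], [ta = t^H], [th = |t - s|^H]. *)
Lemma residual_var_bounds (s t : R) : a <= s <= 1 -> a <= t <= 1 ->
  lnd_const * (`|t - s| `^ H) ^+ 2 <= residual_var s t <= (`|t - s| `^ H) ^+ 2.
Proof.
move=> /andP[as_ s1] /andP[at_ t1].
have s0 : 0 < s by exact: lt_le_trans as_.
have t0 : 0 < t by exact: lt_le_trans at_.
rewrite /residual_var (fbm_covE (ltW s0) (ltW t0)) (fbm_covss (ltW s0)) (fbm_covss (ltW t0)).
set sg := s `^ H; set ta := t `^ H; set th := `|t - s| `^ H.
have sg0 : 0 < sg by exact: powR_gt0.
have ta0 : 0 < ta by exact: powR_gt0.
have th0 : 0 <= th by exact: powR_ge0.
rewrite residual_variance_le// andbT.
have asg : a `^ H <= sg by apply: powH_le => //; exact: ltW.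
have ata : a `^ H <= ta by apply: powH_le => //; exact: ltW.
have sg1 : sg <= 1 by apply: powH_le1 => //; exact: ltW.
have -> : ta ^+ 2 - (2^-1 * (ta ^+ 2 + sg ^+ 2 - th ^+ 2)) ^+ 2 / sg ^+ 2 =
    ((sg + ta) ^+ 2 - th ^+ 2) * (th ^+ 2 - (sg - ta) ^+ 2) / (4 * sg ^+ 2).
  by field; rewrite gt_eqF.
pose k := (1 - H) * a `^ H.
have aH1 : a `^ H <= 1 by apply: powH_le1 => //; exact: ltW.
have k0 : 0 < k by rewrite mulr_gt0// subr_gt0.
have k1 : k < 1 by have := H0; rewrite /k; have := aH0; nra.
have sgta : `|sg - ta| <= (1 - k) * th.
  have [st|/ltW ts] := lerP s t.
  - have stH : sg <= ta by apply: powH_le => //; exact: ltW.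
    rewrite distrC ger0_norm ?subr_ge0// /th ger0_norm ?subr_ge0//.
    exact: powR_increment.
  - have tsH : ta <= sg by apply: powH_le => //; exact: ltW.
    rewrite ger0_norm ?subr_ge0// /th distrC ger0_norm ?subr_ge0//.
    exact: powR_increment.
(* Both times are positive, so [|t - s|] is at most the larger one. *)
have thmax : th <= sg \/ th <= ta.
  have [st|/ltW ts] := lerP s t.
  - right; apply: powH_le => //; rewrite ger0_norm ?subr_ge0//.
    by rewrite lerBlDr lerDl ltW.
  - left; apply: powH_le => //; rewrite distrC ger0_norm ?subr_ge0//.
    by rewrite lerBlDr lerDl ltW.
(* [th^2] cancels against one of the squares in [(sg + ta)^2]; the other square is at least
   [a^(2H)]. *)
have aH2 : (a `^ H) ^+ 2 <= (sg + ta) ^+ 2 - th ^+ 2.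
  have aa : 0 < a `^ H by [].
  have h1 : a `^ H * a `^ H <= sg * sg by apply: ler_pM => //; exact: ltW.
  have h2 : a `^ H * a `^ H <= ta * ta by apply: ler_pM => //; exact: ltW.
  have h3 : 0 < sg * ta by exact: mulr_gt0.
  by case: thmax => h4; have := ler_pM th0 th0 h4 h4; rewrite !expr2; nra.
(* The strict factor [1 - k] pays here: [1 - (1 - k)^2 = k + k (1 - k) >= k]. *)
have kth : k * th ^+ 2 <= th ^+ 2 - (sg - ta) ^+ 2.
  have h : (sg - ta) ^+ 2 <= ((1 - k) * th) ^+ 2.
    rewrite -[leLHS]real_normK ?num_real// lerXn2r ?nnegrE//.
    by rewrite mulr_ge0// subr_ge0 ltW.
  have h' : 0 <= th ^+ 2 by exact: sqr_ge0.
  apply: le_trans (_ : th ^+ 2 - ((1 - k) * th) ^+ 2 <= _); last by lra.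
  have : 0 <= th ^+ 2 * k * (1 - k) by rewrite !mulr_ge0// ?subr_ge0 ltW.
  by rewrite exprMn; lra.
rewrite ler_pdivlMr ?mulr_gt0 ?exprn_gt0//.
apply: (@le_trans _ _ ((a `^ H) ^+ 2 * (k * th ^+ 2))); last first.
  by apply: ler_pM => //; rewrite ?sqr_ge0// mulr_ge0 ?sqr_ge0// ltW.
have -> : lnd_const * th ^+ 2 * (4 * sg ^+ 2) =
   ((a `^ H) ^+ 2 * (k * th ^+ 2)) * sg ^+ 2.
  by rewrite /lnd_const /k; field.
rewrite ler_piMr//; last by rewrite exprn_ile1// ltW.
by rewrite mulr_ge0 ?sqr_ge0// mulr_ge0 ?sqr_ge0// ltW.
Qed.

(** Replacing [y - x] by [y - rho x] shifts a center by [(1 - rho) x]. For bounded [x] this is of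
    the order of [|t - s|^H], hence harmless on the scale of the Gaussian factor. *)
Lemma regression_bound (s t : R) : a <= s <= 1 -> a <= t <= 1 ->
  `|1 - fbm_cov H s t / fbm_cov H s s| <= 2 * `|t - s| `^ H / (a `^ H) ^+ 2.
Proof.
move=> /andP[as_ s1] /andP[at_ t1].
have s0 : 0 < s by exact: lt_le_trans as_.
have t0 : 0 < t by exact: lt_le_trans at_.
rewrite (fbm_covE (ltW s0) (ltW t0)) (fbm_covss (ltW s0)).
set sg := s `^ H; set ta := t `^ H; set th := `|t - s| `^ H.
have sg0 : 0 < sg by exact: powR_gt0.
have ta0 : 0 < ta by exact: powR_gt0.
have th0 : 0 <= th by exact: powR_ge0.
have asg : a `^ H <= sg by apply: powH_le => //; exact: ltW.
have sg1 : sg <= 1 by apply: powH_le1 => //; exact: ltW.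
have ta1 : ta <= 1 by apply: powH_le1 => //; exact: ltW.
have th1 : th <= 1 by apply: powH_le1 => //; rewrite ler_norml; lra.
have sgta : `|sg - ta| <= th.
  have kk : 0 <= (1 - H) * a `^ H by rewrite mulr_ge0// ?subr_ge0 ltW.
  have [st|/ltW ts] := lerP s t.
  - have stH : sg <= ta by apply: powH_le => //; exact: ltW.
    rewrite distrC ger0_norm ?subr_ge0//.
    have := powR_increment a_gt0 H01 as_ st t1.
    by rewrite /th ger0_norm ?subr_ge0// -/sg -/ta; have := powR_ge0 (t - s) H; nra.
  - have tsH : ta <= sg by apply: powH_le => //; exact: ltW.
    rewrite ger0_norm ?subr_ge0//.
    have := powR_increment a_gt0 H01 at_ ts s1.
    rewrite /th distrC ger0_norm ?subr_ge0// -/sg -/ta.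
    by have := powR_ge0 (s - t) H; nra.
have -> : 1 - 2^-1 * (ta ^+ 2 + sg ^+ 2 - th ^+ 2) / sg ^+ 2 =
   2^-1 * ((sg - ta) * (sg + ta) + th * th) / sg ^+ 2.
  by field; rewrite gt_eqF.
rewrite normrM (gtr0_norm (x := _^-1)) ?invr_gt0 ?exprn_gt0//.
apply: ler_pM => //.
- by rewrite invr_ge0 sqr_ge0.
- rewrite normrM ger0_norm//.
  have h1 : `|(sg - ta) * (sg + ta)| <= th * 2.
    by rewrite normrM; apply: ler_pM => //; rewrite ger0_norm; lra.
  have h2 : `|th * th| <= th by rewrite ger0_norm ?mulr_ge0// ler_piMr.
  by have := ler_normD ((sg - ta) * (sg + ta)) (th * th); lra.
- by rewrite lef_pV2 ?posrE ?exprn_gt0// lerXn2r// nnegrE ltW.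
Qed.

End two_point_covariance.

Section two_point_estimate.
Context {R : realType}.
Variables (a H : R).
Hypotheses (a_gt0 : 0 < a) (a_le1 : a <= 1) (H01 : 0 < H < 1).

(** The deviation of [X t - X s] smoothed at spatial scale [r]. It never falls below [r], so
    coinciding or close times need no separate treatment. *)
Definition two_point_scale (s t r : R) : R :=
  Num.sqrt ((`|t - s| `^ H) ^+ 2 + r ^+ 2).

Let aH0 : 0 < a `^ H. Proof. exact: powR_gt0. Qed.

Lemma two_point_scale_gt0 (s t r : R) : 0 < r -> 0 < two_point_scale s t r.
Proof. by move=> r0; rewrite sqrtr_gt0 ltr_wpDl ?sqr_ge0// exprn_gt0. Qed.

Lemma two_point_scaleE (s t r : R) :
  two_point_scale s t r ^+ 2 = (`|t - s| `^ H) ^+ 2 + r ^+ 2.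
Proof. by rewrite sqr_sqrtr// addr_ge0 ?sqr_ge0. Qed.

(** Recentering from [dl] to [z] through [u]: both moves are of order [th <= L], so
    [z^2 <= 4 dl^2 + 4 (M^2 + K^2) L^2]. The price is a constant factor and a variance four times as
    large. *)
Let gauss_shift (C2 M K L th dl u z : R) : 0 < C2 -> 0 < L -> 0 <= M -> 0 <= K ->
  0 <= th -> th ^+ 2 <= L ^+ 2 ->
  `|u - dl| <= M * th -> `|z - u| <= K * th ->
  expR (- dl ^+ 2 / (2 * (C2 * L ^+ 2))) <=
  expR ((M ^+ 2 + K ^+ 2) / (2 * C2)) * expR (- (8 * C2)^-1 * (z ^+ 2 / L ^+ 2)).
Proof.
move=> C0 L0 M0 K0 th0 thL ud zu.
rewrite -expRD ler_expR.
have L2 : 0 < L ^+ 2 by rewrite exprn_gt0.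
have sq (v Q : R) : 0 <= Q -> `|v| <= Q * th -> v ^+ 2 <= Q ^+ 2 * L ^+ 2.
  move=> Q0 vQ; apply: le_trans (_ : (Q * th) ^+ 2 <= _).
    by rewrite -[leLHS]real_normK ?num_real// lerXn2r ?nnegrE// mulr_ge0.
  by rewrite exprMn ler_wpM2l// sqr_ge0.
have h1 := sq _ _ M0 ud; have h2 := sq _ _ K0 zu.
have -> : (M ^+ 2 + K ^+ 2) / (2 * C2) + - (8 * C2)^-1 * (z ^+ 2 / L ^+ 2) =
    (4 * (M ^+ 2 + K ^+ 2) * L ^+ 2 - z ^+ 2) / (8 * (C2 * L ^+ 2)).
  by field; rewrite !gt_eqF.
have -> : - dl ^+ 2 / (2 * (C2 * L ^+ 2)) = - (4 * dl ^+ 2) / (8 * (C2 * L ^+ 2)).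
  by field; rewrite !gt_eqF.
apply: ler_wpM2r; first by rewrite invr_ge0 !mulr_ge0// ltW.
have := sqr_ge0 (z - u - u); have := sqr_ge0 (u - dl - dl).
have := sqr_ge0 (K * L); rewrite exprMn; lra.
Qed.

(** The point [z] is free within [K |t - s|^H] of [y - x]: the centers will contain the drift, while
    [z] will be a coordinate of the difference of two points of [F]. The constants precede the
    probability space and the process. *)
Lemma two_point_le (M K : R) : 0 <= M -> 0 <= K ->
  exists C c : R, [/\ 0 < C, 0 < c &
  forall (disp : measure_display) (T : measurableType disp) (P : probability T R)
    (X : R -> {RV P >-> R}), is_fbm H X ->
  forall s t r x y z : R, a <= s <= 1 -> a <= t <= 1 -> 0 < r -> `|x| <= M ->
    `|z - (y - x)| <= K * `|t - s| `^ H ->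
    (P [set w | (`|X s w - x| <= r)%R /\ (`|X t w - y| <= r)%R]%classic <=
     (C * r ^+ 2 / two_point_scale s t r *
      expR (- c * (z ^+ 2 / two_point_scale s t r ^+ 2)))%:E)%E].
Proof.
move=> M0 K0.
pose aH2 := (a `^ H) ^+ 2.
have aH2_gt0 : 0 < aH2 by rewrite exprn_gt0.
pose rho0 := 1 + 2 / aH2.
have rho0_ge0 : 0 <= rho0 by rewrite addr_ge0// divr_ge0// ltW.
pose C2 := (1 + rho0) ^+ 2.
have C2_gt0 : 0 < C2 by rewrite exprn_gt0// ltr_wpDr.
pose c1 := lnd_const a H.
have c1_gt0 : 0 < c1 by exact: lnd_const_gt0.
have c1_le1 : c1 <= 1 by exact: lnd_const_le1.
pose M' := 2 * M / aH2.
have M'0 : 0 <= M' by rewrite divr_ge0 ?mulr_ge0// ltW.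
pose G := expR ((M' ^+ 2 + K ^+ 2) / (2 * C2)).
pose C := expR 1 * (a `^ H)^-1 * ((1 + rho0) / Num.sqrt c1) * G.
have rho1 : 0 < 1 + rho0 by rewrite ltr_wpDr.
have C_gt0 : 0 < C.
  by rewrite /C /G !mulr_gt0 ?expR_gt0 ?invr_gt0 ?sqrtr_gt0.
exists C, (8 * C2)^-1; split => //; first by rewrite invr_gt0 mulr_gt0.
move=> disp T P X fbmX s t r x y z sa ta r0 xM zxy.
have /andP[as_ s1] := sa; have /andP[at_ t1] := ta.
have s0 : 0 < s by exact: lt_le_trans as_.
have t0 : 0 < t by exact: lt_le_trans at_.
have s01 : s \in `[0, 1] by rewrite in_itv/= s1 ltW.
have t01 : t \in `[0, 1] by rewrite in_itv/= t1 ltW.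
set L := two_point_scale s t r.
have L0 : 0 < L by exact: two_point_scale_gt0.
set th := `|t - s| `^ H in zxy *.
have th0 : 0 <= th by exact: powR_ge0.
have LE : L ^+ 2 = th ^+ 2 + r ^+ 2 by exact: two_point_scaleE.
pose sg := s `^ H.
have sg0 : 0 < sg by exact: powR_gt0.
have covss : fbm_cov H s s = sg ^+ 2 by apply: fbm_covss => //; exact: ltW.
pose rho := fbm_cov H s t / fbm_cov H s s.
have rhoB : `|1 - rho| <= 2 * th / aH2 by exact: regression_bound.
have th1 : th <= 1.
  have -> : 1 = 1 `^ H :> R by rewrite powR1.
  apply: ge0_ler_powR; rewrite ?nnegrE//; first by case/andP: H01 => /ltW.
  by rewrite ler_norml; lra.
have rho_le : `|rho| <= rho0.
  have h1 : 2 * th / aH2 <= 2 / aH2.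
    by apply: ler_wpM2r; [rewrite invr_ge0 ltW|lra].
  have := ler_normB 1 (1 - rho); rewrite subKr normr1 /rho0; lra.
(* If [X s] and [X t] are within [r] of [x] and [y], then [D] is within [(1 + |rho|) r] of
   [y - rho x]. *)
pose q := (1 + rho0) * r.
have q0 : 0 < q by rewrite mulr_gt0.
pose v := residual_var H s t.
have /andP[v_ge v_le] := residual_var_bounds a_gt0 a_le1 H01 sa ta.
have v0 : 0 <= v by apply: le_trans v_ge; rewrite mulr_ge0 ?sqr_ge0// ltW.
pose D w := X t w - rho * X s w.
have mD : measurable_fun setT D.
  by apply: measurable_funB => //; apply: measurable_funM.
(* With this [rho] the cross term of the variance vanishes; this replaces independence of [X s] and
   [D]. *)
have char u v' c : (\int[P]_w cos (u * X s w + v' * D w + c) =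
    cos c * expR (- ((u ^+ 2 * sg ^+ 2 + v' ^+ 2 * Num.sqrt v ^+ 2) / 2)))%R.
  have := fbm_cos fbmX (u - v' * rho) v' c s01 t01.
  have -> : fbm_var2 H s t (u - v' * rho) v' =
      u ^+ 2 * sg ^+ 2 + v' ^+ 2 * Num.sqrt v ^+ 2.
    rewrite sqr_sqrtr// /v /residual_var /fbm_var2 /rho covss.
    by field; rewrite gt_eqF.
  by move=> <-; apply: eq_Rintegral => w _; congr cos; rewrite /D; ring.
pose dl := y - rho * x.
have mset (Z : T -> R) z' e : measurable_fun setT Z -> measurable [set w | `|Z w - z'| <= e].
  move=> mZ; have mn : measurable_fun setT (fun w => `|Z w - z'|).
    by apply: measurableT_comp => //; exact: measurable_funB.
  rewrite (_ : [set _ | _] = (fun w => `|Z w - z'|) @^-1` `]-oo, e]).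
    by rewrite -[X in measurable X]setTI; exact: mn.
  by apply/seteqP; split => w /=; rewrite in_itv.
have := prob_pair_le (measurable_funPT (X s)) mD char x dl r0 q0 sg0.
have sub : [set w | `|X s w - x| <= r /\ `|X t w - y| <= r] `<=`
    [set w | `|X s w - x| <= r /\ `|D w - dl| <= q].
  move=> w /= [h1 h2]; split => //.
  have -> : D w - dl = (X t w - y) - rho * (X s w - x) by rewrite /D /dl; ring.
  apply: le_trans (ler_normB _ _) _; rewrite normrM /q mulrDl mul1r.
  by apply: lerD => //; exact: ler_pM.
move=> /(le_trans (le_measure P _ _ sub)) h; apply: le_trans (h _ _) _.
- by rewrite inE; apply: measurableI; exact: mset.
- by rewrite inE; apply: measurableI; exact: mset.
rewrite lee_fin.
(* The smoothed residual variance is comparable with [L^2]: this lower bound serves the prefactor,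
   the upper bound [vq] the exponential. *)
have qv : c1 * L ^+ 2 <= q ^+ 2 + v.
  rewrite LE mulrDr addrC; apply: lerD => //.
  apply: (@le_trans _ _ (1 * r ^+ 2)); first by rewrite ler_wpM2r ?sqr_ge0.
  rewrite /q exprMn ler_wpM2r ?sqr_ge0// exprn_ege1//; lra.
have vq : q ^+ 2 + v <= C2 * L ^+ 2.
  rewrite LE mulrDr addrC /q exprMn lerD2r.
  apply: le_trans v_le _; rewrite ler_peMl ?sqr_ge0// /C2 exprn_ege1//; lra.
have qv0 : 0 < q ^+ 2 + v by rewrite ltr_wpDr// exprn_gt0.
have sqE : 1 + (Num.sqrt v / q) ^+ 2 = (q ^+ 2 + v) / q ^+ 2.
  by rewrite exprMn sqr_sqrtr//; field; rewrite gt_eqF.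
rewrite sqE.
have f1 : (Num.sqrt ((q ^+ 2 + v) / q ^+ 2))^-1 <= (1 + rho0) * r / Num.sqrt c1 / L.
  have -> : (1 + rho0) * r / Num.sqrt c1 / L = (Num.sqrt c1 * L / q)^-1.
    by rewrite invf_div invfM mulrA.
  have b0 : 0 < Num.sqrt c1 * L / q.
    by rewrite divr_gt0// mulr_gt0// sqrtr_gt0.
  have b1 : 0 < Num.sqrt ((q ^+ 2 + v) / q ^+ 2).
    by rewrite sqrtr_gt0 divr_gt0// exprn_gt0.
  rewrite lef_pV2 ?posrE//.
  rewrite -[leLHS](gtr0_norm b0) -sqrtr_sqr ler_sqrt; last first.
    by rewrite divr_ge0 ?sqr_ge0// ltW.
  rewrite exprMn exprMn exprVn sqr_sqrtr; last exact: ltW.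
  by apply: ler_wpM2r => //; rewrite invr_ge0 sqr_ge0.
have f2 : expR (- (dl / q) ^+ 2 / (2 * ((q ^+ 2 + v) / q ^+ 2))) <=
    G * expR (- (8 * C2)^-1 * (z ^+ 2 / L ^+ 2)).
  have -> : - (dl / q) ^+ 2 / (2 * ((q ^+ 2 + v) / q ^+ 2)) = - (dl ^+ 2 / (2 * (q ^+ 2 + v))).
    by field; rewrite !gt_eqF.
  apply: (@le_trans _ _ (expR (- dl ^+ 2 / (2 * (C2 * L ^+ 2))))).
    rewrite ler_expR mulNr lerN2 ler_wpM2l ?sqr_ge0// lef_pV2 ?posrE.
    + by rewrite ler_pM2l.
    + by rewrite !mulr_gt0// exprn_gt0.
    + by rewrite mulr_gt0.
  apply: (gauss_shift (th := th) (u := y - x)) => //.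
  - by rewrite LE lerDl sqr_ge0.
  - have -> : y - x - dl = - ((1 - rho) * x) by rewrite /dl; ring.
    rewrite normrN normrM /M'.
    have -> : 2 * M / aH2 * th = (2 * th / aH2) * M by ring.
    exact: ler_pM.
apply: (@le_trans _ _ (expR 1 * (r / a `^ H) *
    ((1 + rho0) * r / Num.sqrt c1 / L * (G * expR (- (8 * C2)^-1 * (z ^+ 2 / L ^+ 2)))))).
  apply: ler_pM.
  - by rewrite mulr_ge0 ?expR_ge0// divr_ge0// ltW.
  - by rewrite mulr_ge0 ?expR_ge0// invr_ge0.
  - apply: ler_wpM2l; first exact: expR_ge0.
    apply: ler_wpM2l; first exact: ltW.
    rewrite lef_pV2 ?posrE//; apply: ge0_ler_powR; rewrite ?nnegrE//.
    + by case/andP: H01 => /ltW.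
    + exact: ltW.
    + exact: ltW.
  - by apply: ler_pM; rewrite ?expR_ge0// invr_ge0.
by rewrite le_eqVlt; apply/orP; left; apply/eqP; rewrite /C; ring.
Qed.

End two_point_estimate.

(** * Discrete Frostman measures *)

Section dyadic_cubes.
Context {R : realType} {d : nat}.
Implicit Types (x y : 'rV[R]_d) (k j n : nat) (u z : {ffun 'I_d -> int}).

Definition cube k x : {ffun 'I_d -> int} :=
  [ffun i => Num.floor (2 ^+ k * x ord0 i)].

Lemma floor_half (y : R) : Num.floor y = (Num.floor (2 * y) %/ 2)%Z.
Proof.
apply: floor_def; set m := Num.floor (2 * y).
have /andP[m1 m2] := floor_itv (2 * y); rewrite -/m in m1 m2.
have e := divz_eq m 2; have r0 : (0 <= m %% 2)%Z by rewrite modz_ge0.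
have r1 : ((m %% 2)%Z < 2) by rewrite ltz_pmod.
have h1 : (2 * (m %/ 2)%Z <= m) by lia.
have h2 : (m + 1 <= 2 * ((m %/ 2)%Z + 1)) by lia.
rewrite -(ler_int R) intrM in h1; rewrite -(ler_int R) [X in _ <= X]intrM in h2.
by apply/andP; split; lra.
Qed.

Lemma cube_coarser k x i : cube k x i = (cube k.+1 x i %/ 2)%Z.
Proof. by rewrite !ffunE floor_half exprS mulrA. Qed.

Lemma eq_cube_coarser k n x y : cube (k + n) x = cube (k + n) y -> cube k x = cube k y.
Proof.
elim: n => [|n IH]; first by rewrite addn0.
rewrite addnS => e; apply: IH; apply/ffunP => i.
by rewrite !(cube_coarser (k + n)) e.
Qed.

Lemma cube_near k x y : cube k x = cube k y ->
  forall i, `|x ord0 i - y ord0 i| < 2^-1 ^+ k.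
Proof.
move=> e i; have p : 0 < 2 ^+ k :> R by rewrite exprn_gt0.
have : cube k x i = cube k y i by rewrite e.
rewrite !ffunE => h.
have /andP[h1 h2] := floor_itv (2 ^+ k * x ord0 i).
have /andP[h3 h4] := floor_itv (2 ^+ k * y ord0 i).
rewrite h in h1 h2; rewrite intrD in h2; rewrite intrD in h4.
have h5 : `|2 ^+ k * (x ord0 i - y ord0 i)| < 1 by rewrite ltr_norml mulrBr; lra.
by rewrite exprVn -[ltRHS]mul1r ltr_pdivlMr// mulrC -[X in X * _](gtr0_norm p) -normrM.
Qed.

End dyadic_cubes.

Section frostman_tree.
Context {R : realType} {d : nat}.
Variables (g : R) (F : set 'rV[R]_d).
Implicit Types (k j n : nat) (u z : {ffun 'I_d -> int}) (zs : seq {ffun 'I_d -> int}).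

Definition cube_weight k : R := (2^-1 ^+ k) `^ g.

Lemma cube_weight_gt0 k : 0 < cube_weight k.
Proof. by rewrite powR_gt0// exprn_gt0. Qed.

(* A finite measure [w] on [F], with mass at most [cube_weight j] on every cube of
   generation [j], and a cover [L] of the same total weight (max flow = min cut). *)
Definition frostman_flow k n zs : Prop :=
  exists (w : seq (R * 'rV[R]_d)) (L : seq (nat * 'rV[R]_d)),
  [/\ forall p, p \in w -> [/\ 0 <= p.1, F p.2 & cube k p.2 \in zs],
      forall y, F y -> cube k y \in zs ->
        exists2 c, c \in L & cube c.1 c.2 = cube c.1 y,
      forall c, c \in L -> (k <= c.1)%N,
      \sum_(p <- w) p.1 = \sum_(c <- L) cube_weight c.1 &
      forall j u, (k <= j <= k + n)%N ->
        \sum_(p <- w | cube j p.2 == u) p.1 <= cube_weight j].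

Lemma frostman_flow_nil k n : frostman_flow k n [::].
Proof.
exists [::], [::]; split => //; first by rewrite !big_nil.
by move=> j u _; rewrite big_nil ltW// cube_weight_gt0.
Qed.

Let cube_disjoint k j z zs (w : seq (R * 'rV[R]_d)) (x : 'rV[R]_d) : (k <= j)%N ->
  cube k x \notin zs -> (forall p, p \in w -> cube k p.2 \in zs) ->
  \sum_(p <- w | cube j p.2 == cube j x) p.1 = 0.
Proof.
move=> kj xz wz; rewrite big_seq_cond big1// => p /andP[pw /eqP e].
by move: xz; rewrite -(@eq_cube_coarser _ _ k (j - k) p.2 x) ?subnKC// wz.
Qed.

(** A cube of generation [j >= k] lies in a single cube of generation [k], so it receives mass from
    only one of the two flows and its bound survives their union. *)
Lemma frostman_flow_cons k n z zs : z \notin zs ->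
  frostman_flow k n [:: z] -> frostman_flow k n zs -> frostman_flow k n (z :: zs).
Proof.
move=> zzs [w1 [L1 [w1P L1c L1k m1 b1]]] [w2 [L2 [w2P L2c L2k m2 b2]]].
exists (w1 ++ w2), (L1 ++ L2); split.
- move=> p; rewrite mem_cat => /orP[/w1P|/w2P] [? ? h]; split => //.
  + by rewrite inE; rewrite inE in h; rewrite h.
  + by rewrite inE h orbT.
- move=> y Fy; rewrite inE => /orP[h|h].
  + have [|c cL e] := L1c y Fy; first by rewrite inE.
    by exists c => //; rewrite mem_cat cL.
  + by have [c cL e] := L2c y Fy h; exists c => //; rewrite mem_cat cL orbT.
- by move=> c; rewrite mem_cat => /orP[/L1k|/L2k].
- by rewrite !big_cat/= m1 m2.
- move=> j u jk; have /andP[kj _] := jk; rewrite big_cat/=.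
  have [[x xw /eqP <-]|nw2] := pselect (exists2 p, p \in w2 & cube j p.2 == u).
  + rewrite (@cube_disjoint k j z [:: z] w1) ?add0r//; first exact: b2.
      have [_ _ h] := w2P _ xw.
      by rewrite inE; apply: contra zzs => /eqP <-.
    by move=> p /w1P[].
  + rewrite [X in _ + X]big_seq_cond [X in _ + X]big_pred0 ?addr0; first exact: b1.
    move=> p; apply/negP => /andP[pw2 e]; apply: nw2; by exists p.
Qed.

Lemma frostman_flow_seq k n zs : (forall z, frostman_flow k n [:: z]) ->
  uniq zs -> frostman_flow k n zs.
Proof.
move=> h; elim: zs => [_|z zs IH /= /andP[zzs uzs]]; first exact: frostman_flow_nil.
by apply: frostman_flow_cons => //; exact: IH.
Qed.

(** [undup] provides the duplicate-free list required by [frostman_flow_seq] whether or not the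
    enumeration is injective. *)
Definition cube_children z : seq {ffun 'I_d -> int} :=
  undup [seq [ffun i => 2 * z i + (e i : nat)%:Z] | e : {ffun 'I_d -> bool}].

Lemma mem_cube_children k (y : 'rV[R]_d) z :
  (cube k.+1 y \in cube_children z) = (cube k y == z).
Proof.
rewrite mem_undup; apply/idP/eqP => [/mapP[e _ E]|<-].
  apply/ffunP => i; rewrite cube_coarser E ffunE.
  by case: (e i) => /=; lia.
pose e : {ffun 'I_d -> bool} := [ffun i => (cube k.+1 y i %% 2)%Z == 1].
apply/mapP; exists e; first by rewrite mem_enum.
apply/ffunP => i; rewrite [RHS]ffunE (cube_coarser k) [e i]ffunE.
by case: eqP => /=; lia.
Qed.

(** If the flow of the children fits into the capacity of the parent, it is kept with its cover.
    Otherwise it is scaled down to that capacity and the cover becomes the parent alone. In both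
    cases mass and cover weight stay equal. *)
Lemma frostman_flow_step k n z :
  frostman_flow k.+1 n (cube_children z) -> frostman_flow k n.+1 [:: z].
Proof.
move=> [w [L [wP Lc Lk m b]]].
have wz p : p \in w -> cube k p.2 = z.
  by move=> /wP[_ _]; rewrite mem_cube_children => /eqP.
have M0 : 0 <= \sum_(p <- w) p.1.
  by rewrite big_seq sumr_ge0// => p /wP[].
set M := \sum_(p <- w) p.1 in m M0.
have [Mk|kM] := lerP M (cube_weight k).
- exists w, L; split => //.
  + by move=> p pw; have [? ? _] := wP _ pw; split => //; rewrite inE wz.
  + by move=> y Fy; rewrite inE => yz; apply: Lc => //; rewrite mem_cube_children.
  + by move=> c /Lk; exact: ltnW.
  + move=> j u /andP[]; rewrite leq_eqVlt => /predU1P[<- _|kj jk]; last first.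
      by apply: b; rewrite kj addSnnS.
    apply: le_trans Mk; rewrite /M big_mkcond !big_seq; apply: ler_sum => p /wP[h _ _].
    by case: ifP.
- have M_gt0 : 0 < M by apply: lt_trans kM; exact: cube_weight_gt0.
  pose q := cube_weight k / M.
  have q0 : 0 <= q by rewrite divr_ge0// ltW// cube_weight_gt0.
  have q1 : q <= 1 by rewrite ler_pdivrMr// mul1r ltW.
  (* Covers list cubes through points, so the parent needs one; the positive mass supplies an atom
     inside it. *)
  have [p0 p0w] : exists p, p \in w.
    move: M_gt0; rewrite /M; case: (w) => [|p w' _]; last by exists p; rewrite mem_head.
    by rewrite big_nil ltxx.
  have [_ Fp0 _] := wP _ p0w.
  exists [seq (q * p.1, p.2) | p <- w], [:: (k, p0.2)]; split.
  + move=> _ /mapP[p pw ->]/=; have [h1 h2 _] := wP _ pw.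
    by split => //; [exact: mulr_ge0|rewrite inE wz].
  + move=> y Fy; rewrite inE => /eqP yz.
    by exists (k, p0.2); rewrite ?inE//= yz wz.
  + by move=> c; rewrite inE => /eqP ->.
  + by rewrite big_map/= -mulr_sumr -/M big_seq1 /q mulfVK// gt_eqF.
  + move=> j u /andP[]; rewrite leq_eqVlt => /predU1P[<- _|kj jk]; last first.
      rewrite big_map/= -mulr_sumr.
      apply: (@le_trans _ _ (1 * \sum_(p <- w | cube j p.2 == u) p.1)).
        apply: ler_wpM2r => //; rewrite big_seq_cond sumr_ge0//.
        by move=> p /andP[/wP[]].
      by rewrite mul1r; apply: b; rewrite kj addSnnS.
    rewrite big_map/= -mulr_sumr.
    apply: (@le_trans _ _ (q * M)); last by rewrite /q mulfVK// gt_eqF.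
    apply: ler_wpM2l => //; rewrite /M big_mkcond !big_seq.
    by apply: ler_sum => p /wP[h _ _]; case: ifP.
Qed.

Lemma frostman_flow_leaf k z : frostman_flow k 0 [:: z].
Proof.
have [[x [Fx xz]]|nF] := pselect (exists x, F x /\ cube k x = z).
- exists [:: (cube_weight k, x)], [:: (k, x)]; split.
  + move=> p; rewrite inE => /eqP ->; rewrite /= inE xz eqxx.
    by split => //; rewrite ltW// cube_weight_gt0.
  + move=> y Fy; rewrite inE => /eqP yz; exists (k, x); rewrite ?inE//=.
    by rewrite xz yz.
  + by move=> c; rewrite inE => /eqP ->.
  + by rewrite !big_seq1.
  + move=> j u; rewrite addn0 -eqn_leq => /eqP <-.
    rewrite big_mkcond big_seq1/=; case: ifP => // _.
    by rewrite ltW// cube_weight_gt0.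
- exists [::], [::]; split => //.
  + by move=> y Fy; rewrite inE => /eqP yz; exfalso; apply: nF; exists y.
  + by rewrite !big_nil.
  + by move=> j u _; rewrite big_nil ltW// cube_weight_gt0.
Qed.

Lemma frostman_flow1 n k z : frostman_flow k n [:: z].
Proof.
elim: n k z => [|n IH] k z; first exact: frostman_flow_leaf.
apply: frostman_flow_step; apply: frostman_flow_seq => //; exact: undup_uniq.
Qed.

End frostman_tree.

Section frostman.
Context {R : realType} {d : nat}.
Implicit Types (g : R) (F : set 'rV[R]_d).

Lemma exprn_half_le (e : R) : 0 < e -> exists n : nat, 2^-1 ^+ n <= e.
Proof.
move=> e0; exists (Num.bound e^-1).
have h : e^-1 < (Num.bound e^-1)%:R by apply: archi_boundP; rewrite invr_ge0 ltW.
rewrite exprVn -[leRHS]invrK lef_pV2 ?posrE ?exprn_gt0 ?invr_gt0//.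
apply: ltW; apply: lt_le_trans h _; rewrite -natrX ler_nat.
by rewrite ltnW// ltn_expl.
Qed.

Lemma ler_exprn_half (m n : nat) : (m <= n)%N -> 2^-1 ^+ n <= 2^-1 ^+ m :> R.
Proof. by move=> mn; apply: ler_wiXn2l => //; rewrite invf_le1// ler1n. Qed.

Lemma euclidean_norm_le (x : 'rV[R]_d) (e : R) : 0 <= e ->
  (forall i, `|x ord0 i| <= e) -> euclidean_norm x <= d%:R * e.
Proof.
move=> e0 xe; rewrite /euclidean_norm -[leRHS]ger0_norm ?mulr_ge0// -sqrtr_sqr.
rewrite ler_sqrt ?sqr_ge0//.
apply: (@le_trans _ _ (\sum_(i < d) e ^+ 2)).
  by apply: ler_sum => i _; rewrite -[leLHS]real_normK ?num_real// lerXn2r ?nnegrE.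
rewrite sumr_const card_ord exprMn -[X in X <= _]mulr_natl; apply: ler_wpM2r; first exact: sqr_ge0.
by rewrite -natrX ler_nat; case: d => // n; rewrite -[X in (X <= _)%N]expn1 leq_pexp2l.
Qed.

Lemma coord_le_euclidean_norm (x : 'rV[R]_d) i : `|x ord0 i| <= euclidean_norm x.
Proof.
rewrite /euclidean_norm -sqrtr_sqr ler_sqrt; last by rewrite sumr_ge0// => j _; exact: sqr_ge0.
by rewrite (bigD1 i)//= lerDl sumr_ge0// => j _; exact: sqr_ge0.
Qed.

Lemma hausdorff_content_ge0 T (dist : T -> T -> R) g (G : set T) (e : R) :
  (0 <= hausdorff_content dist g G e)%E.
Proof.
apply: le_ereal_inf_tmp => _ [x [r [_ _ ->]]].
by apply: nneseries_ge0 => n _ _; rewrite lee_fin powR_ge0.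
Qed.

Lemma hausdorff_measure_neq0 T (dist : T -> T -> R) g (G : set T) :
  hausdorff_measure dist g G <> 0%E ->
  exists2 e : R, 0 < e & (0 < hausdorff_content dist g G e)%E.
Proof.
move=> h; apply: contrapT => n; apply: h.
rewrite /hausdorff_measure; apply: lim_near_cst => //.
near=> e; apply/eqP; rewrite eq_le hausdorff_content_ge0 andbT leNgt.
by apply/negP => h; apply: n; exists e.
Unshelve. all: end_near. Qed.

(** A cube of side [2^-k] has diameter at most [d 2^-k]; the radius uses [d + 1] because balls are
    open. *)
Lemma hausdorff_content_le_seq g F (e : R) (L : seq (nat * 'rV[R]_d)) : 0 < g ->
  0 <= e -> (forall c, c \in L -> d.+1%:R * 2^-1 ^+ c.1 <= e) ->
  (forall y, F y -> exists2 c, c \in L & cube c.1 c.2 = cube c.1 y) ->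
  (hausdorff_content (@euclidean_dist R d) g F e <=
   ((2 * d.+1%:R) `^ g * \sum_(c <- L) cube_weight g c.1)%:E)%E.
Proof.
move=> g0 e0 Le Lc.
pose rad (c : nat * 'rV[R]_d) : R := d.+1%:R * 2^-1 ^+ c.1.
have rad0 c : 0 <= rad c by rewrite mulr_ge0// exprn_ge0.
(* Beyond the list the default radius 0 gives empty balls, which contribute nothing since
   [g > 0]. *)
pose x n := nth 0 (map snd L) n; pose r n := nth 0 (map rad L) n.
have xE n : (n < size L)%N -> x n = (nth (0%N, 0) L n).2.
  by move=> nL; rewrite /x (nth_map (0%N, 0)).
have rE n : (n < size L)%N -> r n = rad (nth (0%N, 0) L n).
  by move=> nL; rewrite /r (nth_map (0%N, 0)).
have r0 n : (size L <= n)%N -> r n = 0.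
  by move=> nL; rewrite /r nth_default// size_map.
apply: ereal_inf_lbound; exists x, r; split.
- move=> y /Lc[c cL e1]; exists (index c L) => //=.
  have iL : (index c L < size L)%N by rewrite index_mem.
  rewrite /metric_ball/= /euclidean_dist xE// rE// nth_index//.
  apply: (@le_lt_trans _ _ (d%:R * 2^-1 ^+ c.1)).
    apply: euclidean_norm_le; first by rewrite exprn_ge0.
    by move=> i; rewrite !mxE; exact/ltW/cube_near.
  by rewrite /rad ltr_pM2r ?exprn_gt0// ltr_nat.
- move=> n; have [nL|nL] := ltnP n (size L); last by rewrite r0// lexx.
  by rewrite rE// rad0/= Le// mem_nth.
- rewrite (nneseries_split 0 (size L)); last first.
    by move=> k _; rewrite lee_fin powR_ge0.
  rewrite eseries0 ?adde0; last first.
    by move=> i iL _; rewrite r0 ?mulr0 ?powR0 ?gt_eqF.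
  rewrite sumEFin; congr EFin.
  rewrite (big_nth (0%N, 0)) mulr_sumr add0n !big_seq.
  apply: eq_bigr => i; rewrite mem_index_iota => /= iL.
  by rewrite rE// /rad /cube_weight mulrA [RHS]powRM// exprn_ge0.
Qed.

Lemma cubes_finite k F (M : R) : (forall y, F y -> forall i, `|y ord0 i| <= M) ->
  exists2 zs : seq {ffun 'I_d -> int}, uniq zs & forall y, F y -> cube k y \in zs.
Proof.
move=> FM; pose N := Num.bound (2 ^+ k * M).
pose tab (e : {ffun 'I_d -> 'I_(N.+1 + N.+1)}) : {ffun 'I_d -> int} :=
  [ffun i => (e i : nat)%:Z - N.+1%:Z].
exists (undup (map tab (enum {ffun 'I_d -> 'I_(N.+1 + N.+1)}))); first exact: undup_uniq.
move=> y Fy; rewrite mem_undup.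
have B i : (`|cube k y i|%N <= N.+1)%N /\ cube k y i < N.+1%:Z.
  have yM := FM _ Fy i.
  have NM : 2 ^+ k * M < N%:R.
    apply: archi_boundP; rewrite mulr_ge0 ?exprn_ge0//; exact: le_trans yM.
  have p : 0 < 2 ^+ k :> R by rewrite exprn_gt0.
  have h : `|2 ^+ k * y ord0 i| <= 2 ^+ k * M.
    by rewrite normrM (gtr0_norm p) ler_pM2l.
  have /andP[h1 h2] := floor_itv (2 ^+ k * y ord0 i).
  rewrite intrD in h2; move: h; rewrite ler_norml => /andP[h3 h4].
  rewrite ffunE; set m := Num.floor _ in h1 h2 *.
  have u1 : m < N%:Z by rewrite -(ltr_int R); apply: le_lt_trans NM; lra.
  have u2 : - N%:Z - 1 < m.
    by rewrite -(ltr_int R) intrB intrN; move: NM; lra.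
  lia.
have C i : (absz (cube k y i + N.+1%:Z)%R < N.+1 + N.+1)%N by have := B i; lia.
apply/mapP; exists [ffun i => Ordinal (C i)]; first by rewrite mem_enum.
by apply/ffunP => i; rewrite !ffunE/=; have := B i; rewrite ffunE; lia.
Qed.

Definition near_coord (x y : 'rV[R]_d) (r : R) : bool :=
  [forall i, `|y ord0 i - x ord0 i| <= r].

Lemma near_coord_cube j (x y : 'rV[R]_d) (r : R) : r <= 2^-1 ^+ j -> near_coord x y r ->
  exists e : {ffun 'I_d -> 'I_3},
    cube j y = [ffun i => cube j x i + (e i : nat)%:Z - 1].
Proof.
move=> rj /forallP xy.
have B i : (absz (cube j y i - cube j x i + 1)%R < 3)%N /\ -1 <= cube j y i - cube j x i.
  have p : 0 < 2 ^+ j :> R by rewrite exprn_gt0.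
  have h : `|2 ^+ j * (y ord0 i - x ord0 i)| <= 1.
    rewrite normrM (gtr0_norm p) mulrC -ler_pdivlMr// mul1r -exprVn.
    exact: le_trans (xy i) rj.
  rewrite mulrBr ler_norml in h; case/andP: h => h1 h2.
  rewrite !ffunE.
  have /andP[u1 u2] := floor_itv (2 ^+ j * y ord0 i).
  have /andP[v1 v2] := floor_itv (2 ^+ j * x ord0 i).
  rewrite intrD in u2; rewrite intrD in v2.
  set m := Num.floor _ in u1 u2 *; set n := Num.floor _ in v1 v2 *.
  have l1 : m - n < 2 by rewrite -(ltr_int R) intrB; lra.
  have l2 : - 2%:Z < m - n by rewrite -(ltr_int R) intrB; lra.
  lia.
exists [ffun i => Ordinal (B i).1].
by apply/ffunP => i; rewrite !ffunE/=; have := B i; rewrite !ffunE; lia.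
Qed.

(** The mass of the flow is the weight of a cover by small cubes, hence bounded below through the
    Hausdorff content, uniformly in [n]. Normalizing it therefore costs a fixed constant. *)
Theorem discrete_frostman g F (M : R) : 0 < g ->
  (forall y, F y -> forall i, `|y ord0 i| <= M) ->
  hausdorff_measure (@euclidean_dist R d) g F <> 0%E ->
  exists2 C : R, 0 < C & forall n, exists w : seq (R * 'rV[R]_d),
    [/\ forall p, p \in w -> 0 <= p.1 /\ F p.2,
        \sum_(p <- w) p.1 = 1 &
        forall x r, 2^-1 ^+ n <= r ->
          \sum_(p <- w | near_coord x p.2 r) p.1 <= C * r `^ g].
Proof.
move=> g0 FM /hausdorff_measure_neq0[e e0 He].
have d1 : 0 < d.+1%:R :> R by rewrite ltr0n.
have pow_le (y z : R) : 0 <= y -> y <= z -> y `^ g <= z `^ g.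
  move=> y0 yz; apply: ge0_ler_powR; rewrite ?nnegrE ?(ltW g0)//.
  exact: le_trans yz.
(* From generation [k0] on, the balls around cubes have radius at most [e], so the positive content
   at [e] applies to the covers. *)
have [k0 k0e] := @exprn_half_le (e / d.+1%:R) (divr_gt0 e0 d1).
have [zs uzs Fzs] := cubes_finite k0 FM.
have [kap kap0 kape] : exists2 kap : R, 0 < kap &
    (kap%:E <= hausdorff_content (@euclidean_dist R d) g F e)%E.
  case: (hausdorff_content _ _ _ _) He => [h|_|//].
  - by rewrite lte_fin => h0; exists h.
  - by exists 1 => //; exact: leey.
pose D : R := (2 * d.+1%:R) `^ g.
have D0 : 0 < D by rewrite powR_gt0// mulr_gt0.
pose m0 := kap / D.
have m0_gt0 : 0 < m0 by exact: divr_gt0.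
(* The first term serves radii above [2^-k0], where the total mass 1 is a good enough bound. The
   second counts the [3^d] neighbouring cubes of a smaller radius. *)
pose C := (2 ^+ k0) `^ g + (3 ^ d)%:R * 2 `^ g / m0.
have C1 : 0 < (3 ^ d)%:R * 2 `^ g / m0.
  by rewrite divr_gt0// mulr_gt0 ?powR_gt0// ltr0n expn_gt0.
have C2 : 0 < (2 ^+ k0 : R) `^ g by rewrite powR_gt0// exprn_gt0.
exists C; first exact: addr_gt0.
move=> n; have [w [L [wP Lc Lk m b]]] := frostman_flow_seq (frostman_flow1 g F n k0) uzs.
set mass := \sum_(p <- w) p.1 in m.
have mass_ge : m0 <= mass.
  rewrite ler_pdivrMr// mulrC m -lee_fin; apply: le_trans kape _.
  apply: hausdorff_content_le_seq => //; first exact: ltW.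
    move=> c /Lk cL; rewrite mulrC -ler_pdivlMr//; apply: le_trans k0e.
    exact: ler_exprn_half.
  by move=> y Fy; apply: Lc => //; exact: Fzs.
have mass0 : 0 < mass by exact: lt_le_trans mass_ge.
exists [seq (p.1 / mass, p.2) | p <- w]; split.
- move=> _ /mapP[p pw ->]/=; have [h1 h2 _] := wP _ pw; split => //.
  by rewrite divr_ge0// ltW.
- by rewrite big_map/= -mulr_suml -/mass divff// gt_eqF.
move=> x r nr; rewrite big_map/= -mulr_suml ler_pdivrMr//.
have r_gt0 : 0 < r by apply: lt_le_trans nr; rewrite exprn_gt0.
have rg0 : 0 < r `^ g by exact: powR_gt0.
have [kr|rk] := lerP (2^-1 ^+ k0) r.
  apply: (@le_trans _ _ mass).
    rewrite /mass big_mkcond !big_seq.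
    by apply: ler_sum => p /wP[h _ _]; case: ifP.
  rewrite ler_peMl//; first exact: ltW.
  apply: (@le_trans _ _ ((2 ^+ k0) `^ g * r `^ g)); last first.
    by rewrite ler_pM2r// lerDl ltW.
  have p : 0 < 2 ^+ k0 :> R by rewrite exprn_gt0.
  rewrite -powRM; [|exact: ltW|exact: ltW].
  have := @pow_le 1 (2 ^+ k0 * r) ler01; rewrite powR1; apply.
  by rewrite mulrC -ler_pdivrMr// mul1r -exprVn.
have ex : exists j, 2^-1 ^+ j.+1 <= r.
  by exists n; apply: le_trans nr; exact: ler_exprn_half.
(* Minimality gives [2^-(j+1) <= r <= 2^-j]: cubes of generation [j] are wide enough for [3^d] of
   them to suffice, and their weight is at most [2^g r^g]. *)
have jP := ex_minnP ex; case: jP => j jr jmin.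
have k0j : (k0 <= j)%N.
  rewrite leqNgt; apply/negP => jk.
  have := ler_exprn_half jk; move: jr rk; lra.
have jn : (j <= n)%N.
  by apply: jmin; apply: le_trans nr; exact: ler_exprn_half.
have rj : r <= 2^-1 ^+ j.
  case: (j) jmin k0j => [_ k00|i im _].
    by apply: ltW; apply: lt_le_trans rk _; exact: ler_exprn_half.
  by rewrite leNgt; apply/negP => /ltW /im; rewrite ltnn.
pose nb (e' : {ffun 'I_d -> 'I_3}) : {ffun 'I_d -> int} :=
  [ffun i => cube j x i + (e' i : nat)%:Z - 1].
apply: (@le_trans _ _ (\sum_(e' : {ffun 'I_d -> 'I_3})
    \sum_(p <- w | cube j p.2 == nb e') p.1)).
  rewrite big_mkcond/=.
  under [leRHS]eq_bigr do rewrite big_mkcond/=.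
  rewrite exchange_big/= !big_seq; apply: ler_sum => p /wP[p0 _ _].
  case: ifP => [/(near_coord_cube rj)[e' /eqP E]|_].
    rewrite (bigD1 e')//= /nb E lerDl sumr_ge0// => u _.
    by case: ifP.
  by rewrite sumr_ge0// => u _; case: ifP.
apply: (@le_trans _ _ (\sum_(e' : {ffun 'I_d -> 'I_3}) cube_weight g j)).
  apply: ler_sum => e' _; apply: b; rewrite k0j/=.
  by rewrite (leq_trans jn)// leq_addl.
rewrite sumr_const card_ffun !card_ord -mulr_natl.
have wj : cube_weight g j <= 2 `^ g * r `^ g.
  rewrite -powRM//; last exact: ltW.
  apply: pow_le; first by rewrite exprn_ge0.
  by move: jr; rewrite exprS; lra.
apply: (@le_trans _ _ ((3 ^ d)%:R * (2 `^ g * r `^ g))).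
  by apply: ler_wpM2l.
apply: (@le_trans _ _ ((3 ^ d)%:R * 2 `^ g / m0 * r `^ g * m0)).
  by rewrite le_eqVlt; apply/orP; left; apply/eqP; field; rewrite gt_eqF.
apply: ler_pM => //; first by rewrite mulr_ge0 ?powR_ge0// ltW.
- exact: ltW.
- by rewrite ler_pM2r// lerDr ltW.
Qed.

End frostman.

(** * Gaussian potentials of discrete Frostman measures *)

Section gaussian_potential.
Context {R : realType} {d : nat}.

Lemma sum_exprn_half_le (N : nat) : \sum_(j < N) 2^-1 ^+ j <= 2 :> R.
Proof.
have h : \sum_(j < N) 2^-1 ^+ j = 2 - 2 * 2^-1 ^+ N :> R.
  elim: N => [|N IH]; first by rewrite big_ord0 expr0; ring.
  by rewrite big_ord_recr/= IH exprS; field.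
by rewrite h lerBlDr lerDl mulr_ge0// exprn_ge0.
Qed.

Lemma expRN_le (m : nat) (y : R) : (0 < m)%N -> 0 < y ->
  expR (- y) <= (m%:R / y) ^+ m.
Proof.
move=> m0 y0; have mr : 0 < m%:R :> R by rewrite ltr0n.
have -> : - y = m%:R * (- (y / m%:R)) by field; rewrite gt_eqF.
rewrite expRM_natl lerXn2r ?nnegrE ?expR_ge0//; first by rewrite divr_ge0// ltW.
rewrite expRN -[leRHS]invrK lef_pV2 ?posrE ?expR_gt0//; last first.
  by rewrite invr_gt0 divr_gt0.
by rewrite invf_div; apply: le_trans (expR_ge1Dx _); rewrite lerDr.
Qed.

(** Decomposition into dyadic shells of size [2^j L] around [x]: the mass grows at most like
    [2^(jg)], which the Gaussian factor beats. All shells have size at least [2^-n], where the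
    Frostman bound is available. *)
Lemma gaussian_potential_le (g c C : R) : 0 < g -> 0 < c -> 0 < C ->
  exists2 C' : R, 0 < C' & forall n (w : seq (R * 'rV[R]_d)),
    (forall p, p \in w -> 0 <= p.1) ->
    (forall x r, 2^-1 ^+ n <= r ->
       \sum_(p <- w | near_coord x p.2 r) p.1 <= C * r `^ g) ->
    forall (x : 'rV[R]_d) (L : R), 2^-1 ^+ n <= L ->
      \sum_(p <- w) p.1 * expR (- c * \sum_(i < d) ((p.2 ord0 i - x ord0 i) ^+ 2 / L ^+ 2))
        <= C' * L `^ g.
Proof.
move=> g0 c0 C0.
(* Decay of order [2 m] in [2^j] leaves a spare factor [2^-j] after [2^(jg)], so the shells sum
   geometrically. *)
have [m m0 gm] : exists2 m : nat, (0 < m)%N & g <= (2 * m - 1)%:R.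
  exists (Num.bound g).+1 => //.
  apply: (@le_trans _ _ (Num.bound g)%:R); first by apply/ltW/archi_boundP/ltW.
  by rewrite ler_nat; lia.
pose Q := 1 + (4 * m%:R / c) ^+ m.
have Q0 : 0 <= (4 * m%:R / c) ^+ m by rewrite exprn_ge0// divr_ge0 ?mulr_ge0// ltW.
(* Outside the previous cube some coordinate exceeds [2^j' L], which gives the exponent [c 4^j']; in
   the innermost cube the trivial bound 1 is used. *)
pose e (j : nat) := if j is j'.+1 then expR (- (c * 4 ^+ j')) else 1 : R.
have e0 j : 0 <= e j by case: j => [|j] /=; rewrite ?expR_ge0.
have eQ j : e j * (2 ^+ j) `^ g <= Q * 2^-1 ^+ j.
  case: j => [|j] /=; first by rewrite !expr0 powR1 !mulr1 /Q lerDl.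
  set t : R := 2 ^+ j.+1.
  have t1 : 1 <= t by rewrite exprn_ege1// ler1n.
  have t0 : 0 < t by exact: lt_le_trans t1.
  have tg : t `^ g <= t ^+ (2 * m - 1).
    by rewrite -powR_mulrn; [exact: ler_powR|exact: ltW].
  have t4 : c * 4 ^+ j = c / 4 * t ^+ 2.
    by rewrite /t -exprM mulnC exprM (_ : 2 ^+ 2 = 4); [rewrite exprS; field|ring].
  have ee : expR (- (c * 4 ^+ j)) <= (4 * m%:R / c) ^+ m / t ^+ (2 * m).
    apply: le_trans (expRN_le m0 _) _.
      by rewrite mulr_gt0// exprn_gt0.
    rewrite t4 exprM -expr_div_n le_eqVlt; apply/orP; left; apply/eqP.
    by congr (_ ^+ _); field; rewrite !gt_eqF.
  apply: (@le_trans _ _ ((4 * m%:R / c) ^+ m / t ^+ (2 * m) * t ^+ (2 * m - 1))).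
    by apply: ler_pM => //; rewrite ?expR_ge0 ?powR_ge0.
  have -> : t ^+ (2 * m) = t * t ^+ (2 * m - 1) by rewrite -exprS; congr (_ ^+ _); lia.
  have s0 : 0 < t ^+ (2 * m - 1) by rewrite exprn_gt0.
  have -> : (4 * m%:R / c) ^+ m / (t * t ^+ (2 * m - 1)) * t ^+ (2 * m - 1) =
      (4 * m%:R / c) ^+ m / t.
    by move: (_ ^+ m) (_ ^+ (2 * m - 1)) s0 => A s s0; field; rewrite !gt_eqF.
  rewrite exprVn -/t; apply: ler_wpM2r; first by rewrite invr_ge0 ltW.
  by rewrite /Q lerDr.
exists (C * (Q * 2)); first by rewrite !mulr_gt0// /Q ltr_wpDr.
move=> n w w0 wC x L nL.
have L0 : 0 < L by apply: lt_le_trans nL; rewrite exprn_gt0.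
have ex (p : R * 'rV[R]_d) : exists j, near_coord x p.2 (2 ^+ j * L).
  pose B := \sum_(i < d) `|p.2 ord0 i - x ord0 i| + 1.
  have B0 : 0 < B by rewrite ltr_wpDl// sumr_ge0.
  have [j hj] := @exprn_half_le R (L / B) (divr_gt0 L0 B0); exists j.
  apply/forallP => i; apply: (@le_trans _ _ B).
    by rewrite /B (bigD1 i)//= -addrA lerDl addr_ge0// sumr_ge0.
  move: hj; rewrite exprVn ler_pdivlMr// mulrC ler_pdivrMr ?exprn_gt0//.
  by rewrite mulrC.
pose jp p := ex_minn (ex p).
pose N := (\max_(p <- w) jp p).+1.
have jN p : p \in w -> (jp p < N)%N by move=> pw; rewrite ltnS; exact: leq_bigmax_seq.
have pt p : p \in w ->
    expR (- c * \sum_(i < d) ((p.2 ord0 i - x ord0 i) ^+ 2 / L ^+ 2)) <=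
    \sum_(j < N | near_coord x p.2 (2 ^+ j * L)) e j.
  move=> pw; have nj : near_coord x p.2 (2 ^+ jp p * L) by rewrite /jp; case: ex_minnP.
  rewrite (bigD1 (Ordinal (jN _ pw)))//=.
  apply: (@le_trans _ _ (e (jp p))); last by rewrite lerDl sumr_ge0.
  rewrite /jp; case: ex_minnP => -[|j] nearj minj /=.
    rewrite -expR0 ler_expR mulNr oppr_le0 mulr_ge0 ?(ltW c0)// sumr_ge0// => i _.
    by rewrite divr_ge0 ?sqr_ge0.
  have : ~~ near_coord x p.2 (2 ^+ j * L).
    by apply/negP => /minj; rewrite ltnn.
  rewrite negb_forall => /existsP[i]; rewrite -ltNge => hi.
  rewrite ler_expR mulNr lerN2 ler_pM2l//.
  apply: (@le_trans _ _ ((p.2 ord0 i - x ord0 i) ^+ 2 / L ^+ 2)); last first.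
    rewrite (bigD1 i)//= lerDl sumr_ge0// => k _.
    by rewrite divr_ge0 ?sqr_ge0.
  rewrite ler_pdivlMr ?exprn_gt0// -[leRHS]real_normK ?num_real//.
  have -> : 4 ^+ j * L ^+ 2 = (2 ^+ j * L) ^+ 2.
    by rewrite exprMn -exprM mulnC exprM (_ : 2 ^+ 2 = 4); [|ring].
  by rewrite lerXn2r ?nnegrE ?mulr_ge0 ?exprn_ge0 ?(ltW L0) ?(ltW hi).
apply: (@le_trans _ _ (\sum_(j < N) e j * (C * (2 ^+ j * L) `^ g))).
  apply: (@le_trans _ _ (\sum_(p <- w) \sum_(j < N | near_coord x p.2 (2 ^+ j * L)) e j * p.1)).
    rewrite !big_seq; apply: ler_sum => p pw.
    by rewrite mulrC -[leRHS]mulr_suml; apply: ler_wpM2r; [exact: w0|exact: pt].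
  under eq_bigr do rewrite big_mkcond/=.
  rewrite exchange_big/=; apply: ler_sum => j _.
  rewrite -big_mkcond/= -mulr_sumr; apply: ler_wpM2l; first exact: e0.
  apply: wC; apply: le_trans nL _; rewrite ler_peMl//; first exact: ltW.
  by rewrite exprn_ege1// ler1n.
apply: (@le_trans _ _ (\sum_(j < N) C * L `^ g * (Q * 2^-1 ^+ j))).
  apply: ler_sum => j _; rewrite powRM ?exprn_ge0//; last exact: ltW.
  have -> : e j * (C * ((2 ^+ j) `^ g * L `^ g)) = C * L `^ g * (e j * (2 ^+ j) `^ g) by ring.
  by apply: ler_wpM2l; [rewrite mulr_ge0 ?powR_ge0// ltW|exact: eQ].
rewrite -mulr_sumr -mulr_sumr.
have -> : C * (Q * 2) * L `^ g = C * L `^ g * (Q * 2) by ring.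
apply: ler_wpM2l; first by rewrite mulr_ge0 ?powR_ge0// ltW.
by apply: ler_wpM2l; [rewrite addr_ge0|exact: sum_exprn_half_le].
Qed.

End gaussian_potential.

(** * Second moment method and Riesz energies *)

Section second_moment.
Context {R : realType} {disp : measure_display} {T : measurableType disp}.
Variable P : probability T R.

Let integrable_indicZ (A : set T) (k : R) : measurable A ->
  P.-integrable setT (EFin \o (fun w => k * \1_A w)).
Proof. by move=> mA; apply: (integrableZl _ _ (integrable_indic _ _)). Qed.

Let Rintegral_indicZ (A : set T) (k : R) : measurable A ->
  (\int[P]_w (k * \1_A w) = k * fine (P A))%R.
Proof.
move=> mA; rewrite RintegralZl//; last exact: integrable_indic.
by rewrite /Rintegral integral_indic// setIT.
Qed.

Lemma integrable_sum_seq (I : Type) (s : seq I) (h : I -> T -> R) :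
  (forall i, P.-integrable setT (EFin \o h i)) ->
  P.-integrable setT (EFin \o (fun w => \sum_(i <- s) h i w)) /\
  (\int[P]_w (\sum_(i <- s) h i w) = \sum_(i <- s) \int[P]_w h i w)%R.
Proof.
move=> ih; elim: s => [|i s [IH1 IH2]].
  split.
    by under eq_fun do rewrite big_nil; exact: (finite_measure_integrable_cst _ 0).
  under eq_Rintegral do rewrite big_nil.
  by rewrite big_nil Rintegral_cst// mul0r.
split.
  rewrite (_ : EFin \o _ = (fun w => (h i w)%:E + (\sum_(j <- s) h j w)%:E)%E).
    exact: (integrableD measurableT (ih i) IH1).
  by apply/funext => w /=; rewrite big_cons EFinD.
under eq_Rintegral do rewrite big_cons.
by rewrite RintegralD// IH2 big_cons.
Qed.

(* Integrates [2 l Z - l^2 Z^2 <= 1_U], [Z = \sum_i q i 1_(A i)], at [l = p / S]. *)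
Lemma second_moment_lower (I : eqType) (s : seq I) (q : I -> R) (A : I -> set T)
    (U : set T) (p S : R) :
  (forall i, measurable (A i)) -> measurable U ->
  (forall i, i \in s -> A i `<=` U) ->
  0 < S -> p <= \sum_(i <- s) q i * fine (P (A i)) ->
  0 <= p ->
  \sum_(i <- s) \sum_(j <- s) q i * q j * fine (P (A i `&` A j)) <= S ->
  ((p ^+ 2 / S)%:E <= P U)%E.
Proof.
move=> mA mU AU S0 hp p0 hS.
pose l := p / S.
have l0 : 0 <= l by rewrite divr_ge0// ltW.
pose Z w := \sum_(i <- s) q i * \1_(A i) w.
pose Z2 w := \sum_(i <- s) \sum_(j <- s) q i * q j * \1_(A i `&` A j) w.
have Z2E w : Z2 w = Z w ^+ 2.
  rewrite expr2 /Z mulr_suml; apply: eq_bigr => i _.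
  rewrite mulr_sumr; apply: eq_bigr => j _.
  by rewrite indicI/=; ring.
have [iZ IZ] := @integrable_sum_seq I s _ (fun i => integrable_indicZ (q i) (mA i)).
have mAA i j : measurable (A i `&` A j) by exact: measurableI.
have h2 i := @integrable_sum_seq I s _ (fun j => integrable_indicZ (q i * q j) (mAA i j)).
have [iZ2 IZ2] := @integrable_sum_seq I s _ (fun i => (h2 i).1).
have PU : P U = (\int[P]_w (\1_U : T -> R) w)%:E.
  rewrite /Rintegral fineK; last by apply: integrable_fin_num => //; exact: integrable_indic.
  by rewrite integral_indic// setIT.
rewrite PU lee_fin.
have i1 : P.-integrable setT (EFin \o (fun w => 2 * l * Z w)).
  exact: (integrableZl _ _ iZ).
have i2 : P.-integrable setT (EFin \o (fun w => l ^+ 2 * Z2 w)).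
  exact: (integrableZl _ _ iZ2).
apply: (@le_trans _ _ (\int[P]_w (2 * l * Z w - l ^+ 2 * Z2 w))).
  rewrite RintegralB// !RintegralZl//.
  have -> : (\int[P]_w Z w = \sum_(i <- s) q i * fine (P (A i)))%R.
    by rewrite IZ; apply: eq_bigr => i _; exact: Rintegral_indicZ.
  have -> : (\int[P]_w Z2 w =
      \sum_(i <- s) \sum_(j <- s) q i * q j * fine (P (A i `&` A j)))%R.
    rewrite IZ2; apply: eq_bigr => i _; rewrite (h2 i).2; apply: eq_bigr => j _.
    exact: Rintegral_indicZ.
  have e1 : 2 * l * p <= 2 * l * \sum_(i <- s) q i * fine (P (A i)).
    by apply: ler_wpM2l => //; rewrite mulr_ge0.
  have e2 : l ^+ 2 * (\sum_(i <- s) \sum_(j <- s) q i * q j * fine (P (A i `&` A j))) <=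
      l ^+ 2 * S by apply: ler_wpM2l => //; exact: sqr_ge0.
  have -> : p ^+ 2 / S = 2 * l * p - l ^+ 2 * S by rewrite /l; field; rewrite gt_eqF.
  lra.
apply: le_Rintegral => //.
- exact: (integrableB measurableT i1 i2).
- exact: integrable_indic.
move=> w _; rewrite Z2E indicE.
have [wU|wU] := boolP (w \in U).
  by have := sqr_ge0 (1 - l * Z w); rewrite /=; lra.
rewrite (_ : Z w = 0) ?expr0n/= ?mulr0 ?subr0// /Z.
rewrite big1_seq// => i /andP[_ si]; rewrite indicE memNset ?mulr0//.
by move=> /(AU _ si) /mem_set; rewrite (negbTE wU).
Qed.

End second_moment.

Section energy.
Context {R : realType}.

Lemma measurable_riesz_kernel (b : R) :
  measurable_fun [set: R * R] (fun z => riesz_kernel b z.1 z.2).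
Proof.
pose h (z : R) : \bar R := if z == 0 then +oo%E else (`|z| `^ (- b))%:E.
have mh : measurable_fun [set: R] h.
  apply: measurable_fun_if => //.
  - by apply: measurable_fun_eqr.
  - apply: measurable_funTS; apply/measurable_EFinP.
    have mn : measurable_fun [set: R] (fun y : R => `|y|) by exact: measurableT_comp.
    have mp : measurable_fun [set: R] (fun x : R => x `^ (- b)) by exact: measurable_powR.
    exact: (measurableT_comp mp mn).
rewrite (_ : (fun z => _) = h \o (fun z : R * R => z.1 - z.2)).
  apply: measurableT_comp => //.
  by apply: measurable_funB; [exact: measurable_fst|exact: measurable_snd].
by apply/funext => -[u v]; rewrite /riesz_kernel /h/= subr_eq0.
Qed.

Lemma riesz_kernel_ge0 (b u v : R) : (0 <= riesz_kernel b u v)%E.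
Proof. by rewrite /riesz_kernel; case: ifP => // _; rewrite lee_fin powR_ge0. Qed.

(* [mu] is replaced by atoms [p.1] at points [p.2] of [E], one for each cell
   [k e, (k + 1) e). *)
Lemma energy_discrete (E : set R) (b e : R) (mu : probability R R) :
  measurable E -> E `<=` `[0, 1] -> mu E = 1%E -> 0 < e ->
  exists s : seq (R * R),
    [/\ forall p, p \in s -> 0 <= p.1 /\ E p.2, \sum_(p <- s) p.1 = 1 &
    forall K : R -> R -> R, (forall x y, 0 <= K x y) ->
      (forall x y u v, `|u - x| <= e -> `|v - y| <= e -> u != v ->
         K x y <= `|u - v| `^ (- b)) ->
      ((\sum_(p <- s) \sum_(q <- s) p.1 * q.1 * K p.2 q.2)%:E <= energy b mu)%E].
Proof.
move=> mE E01 muE e0.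
have [x0 Ex0] : E !=set0.
  apply/set0P/eqP => E0; move: muE; rewrite E0 measure0 => /eqP.
  by rewrite eqe eq_sym oner_eq0.
(* [E] lies in [[0, 1]], so cells with index below [N] cover it. *)
have [N eN] : exists N : nat, e^-1 < N%:R.
  by exists (Num.bound e^-1); apply: archi_boundP; rewrite invr_ge0 ltW.
pose c (k : nat) : set R := E `&` `[k%:R * e, k.+1%:R * e[%classic.
have mc k : measurable (c k) by apply: measurableI => //; exact: measurable_itv.
have idx u : E u -> exists2 k, (k < N)%N & c k u.
  move=> Eu; have := E01 _ Eu; rewrite /= in_itv/= => /andP[u0 u1].
  have ue0 : 0 <= u / e by rewrite divr_ge0// ltW.
  exists (Num.truncn (u / e)).
    rewrite -(ltr_nat R); apply: le_lt_trans eN.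
    apply: (@le_trans _ _ (u / e)); first by rewrite Num.Theory.truncn_le.
    by rewrite ler_piMl// invr_ge0 ltW.
  split => //=; rewrite in_itv/= -ler_pdivlMr// -ltr_pdivrMr//.
  exact: truncn_itv.
have tc : trivIset setT c.
  apply/trivIsetP => i j _ _; wlog ij : i j / (i < j)%N.
    move=> h; rewrite neq_ltn => /orP[ij|ji].
      by apply: h => //; rewrite neq_ltn ij.
    by rewrite setIC; apply: h => //; rewrite neq_ltn ji.
  move=> _; apply/seteqP; split => // u [[_ /=]]; rewrite in_itv/= => /andP[_ h1].
  move=> [_ /=]; rewrite in_itv/= => /andP[h2 _].
  have h3 : i.+1%:R * e <= j%:R * e by rewrite ler_pM2r// ler_nat.
  by have := lt_le_trans h1 (le_trans h3 h2); rewrite ltxx.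
have tcN D : trivIset D (fun i : 'I_N => c i).
  by move=> i j _ _ h; apply/val_inj/tc.
have cE : E = \big[setU/set0]_(k < N) c k.
  apply/seteqP; split => u.
    by move=> /idx[k kN ck]; rewrite -bigcup_mkord; exists k.
  by rewrite -bigcup_mkord => -[k _ []].
(* An empty cell carries no mass; its representative merely has to lie in [E]. *)
pose x k := if pselect (c k !=set0) is left h then xget x0 (c k) else x0.
have xE k : E (x k).
  rewrite /x; case: pselect => // -[y cy].
  by case: xgetP => [z _ []//|/(_ y)].
have xc k u : c k u -> `|u - x k| <= e.
  move=> cu; rewrite /x; case: pselect => [_|/(_ (ex_intro _ u cu))//].
  case: xgetP => [z _ cz|/(_ u)//].
  case: cu => _ /=; rewrite in_itv/= => /andP[h1 h2].
  case: cz => _ /=; rewrite in_itv/= => /andP[h3 h4].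
  move: h2 h4; rewrite -natr1 mulrDl mul1r => h2 h4.
  by rewrite ler_norml; lra.
pose w k := fine (mu (c k)).
have wE k : (w k)%:E = mu (c k) by rewrite /w fineK// fin_num_measure.
exists [seq (w k, x k) | k <- index_iota 0 N]; split.
- by move=> _ /mapP[k _ ->]/=; split => //; rewrite fine_ge0.
- apply: EFin_inj; rewrite big_map -sumEFin/=.
  under eq_bigr do rewrite wE.
  rewrite -muE [in RHS]cE (measure_bigsetU mu mc tc).
  by rewrite big_mkord.
move=> K K0 Kb.
have mr u : measurable_fun setT (riesz_kernel b u).
  exact: (measurableT_comp (measurable_riesz_kernel b) (pair1_measurable u)).
have cell k l u : c k u -> ((K (x k) (x l) * w l)%:E <=
    \int[mu]_(v in c l) riesz_kernel b u v)%E.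
  move=> cu; rewrite EFinM wE -integral_cst//.
  apply: ge0_le_integral => //.
  - by move=> v _; rewrite lee_fin.
  - exact: measurable_funTS.
  move=> v cv; rewrite /riesz_kernel; case: eqVneq => [_|uv]; first exact: leey.
  by rewrite lee_fin; apply: Kb => //; exact: xc.
have inner k u : c k u -> ((\sum_(l < N) K (x k) (x l) * w l)%:E <=
    \int[mu]_v riesz_kernel b u v)%E.
  move=> cu; apply: (@le_trans _ _ (\int[mu]_(v in E) riesz_kernel b u v)%E); last first.
    by apply: ge0_subset_integral => // v _; exact: riesz_kernel_ge0.
  rewrite cE ge0_integral_bigsetU//=.
  - by rewrite -sumEFin; apply: lee_sum => l _; exact: cell.
  - exact: index_enum_uniq.
  - exact: measurable_funTS.
  - by move=> v _; exact: riesz_kernel_ge0.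
have mF : measurable_fun setT (fun u => \int[mu]_v riesz_kernel b u v)%E.
  have := measurable_fun_fubini_tonelli_F (m2 := mu) (fun z : R * R => riesz_kernel b z.1 z.2).
  by apply => [|z]; [exact: measurable_riesz_kernel|exact: riesz_kernel_ge0].
have F0 u : (0 <= \int[mu]_v riesz_kernel b u v)%E.
  by apply: integral_ge0 => v _; exact: riesz_kernel_ge0.
rewrite /energy; apply: (@le_trans _ _ (\int[mu]_(u in E) \int[mu]_v riesz_kernel b u v)%E); last first.
  by apply: ge0_subset_integral.
rewrite cE ge0_integral_bigsetU//=.
- rewrite big_map big_mkord -sumEFin.
  apply: lee_sum => k _.
  have -> : (\sum_(q <- [seq (w l, x l) | l <- index_iota 0 N]) w k * q.1 * K (x k) q.2)%:E =
      ((\sum_(l < N) K (x k) (x l) * w l)%:E * mu (c k))%E.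
    rewrite -wE -EFinM big_map big_mkord mulr_suml.
    by congr EFin; apply: eq_bigr => l _ /=; ring.
  rewrite -integral_cst//; apply: ge0_le_integral => //.
  - move=> u _; rewrite lee_fin sumr_ge0// => l _.
    by rewrite mulr_ge0// fine_ge0.
  - exact: measurable_funTS.
  - by move=> u; exact: inner.
- exact: index_enum_uniq.
- exact: measurable_funTS.
Qed.

End energy.

Section ereal_products.
Context {R : realType} {I : finType}.

Lemma prode_le (x : I -> \bar R) (y : I -> R) :
  (forall i, 0%E <= x i)%E -> (forall i, (x i <= (y i)%:E)%E) ->
  (\prod_i x i <= (\prod_i y i)%:E)%E.
Proof.
move=> x0 xy; suff : (0 <= \prod_i x i)%E /\ (\prod_i x i <= (\prod_i y i)%:E)%E by case.
elim/big_rec2 : _ => [|i v u _ [u0 uv]]; first by split; rewrite ?lee_fin.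
by split; [exact: mule_ge0|rewrite EFinM; exact: lee_pmul].
Qed.

Lemma prode_ge (x : I -> \bar R) (y : I -> R) :
  (forall i, 0 <= y i) -> (forall i, ((y i)%:E <= x i)%E) ->
  ((\prod_i y i)%:E <= \prod_i x i)%E.
Proof.
move=> x0 xy; suff : 0 <= \prod_i y i /\ ((\prod_i y i)%:E <= \prod_i x i)%E by case.
elim/big_rec2 : _ => [|i v u _ [u0 uv]]; first by split; rewrite ?lee_fin.
by split; [exact: mulr_ge0|rewrite EFinM; apply: lee_pmul; rewrite ?lee_fin].
Qed.

End ereal_products.

(** * Probabilities of coordinate balls *)

Section ball_events.
Context {R : realType} {d : nat} {disp : measure_display} {T : measurableType disp}.
Variables (P : probability T R) (B : 'I_d -> R -> {RV P >-> R}).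

(** Cubes instead of Euclidean balls, so that independence of the coordinates turns probabilities
    into products. *)
Definition ball_event (c : 'I_d -> R) (s r : R) : set T :=
  [set w | forall i, `|B i s w - c i| <= r].

Lemma ball_event_sigma i (s c r : R) : s \in `[0, 1] ->
  process_sigma_algebra (B i) [set w | `|B i s w - c| <= r].
Proof.
move=> s01; apply: sub_sigma_algebra; exists s, `[c - r, c + r]%classic; split => //.
by apply/seteqP; split => w /=; rewrite in_itv/= ler_distl.
Qed.

Lemma measurable_coord_ball i (s c r : R) : measurable [set w | `|B i s w - c| <= r].
Proof.
rewrite (_ : [set _ | _] = B i s @^-1` `[c - r, c + r]%classic).
  by rewrite -[X in measurable X]setTI; exact: measurable_funP.
by apply/seteqP; split => w /=; rewrite in_itv/= ler_distl.
Qed.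

Lemma ball_eventE c s r :
  ball_event c s r = \bigcap_(i in [set: 'I_d]) [set w | `|B i s w - c i| <= r].
Proof. by apply/seteqP; split => [w h i _|w h i]; exact: h. Qed.

Lemma measurable_ball_event c s r : measurable (ball_event c s r).
Proof.
rewrite ball_eventE; apply: fin_bigcap_measurable => // i _; exact: measurable_coord_ball.
Qed.

Hypothesis indB : independent_processes B.

Let setT_ord : [set` [set: 'I_d]%SET] = [set: 'I_d].
Proof. by apply/seteqP; split => i //= _; rewrite inE. Qed.

Lemma prob_ball_event c (s r : R) : s \in `[0, 1] ->
  P (ball_event c s r) = (\prod_i P [set w | (`|B i s w - c i| <= r)%R])%E.
Proof.
move=> s01; rewrite ball_eventE -setT_ord indB; last by move=> i _; exact: ball_event_sigma.
by apply: eq_bigl => i; rewrite inE.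
Qed.

Lemma prob_ball_eventI c e (s t r : R) : s \in `[0, 1] -> t \in `[0, 1] ->
  P (ball_event c s r `&` ball_event e t r) =
  (\prod_i P [set w | (`|B i s w - c i| <= r)%R /\ (`|B i t w - e i| <= r)%R])%E.
Proof.
move=> s01 t01.
rewrite (_ : _ `&` _ = \bigcap_(i in [set` [set: 'I_d]%SET])
   [set w | `|B i s w - c i| <= r /\ `|B i t w - e i| <= r]).
  rewrite indB; first by apply: eq_bigl => i; rewrite inE.
  move=> i _.
  apply: (@measurableI _ (g_sigma_algebraType [set C | exists (t : R) (A : set R),
      [/\ t \in `[0, 1], measurable A & C = B i t @^-1` A]]) [set w | `|B i s w - c i| <= r]
      [set w | `|B i t w - e i| <= r]); exact: ball_event_sigma.
rewrite setT_ord; apply/seteqP; split => w; first by move=> [h1 h2] i _; split.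
by move=> h; split => i; have [] := h i I.
Qed.

End ball_events.

Section fbm_ball_events.
Context {R : realType} {d : nat} {disp : measure_display} {T : measurableType disp}.
Variables (P : probability T R) (H : R) (B : 'I_d -> R -> {RV P >-> R}).
Hypotheses (H01 : 0 < H < 1) (fbmB : is_fbm_vector H B).

Let indB : independent_processes B := fbmB.2.
Let H_gt0 : 0 < H. Proof. by case/andP: H01. Qed.

Lemma fbm_marginal i (s : R) A : 0 < s <= 1 -> measurable A ->
  P (B i s @^-1` A) = gaussian_law 0 (s `^ H) A.
Proof.
move=> /andP[s0 s1] mA.
have s01 : s \in `[0, 1] by rewrite in_itv/= (ltW s0).
have [_ /(_ A mA)] := fbm_comb_law (fbmB.1 i) 1 0 s01 s01.
rewrite (_ : (fun w => _) = B i s); last by apply/funext => w; rewrite mul1r mul0r addr0.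
move=> ->; congr gaussian_law.
rewrite /fbm_var2 fbm_covss ?(ltW s0)//.
rewrite !(mul0r, mulr0, addr0, mul1r, expr1n, expr0n)/= ?mul0r ?addr0.
by rewrite sqrtr_sqr ger0_norm ?powR_ge0.
Qed.

Lemma ball_event_le c (s r : R) : 0 < s <= 1 -> 0 <= r ->
  (P (ball_event B c s r) <= ((r / s `^ H) ^+ d)%:E)%E.
Proof.
move=> s01 r0; rewrite prob_ball_event//; last first.
  by case/andP: s01 => ? ?; rewrite in_itv/= ltW.
have -> : (r / s `^ H) ^+ d = \prod_(i < d) (r / s `^ H) by rewrite prodr_const card_ord.
apply: prode_le => i; first exact: measure_ge0.
apply: gaussian_ball_le => //; first by case/andP: s01 => s0 _; exact: powR_gt0.
by move=> A mA; rewrite fbm_marginal.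
Qed.

Lemma ball_event_ge (a M : R) c (s r : R) : 0 < a -> a <= s <= 1 -> 0 <= r ->
  (forall i, `|c i| + r <= M) ->
  (((2 * normal_peak 1 * expR (- (M / a `^ H) ^+ 2 / 2) * r) ^+ d)%:E
    <= P (ball_event B c s r))%E.
Proof.
move=> a0 /andP[sa s1] r0 cM.
have s0 : 0 < s by exact: lt_le_trans sa.
rewrite prob_ball_event//; last by rewrite in_itv/= ltW.
set c0 := (X in (X * r) ^+ d).
have -> : (c0 * r) ^+ d = \prod_(i < d) (c0 * r) by rewrite prodr_const card_ord.
apply: prode_ge => i.
  by rewrite /c0; apply: mulr_ge0 => //; apply: mulr_ge0; rewrite ?expR_ge0// mulr_ge0// normal_peak_ge0.
apply: (@gaussian_ball_ge _ _ _ _ _ (s `^ H)) => //.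
- exact: powR_gt0.
- by move=> A mA; rewrite fbm_marginal ?s0.
- exact: powR_gt0.
- by apply: ge0_ler_powR; rewrite ?nnegrE ?(ltW H_gt0) ?(ltW a0) ?(ltW s0).
have -> : 1 = 1 `^ H :> R by rewrite powR1.
by rewrite ge0_ler_powR ?nnegrE ?(ltW H_gt0) ?(ltW s0).
Qed.

End fbm_ball_events.

(** * Measurability of the hitting event *)

Section separability.
Context {R : realType}.

(** One representative of [F] in each dyadic cube that meets it; pairs of generation and index are
    countable. *)
Lemma dense_seq_rV (d : nat) (F : set 'rV[R]_d) : F !=set0 ->
  exists D : nat -> 'rV[R]_d, (forall n, F (D n)) /\
    forall x, F x -> forall e, 0 < e -> exists n, forall i, `|D n ord0 i - x ord0 i| < e.
Proof.
move=> [x0 Fx0].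
pose rep (c : nat * {ffun 'I_d -> int}) : 'rV[R]_d :=
  xget x0 [set x | F x /\ cube c.1 x = c.2].
have repF c : F (rep c) by rewrite /rep; case: xgetP => [x _ []|].
pose D n : 'rV[R]_d := if unpickle n is Some c then rep c else x0.
exists D; split; first by move=> n; rewrite /D; case: unpickle.
move=> x Fx e e0; have [k ke] := exprn_half_le e0.
exists (pickle (k, cube k x)) => i; rewrite /D pickleK.
apply: lt_le_trans ke; apply: cube_near.
by rewrite /rep; case: xgetP => [y _ []//|/(_ x)[]].
Qed.

Lemma dense_seq_R (E : set R) : E !=set0 ->
  exists D : nat -> R, (forall n, E (D n)) /\
    forall x, E x -> forall e, 0 < e -> exists n, `|D n - x| < e.
Proof.
move=> [x0 Ex0]; pose row1 (x : R) : 'rV[R]_1 := \row_i x.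
have [|D [DE Dd]] := @dense_seq_rV 1 (row1 @` E); first by exists (row1 x0), x0.
exists (fun n => D n ord0 ord0); split.
  by move=> n; have [x Ex <-] := DE n; rewrite mxE.
move=> x Ex e e0; have [|n h] := Dd (row1 x) _ e e0; first by exists x.
by exists n; have := h ord0; rewrite mxE.
Qed.

End separability.

Section hitting_measurability.
Context {R : realType} {d : nat} {disp : measure_display} {T : measurableType disp}.
Variables (P : probability T R) (B : 'I_d -> R -> {RV P >-> R}).
Variables (f : R -> 'rV[R]_d) (a b H K : R) (E : set R) (F : set 'rV[R]_d).
Hypotheses (a_gt0 : 0 < a) (b_le1 : b <= 1) (H_gt0 : 0 < H).
Hypothesis fK : forall s t, s \in `[a, b] -> t \in `[a, b] ->
  euclidean_norm (f t - f s) <= K * `|t - s| `^ H.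
Hypothesis cB : forall i w, {within `[0, 1], continuous (fun t => B i t w)}.
Hypothesis sE : E `<=` `[a, b].

Definition hit_path w s i : R := B i s w + f s ord0 i.

Definition hit_within (r : R) : set T :=
  [set w | exists s x, [/\ E s, F x & forall i, `|hit_path w s i - x ord0 i| < r]].

Let ab01 s : s \in `[a, b] -> s \in `[0, 1].
Proof.
rewrite !in_itv/= => /andP[h1 h2]; apply/andP; split.
  exact: le_trans (ltW a_gt0) h1.
exact: le_trans h2 b_le1.
Qed.

Lemma hit_path_near w (s e : R) : s \in `[a, b] -> 0 < e ->
  exists2 dl : R, 0 < dl & forall t, t \in `[a, b] -> `|t - s| < dl ->
    forall i, `|hit_path w t i - hit_path w s i| < e.
Proof.
move=> sab e0.
have e2 : 0 < e / 2 by rewrite divr_gt0.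
have hB i : \forall t \near s, t \in `[0, 1] -> `|B i s w - B i t w| < e / 2.
  have := (subspace_continuousP _ _).1 (@cB i w) s (ab01 sab).
  by move/cvgrPdist_lt => /(_ _ e2).
have [d1 /= d1_gt0 hd1] := (nbhs_ballP _ _).1 (filter_forall _ hB).
pose k := e / 2 / (`|K| + 1).
have K1 : 0 < `|K| + 1 by rewrite ltr_wpDl.
have k0 : 0 < k by rewrite divr_gt0.
pose d2 := k `^ H^-1.
have d20 : 0 < d2 by rewrite powR_gt0.
exists (Num.min d1 d2); first by rewrite lt_min d1_gt0.
move=> t tab; rewrite lt_min => /andP[t1 t2] i.
have b1 : `|B i s w - B i t w| < e / 2.
  by apply: (hd1 t) => //; [rewrite /ball/= distrC|exact: ab01].
have b2 : `|f t ord0 i - f s ord0 i| < e / 2.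
  apply: (@le_lt_trans _ _ (euclidean_norm (f t - f s))).
    by have := coord_le_euclidean_norm (f t - f s) i; rewrite !mxE.
  apply: le_lt_trans (fK sab tab) _.
  have tH : `|t - s| `^ H <= k.
    have -> : k = d2 `^ H by rewrite -powRrM mulVf ?gt_eqF// powRr1// ltW.
    by apply: ge0_ler_powR; rewrite ?nnegrE ?(ltW H_gt0) ?(ltW d20) ?(ltW t2).
  apply: (@le_lt_trans _ _ (`|K| * k)).
    apply: (@le_trans _ _ (`|K| * `|t - s| `^ H)).
      by rewrite ler_wpM2r ?powR_ge0// ler_norm.
    by rewrite ler_wpM2l.
  rewrite /k mulrA ltr_pdivrMr// mulrC ltr_pM2l// ltrDl ltr01.
  exact: isT.
have -> : hit_path w t i - hit_path w s i =
    - (B i s w - B i t w) + (f t ord0 i - f s ord0 i) by rewrite /hit_path; ring.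
by apply: le_lt_trans (ler_normD _ _) _; rewrite normrN; lra.
Qed.

Let measurable_lt (i : 'I_d) (s c r : R) :
  measurable [set w | `|hit_path w s i - c| < r].
Proof.
have mn : measurable_fun setT (fun w => `|hit_path w s i - c|).
  apply: measurableT_comp => //; apply: measurable_funB => //.
  by rewrite /hit_path; apply: measurable_funD.
rewrite (_ : [set _ | _] = (fun w => `|hit_path w s i - c|) @^-1` `]-oo, r[%classic).
  by rewrite -[X in measurable X]setTI; exact: mn.
by apply/seteqP; split => w /=; rewrite in_itv.
Qed.

(** The condition is open in [s] and [x] along a continuous path, so [s] and [x] may be restricted
    to dense sequences of [E] and [F]. *)
Lemma measurable_hit_within r : measurable (hit_within r).
Proof.
have [E0|/set0P Ene] := eqVneq E set0.
  rewrite (_ : hit_within r = set0)//; apply/seteqP; split => // w [s [x [+ _ _]]].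
  by rewrite E0.
have [F0|/set0P Fne] := eqVneq F set0.
  rewrite (_ : hit_within r = set0)//; apply/seteqP; split => // w [s [x [_ + _]]].
  by rewrite F0.
have [DE [DEE DEd]] := dense_seq_R Ene.
have [DF [DFF DFd]] := dense_seq_rV Fne.
rewrite (_ : hit_within r = \bigcup_m \bigcup_n \bigcap_(i in [set: 'I_d])
    [set w | `|hit_path w (DE m) i - DF n ord0 i| < r]).
  apply: bigcupT_measurable => m; apply: bigcupT_measurable => n.
  apply: fin_bigcap_measurable => // i _; exact: measurable_lt.
apply/seteqP; split => w; last first.
  move=> [m _ [n _ h]]; exists (DE m), (DF n); split => // i; exact: h.
move=> [s [x [Es Fx h]]].
have [e e0 he] : exists2 e : R, 0 < e & forall i, `|hit_path w s i - x ord0 i| + e + e <= r.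
  pose g i := (r - `|hit_path w s i - x ord0 i|) / 2.
  have g0 i : 0 < g i by rewrite divr_gt0// subr_gt0.
  exists (\big[Num.min/1]_i g i).
    by elim/big_ind: _ => // u v u0 v0; rewrite lt_min u0.
  move=> i; have : \big[Num.min/1]_j g j <= g i by rewrite (bigD1 i)//= ge_min lexx.
  by rewrite /g; lra.
have [dl dl0 hdl] := hit_path_near w (sE Es) e0.
have [m hm] := DEd _ Es _ dl0.
have [n hn] := DFd _ Fx _ e0.
exists m => //; exists n => // i _ /=.
have h1 := hdl _ (sE (DEE m)) hm i.
have h2 := hn i.
have -> : hit_path w (DE m) i - DF n ord0 i = (hit_path w (DE m) i - hit_path w s i) +
   (hit_path w s i - x ord0 i) - (DF n ord0 i - x ord0 i) by ring.
apply: le_lt_trans (ler_normB _ _) _.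
have h3 := ler_normD (hit_path w (DE m) i - hit_path w s i) (hit_path w s i - x ord0 i).
have h4 := he i; lra.
Qed.

Hypotheses (cE : compact E) (cF : compact F).

(** Approximate hits at precision [1/(k+1)] have a cluster point in the compact set [E * F], and
    continuity of the path makes it an exact hit. *)
Lemma hitting_eventE :
  hitting_event B f E F = \bigcap_k hit_within k.+1%:R^-1.
Proof.
apply/seteqP; split => w.
  move=> [y [[s Es sy] Fy]] k _; exists s, y; split => // i.
  by rewrite -sy !mxE /hit_path subrr normr0 invr_gt0 ltr0n.
move=> h.
have /choice[p hp] (k : nat) : exists p : R * 'rV[R]_d, [/\ E p.1, F p.2 &
    forall i, `|hit_path w p.1 i - p.2 ord0 i| < k.+1%:R^-1].
  by have [s [x [? ? ?]]] := h k I; exists (s, x).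
have cEF := compact_setX cE cF.
have [|[s x] [[/= Es Fx] cl]] := cEF (p @ \oo) _.
  by exists 0%N => // k _; have [] := hp k.
exists x; split => //; exists s => //.
apply/rowP => i; rewrite !mxE -/(hit_path w s i).
apply/eqP; rewrite -subr_eq0 -normr_le0.
suff small (e : R) : 0 < e -> `|hit_path w s i - x ord0 i| <= e.
  by apply/ler_addgt0Pl => e e0; rewrite addr0; exact: small.
move=> e0.
have e3 : 0 < e / 3 by rewrite divr_gt0.
have [dl dl0 hdl] := hit_path_near w (sE Es) e3.
have [k ke] : exists k : nat, k.+1%:R^-1 < e / 3.
  exists (Num.bound (e / 3)^-1).
  rewrite -[ltRHS]invrK ltf_pV2 ?posrE ?invr_gt0 ?ltr0n//.
  have := @archi_boundP R (e / 3)^-1; rewrite invr_ge0 (ltW e3) => /(_ isT) h1.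
  by apply: lt_le_trans h1 _; rewrite ler_nat.
have n1 : (p @ \oo) (p @` [set n | (k <= n)%N]).
  by exists k => // n /= kn; exists n.
have n2 : nbhs (s, x) (ball s dl `*` ball x (e / 3)).
  exists (ball s dl, ball x (e / 3)) => //; split => /=; exact: nbhsx_ballx.
have [_ [[n kn <-] [/= b1 b2]]] := cl _ _ n1 n2.
have [Epn Fpn hn] := hp n.
have h1 := hdl _ (sE Epn); rewrite distrC in h1; have {}h1 := h1 b1 i.
have h2 := hn i.
have h3 : n.+1%:R^-1 <= k.+1%:R^-1 :> R by rewrite lef_pV2 ?posrE ?ltr0n// ler_nat.
have h4 : `|x ord0 i - (p n).2 ord0 i| < e / 3.
  by case: b2 => _ /(_ ord0 i).
have h5 := lt_le_trans h2 (le_trans h3 (ltW ke)).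
have tri (u v z : R) : `|u| < e / 3 -> `|v| < e / 3 -> `|z| < e / 3 -> `|- u + v - z| <= e.
  move=> hu hv hz; apply: le_trans (ler_normB _ _) _.
  have := ler_normD (- u) v; rewrite normrN; lra.
have -> : hit_path w s i - x ord0 i = - (hit_path w (p n).1 i - hit_path w s i) +
   (hit_path w (p n).1 i - (p n).2 ord0 i) - (x ord0 i - (p n).2 ord0 i) by ring.
exact: tri.
Qed.

Lemma measurable_hitting_event : measurable (hitting_event B f E F).
Proof.
rewrite hitting_eventE; apply: bigcapT_measurable => k; exact: measurable_hit_within.
Qed.

Lemma hitting_event_ge (c : \bar R) :
  (forall r : R, (0 < r)%R -> (c <= P (hit_within r))%E) -> (c <= P (hitting_event B f E F))%E.
Proof.
move=> hc; rewrite hitting_eventE.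
have cv : P (hit_within k.+1%:R^-1) @[k --> \oo] -->
    P (\bigcap_k hit_within k.+1%:R^-1).
  apply: (@nonincreasing_cvg_mu _ _ _ P (fun k => hit_within k.+1%:R^-1)) => //.
  - by rewrite ltey_eq fin_num_measure//; exact: measurable_hit_within.
  - by move=> k; exact: measurable_hit_within.
  - by apply: bigcapT_measurable => k; exact: measurable_hit_within.
  move=> m n mn; apply/subsetPset => w [s [x [Es Fx h]]]; exists s, x; split => // i.
  apply: lt_le_trans (h i) _; by rewrite lef_pV2 ?posrE ?ltr0n// ler_nat.
rewrite -(cvg_lim _ cv)//; apply: lime_ge; first by apply/cvg_ex; eexists; exact: cv.
by apply: nearW => k; apply: hc; rewrite invr_gt0 ltr0n.
Qed.

End hitting_measurability.

(** * Capacity lower bound *)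

Section lower_bound.
Context {R : realType} {d : nat}.
Variables (a b H : R).
Hypotheses (a_gt0 : 0 < a) (a_le1 : a <= 1) (b_le1 : b <= 1) (H01 : 0 < H < 1).

Let H_gt0 : 0 < H. Proof. by case/andP: H01. Qed.

Lemma ball_eventI_le (M K : R) : 0 <= M -> 0 <= K -> exists C c : R,
  [/\ 0 < C, 0 < c & forall (disp : measure_display) (T : measurableType disp)
    (P : probability T R) (B : 'I_d -> R -> {RV P >-> R}), is_fbm_vector H B ->
  forall (s t r : R) (x y z : 'I_d -> R), a <= s <= 1 -> a <= t <= 1 -> 0 < r ->
    (forall i, `|x i| <= M) ->
    (forall i, `|z i - (y i - x i)| <= K * `|t - s| `^ H) ->
    (P (ball_event B x s r `&` ball_event B y t r) <=
     ((C * r ^+ 2 / two_point_scale H s t r) ^+ d *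
      expR (- c * \sum_i (z i ^+ 2 / two_point_scale H s t r ^+ 2)))%:E)%E].
Proof.
move=> M0 K0; have [C [c [C0 c0 h]]] := two_point_le a_gt0 a_le1 H01 M0 K0.
exists C, c; split => // disp T P B fbmB s t r x y z s1 t1 r0 xM zxy.
have s01 u : a <= u <= 1 -> u \in `[0, 1].
  by move=> /andP[ua u1]; rewrite in_itv/= u1 (le_trans (ltW a_gt0) ua).
rewrite (prob_ball_eventI fbmB.2) ?s01//.
set L := two_point_scale H s t r.
have -> : (C * r ^+ 2 / L) ^+ d * expR (- c * \sum_i (z i ^+ 2 / L ^+ 2)) =
   \prod_i (C * r ^+ 2 / L * expR (- c * (z i ^+ 2 / L ^+ 2))).
  by rewrite big_split/= prodr_const card_ord mulr_sumr expR_sum.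
apply: prode_le => i; first exact: measure_ge0.
by apply: h => //; exact: fbmB.1.
Qed.

(** Rounding times by [r^(1/H)] costs [r] after taking the power [H], which [L >= r] absorbs. Three
    distances are added, and [3^H <= 3]. *)
Lemma near_dist_le_scale (e r x y u v : R) : 0 < r -> r <= 1 -> e = r `^ H^-1 ->
  `|u - x| <= e -> `|v - y| <= e -> `|u - v| `^ H <= 3 * two_point_scale H x y r.
Proof.
move=> r0 r1 eE ux vy.
have e0 : 0 < e by rewrite eE powR_gt0.
have eH : e `^ H = r by rewrite eE -powRrM mulVf ?gt_eqF// powRr1// ltW.
set L := two_point_scale H x y r.
have L0 : 0 < L by exact: two_point_scale_gt0.
have LE := two_point_scaleE H x y r; rewrite -/L in LE.
have rL : r <= L.
  by rewrite -ler_sqr ?nnegrE ?(ltW r0) ?(ltW L0)// LE lerDr sqr_ge0.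
have thL : `|y - x| `^ H <= L.
  by rewrite -ler_sqr ?nnegrE ?powR_ge0 ?(ltW L0)// LE lerDl sqr_ge0.
pose m := Num.max `|y - x| e.
have m0 : 0 < m by rewrite lt_max e0 orbT.
have mL : m `^ H <= L by rewrite /m /Num.max; case: ifP => _; [rewrite eH|exact: thL].
have uvm : `|u - v| <= 3 * m.
  have h1 : `|y - x| <= m by rewrite le_max lexx.
  have h2 : e <= m by rewrite le_max lexx orbT.
  have -> : u - v = (u - x) - (v - y) - (y - x) by ring.
  have h3 := ler_normB ((u - x) - (v - y)) (y - x).
  have h4 := ler_normB (u - x) (v - y).
  lra.
apply: (@le_trans _ _ ((3 * m) `^ H)).
  by apply: ge0_ler_powR; rewrite ?nnegrE ?(ltW H_gt0)// mulr_ge0// ltW.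
rewrite powRM ?(ltW m0)//; apply: ler_pM; rewrite ?powR_ge0//.
rewrite -[leRHS]powRr1//; apply: ler_powR; first by rewrite ler1n.
by case/andP: H01 => _ /ltW.
Qed.

Lemma energy_ge0 (be : R) (mu : probability R R) : (0 <= energy be mu)%E.
Proof.
by apply: integral_ge0 => u _; apply: integral_ge0 => v _; exact: riesz_kernel_ge0.
Qed.

Variables (K g : R) (E : set R) (F : set 'rV[R]_d).
Hypotheses (K_ge0 : 0 <= K) (g_gt0 : 0 < g) (g_le : g <= d%:R).
Hypotheses (cF : compact F) (mE : measurable E) (sE : E `<=` `[a, b]).
Hypothesis HF : hausdorff_measure (@euclidean_dist R d) g F <> 0%E.

(** The constant is fixed before the drift, the process, [mu] and [r]. The term [h] keeps the
    denominator positive even for [I = 0]. *)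
Lemma hit_within_energy_ge : exists2 c : R, 0 < c &
  forall (f : R -> 'rV[R]_d) (disp : measure_display) (T : measurableType disp)
    (P : probability T R) (B : 'I_d -> R -> {RV P >-> R}),
  (forall s, s \in `[a, b] -> euclidean_norm (f s) <= K) ->
  (forall s t, s \in `[a, b] -> t \in `[a, b] ->
     euclidean_norm (f t - f s) <= K * `|t - s| `^ H) ->
  is_fbm_vector H B -> forall (mu : probability R R) (I h r : R),
  mu E = 1%E -> energy (H * (d%:R - g)) mu = I%:E -> 0 < h -> 0 < r ->
  ((c / (I + h))%:E <= P (hit_within B f E F r))%E.
Proof.
have [MF [MF0 FM]] : exists MF : R, 0 <= MF /\ forall y, F y -> forall i, `|y ord0 i| <= MF.
  have [M [_ hM]] := compact_bounded cF.
  exists (`|M| + 1); split; first by rewrite addr_ge0.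
  move=> y Fy i; apply: le_trans (hM (`|M| + 1) _ y Fy).
    rewrite [leRHS]/Num.norm/= mx_normrE.
    by apply/bigmax_geP; right; exists (ord0, i).
  by rewrite (le_lt_trans (ler_norm _))// ltrDl.
pose M := MF + K.
have M0 : 0 <= M by rewrite addr_ge0.
have [C [c [C0 c0 hpair]]] := ball_eventI_le M0 K_ge0.
have [C1 C10 frost] := discrete_frostman g_gt0 FM HF.
have [C2 C20 hpot] := @gaussian_potential_le R d g c C1 g_gt0 c0 C10.
pose q0 := 2 * normal_peak 1 * expR (- ((M + 1) / a `^ H) ^+ 2 / 2).
have q00 : 0 < q0 by rewrite mulr_gt0 ?expR_gt0// mulr_gt0// normal_peak_gt0.
(* Compensates the factor 3 of [near_dist_le_scale], so that [ker] lies below the Riesz kernel at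
   all times close to its arguments. *)
pose ka := 3 `^ (- (d%:R - g)).
have ka0 : 0 < ka by rewrite powR_gt0.
exists (q0 ^+ d ^+ 2 / (C ^+ d * C2 / ka)).
  by rewrite divr_gt0 ?exprn_gt0// divr_gt0// mulr_gt0// exprn_gt0.
move=> f disp T P B fK fH fbmB mu I h r' muE enI h0 r'0.
(* [r < r'] turns the closed conditions of [ball_event] into the strict ones of [hit_within]. *)
pose r := Num.min (r' / 2) 1.
have r0 : 0 < r by rewrite lt_min ltr01 divr_gt0.
have r1 : r <= 1 by rewrite ge_min lexx orbT.
have rr' : r < r'.
  have : r <= r' / 2 by rewrite ge_min lexx.
  by move=> hr; apply: le_lt_trans hr _; rewrite ltr_pdivrMr// mulr_natr mulr2n ltrDl.
have I0 : 0 <= I by have := energy_ge0 (H * (d%:R - g)) mu; rewrite enI lee_fin.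
have [n nr] := exprn_half_le r0.
have [w [wF w1 wball]] := frost n.
pose e := r `^ H^-1.
have e0 : 0 < e by rewrite powR_gt0.
have E01 : E `<=` `[0, 1].
  move=> s /sE /=; rewrite !in_itv/= => /andP[sa sb].
  by rewrite (le_trans (ltW a_gt0) sa) (le_trans sb b_le1).
have [S [SE S1 Sen]] := energy_discrete (H * (d%:R - g)) mE E01 muE e0.
have Ea s : E s -> a <= s <= 1.
  by move=> /sE /=; rewrite !in_itv/= => /andP[-> sb]/=; exact: le_trans sb b_le1.
pose L s t := two_point_scale H s t r.
have L0 s t : 0 < L s t by exact: two_point_scale_gt0.
have rL s t : r <= L s t.
  rewrite -ler_sqr ?nnegrE ?(ltW r0) ?(ltW (L0 s t))// /L two_point_scaleE.
  by rewrite lerDr sqr_ge0.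
pose ctr (s : R) (x : 'rV[R]_d) i := x ord0 i - f s ord0 i.
pose s := [seq (p, q) | p <- S, q <- w].
pose A (i : (R * R) * (R * 'rV[R]_d)) := ball_event B (ctr i.1.2 i.2.2) i.1.2 r.
pose D := (C * r ^+ 2) ^+ d.
have D0 : 0 < D by rewrite exprn_gt0// mulr_gt0// exprn_gt0.
have g_le' : 0 <= d%:R - g by rewrite subr_ge0.
pose ker s t := ka * L s t `^ (- (d%:R - g)).
have ker_energy : \sum_(p <- S) \sum_(q <- S) p.1 * q.1 * ker p.2 q.2 <= I.
  rewrite -lee_fin -enI; apply: Sen => [x y|x y u v ux vy uv].
    by rewrite mulr_ge0 ?powR_ge0// ltW.
  have uv0 : 0 < `|u - v| by rewrite normr_gt0 subr_eq0.
  rewrite /ker /ka -powRM ?(ltW (L0 x y))// -mulrN powRrM !powRN.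
  rewrite lef_pV2 ?posrE ?powR_gt0 ?mulr_gt0//.
  apply: ge0_ler_powR; rewrite ?nnegrE ?powR_ge0//; first by rewrite mulr_ge0// ltW.
  exact: (@near_dist_le_scale e).
have memS i : i \in s -> [/\ 0 <= i.1.1, E i.1.2, 0 <= i.2.1 & F i.2.2].
  by move=> /allpairsP[[p q] [/= /SE[? ?] /wF[? ?] ->]].
have ctrM i : i \in s -> forall j, `|ctr i.1.2 i.2.2 j| <= M.
  move=> /memS[_ Ei _ Fi] j; apply: le_trans (ler_normB _ _) _.
  apply: lerD; first exact: FM.
  exact: le_trans (coord_le_euclidean_norm _ _) (fK _ (sE Ei)).
have pairP i j : i \in s -> j \in s ->
  fine (P (A i `&` A j)) <= D * (L i.1.2 j.1.2) ^- d * expR (- c *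
     \sum_k ((j.2.2 ord0 k - i.2.2 ord0 k) ^+ 2 / L i.1.2 j.1.2 ^+ 2)).
  move=> si sj; have [_ Ei _ Fi] := memS _ si; have [_ Ej _ Fj] := memS _ sj.
  rewrite -lee_fin fineK; last first.
    by rewrite fin_num_measure//; apply: measurableI; exact: measurable_ball_event.
  have -> : D * L i.1.2 j.1.2 ^- d = (C * r ^+ 2 / L i.1.2 j.1.2) ^+ d.
    by rewrite exprMn exprVn.
  apply: hpair => //; [exact: Ea|exact: Ea|exact: ctrM|].
  move=> k; rewrite /ctr.
  have -> : j.2.2 ord0 k - i.2.2 ord0 k - (j.2.2 ord0 k - f j.1.2 ord0 k -
     (i.2.2 ord0 k - f i.1.2 ord0 k)) = (f j.1.2 - f i.1.2) ord0 k by rewrite !mxE; ring.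
  exact: le_trans (coord_le_euclidean_norm _ _) (fH _ _ (sE Ei) (sE Ej)).
have main : ((((q0 * r) ^+ d) ^+ 2 / (D * C2 / ka * (I + h)))%:E <=
    P (hit_within B f E F r'))%E.
  apply: (@second_moment_lower _ _ _ P _ s (fun i => i.1.1 * i.2.1) A).
  - by move=> i; exact: measurable_ball_event.
  - apply: (measurable_hit_within _ a_gt0 b_le1 H_gt0 fH _ sE) => i; by have [] := fbmB.1 i.
  - move=> i si w0 Aw; have [_ Ei _ Fi] := memS _ si.
    exists i.1.2, i.2.2; split => // k; apply: le_lt_trans rr'.
    have := Aw k; rewrite /hit_path /ctr.
    by rewrite opprB addrA [X in _ <= X -> _]/=.
  - by rewrite mulr_gt0 ?divr_gt0 ?mulr_gt0// ltr_wpDl.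
  - have -> : (q0 * r) ^+ d = \sum_(i <- s) i.1.1 * i.2.1 * (q0 * r) ^+ d.
      rewrite -mulr_suml /s big_allpairs/=.
      under eq_bigr do rewrite -mulr_sumr w1 mulr1.
      by rewrite S1 mul1r.
    rewrite big_seq [leRHS]big_seq; apply: ler_sum => i si.
    have [i1 Ei i2 Fi] := memS _ si.
    apply: ler_wpM2l; first exact: mulr_ge0.
    rewrite -lee_fin fineK; last by rewrite fin_num_measure//; exact: measurable_ball_event.
    apply: ball_event_ge => //; [exact: Ea|exact: ltW|].
    by move=> k; apply: lerD => //; exact: ctrM.
  - by rewrite exprn_ge0// mulr_ge0// ltW.
  have wle i (t : R) : i \in s -> \sum_(q <- w) q.1 * expR (- c *
     \sum_k ((q.2 ord0 k - i.2.2 ord0 k) ^+ 2 / L i.1.2 t ^+ 2)) <= C2 * L i.1.2 t `^ g.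
    move=> si; apply: (hpot n w) => //; first by move=> p /wF[].
    exact: le_trans nr (rL _ _).
  (* The prefactor [L^(-d)] of the pair probability and the potential bound [L^g] combine into the
     kernel of order [d - g]. *)
  have LE (u t : R) : D * L u t ^- d * (C2 * L u t `^ g) = D * C2 / ka * ker u t.
    have powL : L u t `^ (- (d%:R - g)) = L u t `^ g / L u t ^+ d.
      rewrite opprB powRB; last by rewrite (gt_eqF (L0 u t)) implybT.
      by rewrite powR_mulrn ?(ltW (L0 _ _)).
    have Ld : L u t ^+ d != 0 by rewrite expf_neq0 ?gt_eqF.
    rewrite /ker powL; field; by rewrite Ld gt_eqF.
  apply: (@le_trans _ _ (\sum_(i <- s) \sum_(p <- S) i.1.1 * i.2.1 * (p.1 * (D * C2 / ka * ker i.1.2 p.2)))).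
    rewrite big_seq [leRHS]big_seq; apply: ler_sum => i si.
    have [i1 Ei i2 Fi] := memS _ si.
    rewrite {1}/s big_allpairs big_seq [leRHS]big_seq; apply: ler_sum => p pS.
    have [p1 Ep] := SE _ pS.
    rewrite -LE.
    apply: (@le_trans _ _ (\sum_(q <- w) i.1.1 * i.2.1 * p.1 * (D * L i.1.2 p.2 ^- d) *
       (q.1 * expR (- c * \sum_k ((q.2 ord0 k - i.2.2 ord0 k) ^+ 2 / L i.1.2 p.2 ^+ 2))))).
      rewrite big_seq [leRHS]big_seq; apply: ler_sum => q qw.
      have [q1 Fq] := wF _ qw.
      have pq : (p, q) \in s by apply/allpairsP; exists (p, q).
      have := pairP _ _ si pq; rewrite /= => hp.
      set X := expR _ in hp *.
      have -> : i.1.1 * i.2.1 * p.1 * (D * L i.1.2 p.2 ^- d) * (q.1 * X) =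
         i.1.1 * i.2.1 * (p.1 * q.1) * (D * L i.1.2 p.2 ^- d * X) by ring.
      by apply: ler_wpM2l hp; apply: mulr_ge0; apply: mulr_ge0.
    rewrite -mulr_sumr [leRHS]mulrA [leRHS]mulrA.
    apply: ler_wpM2l; last exact: wle.
    apply: mulr_ge0; first by apply: mulr_ge0 => //; apply: mulr_ge0.
    by apply: divr_ge0; [exact: ltW|rewrite exprn_ge0 ?ltW].
  rewrite /s big_allpairs/=.
  have -> : \sum_(p <- S) \sum_(q <- w) \sum_(p' <- S)
      p.1 * q.1 * (p'.1 * (D * C2 / ka * ker p.2 p'.2)) =
      D * C2 / ka * \sum_(p <- S) \sum_(q <- S) p.1 * q.1 * ker p.2 q.2.
    rewrite mulr_sumr; apply: eq_bigr => p _.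
    pose Y := \sum_(p' <- S) D * C2 / ka * (p.1 * p'.1 * ker p.2 p'.2).
    transitivity (\sum_(q <- w) q.1 * Y).
      apply: eq_bigr => q _; rewrite mulr_sumr; apply: eq_bigr => p' _; ring.
    by rewrite -mulr_suml w1 mul1r /Y mulr_sumr.
  apply: ler_wpM2l; first by rewrite divr_ge0 ?mulr_ge0// ltW.
  by apply: le_trans ker_energy _; rewrite lerDl ltW.
(* Numerator and denominator both carry [r^(2d)]; after cancellation the bound no longer depends on
   [r]. *)
apply: le_trans main; rewrite lee_fin le_eqVlt; apply/orP; left; apply/eqP.
have -> : D = C ^+ d * (r ^+ 2) ^+ d by rewrite /D exprMn.
rewrite [(q0 * r) ^+ d]exprMn.
have rd : (r ^+ 2) ^+ d = r ^+ d ^+ 2 by rewrite -!exprM mulnC.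
rewrite rd.
have Ih : I + h != 0 by rewrite gt_eqF// ltr_wpDl.
field.
by rewrite Ih !expf_neq0 ?gt_eqF.
Qed.

End lower_bound.

Section holder_bounds.
Context {R : realType} {d : nat}.

Lemma euclidean_norm_ge0 (x : 'rV[R]_d) : 0 <= euclidean_norm x.
Proof. exact: sqrtr_ge0. Qed.

Lemma euclidean_norm0 : euclidean_norm (0 : 'rV[R]_d) = 0.
Proof. by rewrite /euclidean_norm big1 ?sqrtr0// => i _; rewrite mxE expr0n. Qed.

(** Since [a < b], both suprema run over non-empty sets and are nonnegative, so each is at most
    their sum. *)
Lemma holder_norm_bounds (a b H K : R) (f : R -> 'rV[R]_d) : a < b ->
  holder_norm a b H f = K%:E ->
  [/\ 0 <= K, forall s, s \in `[a, b] -> euclidean_norm (f s) <= K &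
      forall s t, s \in `[a, b] -> t \in `[a, b] ->
        euclidean_norm (f t - f s) <= K * `|t - s| `^ H].
Proof.
move=> ab; rewrite /holder_norm.
set S := ereal_sup _; set D := ereal_sup _ => SDK.
have ia : a \in `[a, b] by rewrite in_itv/= lexx ltW.
have ib : b \in `[a, b] by rewrite in_itv/= lexx ltW.
have S0 : (0 <= S)%E.
  apply: le_trans (ereal_sup_ubound _); last by exists a; first exact: ia.
  by rewrite lee_fin euclidean_norm_ge0.
have D0 : (0 <= D)%E.
  apply: le_trans (ereal_sup_ubound _); last first.
    by exists a, b; split => //; rewrite lt_eqF.
  by rewrite lee_fin divr_ge0 ?euclidean_norm_ge0 ?powR_ge0.
have SK : (S <= K%:E)%E by rewrite -SDK leeDl.
have DK : (D <= K%:E)%E by rewrite -SDK leeDr.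
have K0 : 0 <= K by rewrite -lee_fin (le_trans S0 SK).
split => // [s si|s t si ti].
  rewrite -lee_fin; apply: le_trans SK; apply: ereal_sup_ubound; by exists s.
have [<-|st] := eqVneq s t.
  by rewrite subrr euclidean_norm0 mulr_ge0 ?powR_ge0.
rewrite -ler_pdivrMr; last by apply: powR_gt0; rewrite normr_gt0 subr_eq0 eq_sym.
by rewrite -lee_fin; apply: le_trans DK; apply: ereal_sup_ubound; exists s, t.
Qed.

End holder_bounds.

Section capacity_bound.
Context {R : realType} {d : nat}.

(** Letting [h] tend to 0 gives [c <= q I] for every finite energy [I]. This keeps the infimum away
    from 0, so its inverse is finite; an infinite infimum gives capacity 0. *)
Lemma capacity_le (be c q : R) (E : set R) : 0 < c ->
  (forall (mu : probability R R) (I h : R), mu E = 1%E -> energy be mu = I%:E ->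
     0 < h -> c / (I + h) <= q) ->
  0 <= q -> (c%:E * capacity be E <= q%:E)%E.
Proof.
move=> c0 hq q0; rewrite /capacity; set S := [set energy be mu | mu in _].
have S0 x : S x -> (0 <= x)%E by move=> [mu _ <-]; exact: energy_ge0.
have m0 : (0 <= ereal_inf S)%E by apply: le_ereal_inf_tmp => x /S0.
have key (mu : probability R R) (I : R) : mu E = 1%E -> energy be mu = I%:E -> c <= q * I.
  move=> muE en.
  have I0 : 0 <= I by rewrite -lee_fin -en energy_ge0.
  have qI h : 0 < h -> c <= q * I + q * h.
    move=> h0; rewrite -mulrDr -ler_pdivrMr; first exact: (hq mu).
    by rewrite ltr_wpDl.
  apply/ler_addgt0Pr => e e0.
  have q1 : 0 < q + 1 by rewrite ltr_wpDl.
  apply: le_trans (qI (e / (q + 1)) _) _; first by rewrite divr_gt0.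
  rewrite lerD2l mulrA ler_pdivrMr// mulrDr mulr1 mulrC lerDl; exact: ltW.
case mE : (ereal_inf S) m0 => [m| |]//= m0; last by rewrite invey mule0 lee_fin.
have [mu [muE [I en]]] : exists mu : probability R R, mu E = 1%E /\ exists I, energy be mu = I%:E.
  have /ereal_inf_lt[x [mu muE muen] xlt] : (ereal_inf S < (m + 1)%:E)%E.
    by rewrite mE lte_fin ltrDl.
  exists mu; split => //; exists (fine x); rewrite fineK//.
  rewrite ge0_fin_numE; last by rewrite -muen energy_ge0.
  exact: lt_trans xlt (ltry _).
have cI := key _ _ muE en.
have q_gt0 : 0 < q.
  rewrite lt_neqAle q0 andbT eq_sym; apply/eqP => q0'.
  by move: cI; rewrite q0' mul0r leNgt c0.
have cm : c / q <= m.
  rewrite -lee_fin -mE; apply: le_ereal_inf_tmp => x [nu nuE <-].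
  case en' : (energy be nu) (energy_ge0 be nu) => [J| |]//= _; last by rewrite leey.
  by rewrite lee_fin ler_pdivrMr// mulrC; exact: (key nu).
have m_gt0 : 0 < m by apply: lt_le_trans cm; rewrite divr_gt0.
rewrite inver gt_eqF// -EFinM lee_fin ler_pdivrMr//.
by rewrite ler_pdivrMr// mulrC in cm.
Qed.

End capacity_bound.

(** * Hausdorff measure upper bound *)

Section null_hausdorff_measure.
Context {R : realType} {T : Type}.
Variables (dist : T -> T -> R).

Lemma hausdorff_content_le_measure (be dl : R) (G : set T) : 0 < dl ->
  (hausdorff_content dist be G dl <= hausdorff_measure dist be G)%E.
Proof.
move=> dl0.
have cv := @nonincreasing_at_right_cvge R (hausdorff_content dist be G) 0 (BRight dl).
rewrite /hausdorff_measure (cvg_lim _ (cv _ _))//.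
- by apply: ereal_sup_ubound; exists dl => //=; rewrite in_itv/= dl0 lexx.
- move=> r s _ _ rs; apply: le_ereal_inf => _ [x [rad [h1 h2 ->]]].
  exists x, rad; split => // n; have /andP[-> h] := h2 n; exact: le_trans h rs.
Qed.

Lemma hausdorff_measure0_cover (be eta dl : R) (G : set T) :
  hausdorff_measure dist be G = 0%E -> 0 < eta -> 0 < dl ->
  exists (x : nat -> T) (r : nat -> R),
    [/\ G `<=` \bigcup_n metric_ball dist (x n) (r n), forall n, 0 <= r n <= dl &
        (\sum_(0 <= n <oo) ((2 * r n) `^ be)%:E < eta%:E)%E].
Proof.
move=> G0 eta0 dl0.
have /ereal_inf_lt[_ [x [r [h1 h2 ->]]] h3] : (hausdorff_content dist be G dl < eta%:E)%E.
  by apply: le_lt_trans (hausdorff_content_le_measure _ _ dl0) _; rewrite G0 lte_fin.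
by exists x, r.
Qed.

End null_hausdorff_measure.

Section minkowski.
Context {R : realType} {T : Type}.
Variables (dist : T -> T -> R).

(** The strict inequality leaves room for an exponent [g' < g]. The factor 2 makes the bound
    strictly larger than the infimum, so an actual cover satisfies it. *)
Lemma upper_minkowski_dim_lt (g : R) (G : set T) :
  (upper_minkowski_dim dist G < g%:E)%E ->
  exists g' r0 : R, [/\ g' < g, 0 < r0 & forall r, 0 < r -> r < r0 ->
    exists n (x : 'I_n -> T), G `<=` \bigcup_i metric_ball dist (x i) r /\
      n%:R <= 2 * r `^ (- g')].
Proof.
move=> /ereal_inf_lt[_ [V nV <-] hV].
have [g' g'g hg'] : exists2 g' : R, g' < g & (ereal_sup ((fun r : R =>
    lne (covering_number dist G r) * ((ln r^-1)^-1)%:E)%E @` V) <= g'%:E)%E.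
  case: (ereal_sup _) hV => [y| |]//=.
    by rewrite lte_fin => yg; exists y.
  by move=> _; exists (g - 1); [rewrite ltrBlDr ltrDl|exact: leNye].
have [r1 /= r10 hr1] : \forall e \near 0^'+, V e by exact: nV.
exists g', (Num.min r1 1); split => //; first by rewrite lt_min r10 ltr01.
move=> r r0; rewrite lt_min => /andP[rr1 r1'].
have Vr : V r by apply: hr1 => //=; rewrite sub0r normrN gtr0_norm.
have lnr : 0 < ln r^-1 by rewrite ln_gt0// invf_gt1.
have h1 : (lne (covering_number dist G r) * ((ln r^-1)^-1)%:E <= g'%:E)%E.
  by apply: le_trans hg'; apply: ereal_sup_ubound; exists r.
have rE : r `^ (- g') = expR (g' * ln r^-1).
  by rewrite /powR gt_eqF// lnV// mulNr mulrN.
have N_le : (covering_number dist G r <= (r `^ (- g'))%:E)%E.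
  rewrite rE; case: (covering_number _ _ _) h1 => [y| |]//=; last by rewrite leNye.
    have [y0|y0] := leP y 0; first by rewrite lee_fin => _; exact: le_trans y0 (expR_ge0 _).
    by rewrite !lee_fin ler_pdivrMr// => h; rewrite -[y]lnK ?posrE// ler_expR.
  by rewrite mulyr gtr0_sg ?invr_gt0// mul1e.
have /ereal_inf_lt[_ [n [x Gx] <-] nlt] : (covering_number dist G r < (2 * r `^ (- g'))%:E)%E.
  apply: le_lt_trans N_le _; rewrite lte_fin mulr_natl mulr2n ltrDl; exact: powR_gt0.
by exists n, x; split => //; apply: ltW; rewrite -lte_fin.
Qed.

End minkowski.

(** * Dyadic chaining and the modulus of continuity *)

Section dyadic_chaining.
Context {R : realType}.
Implicit Types (s q : R) (X : R -> R).

Definition dyadic_index (n : nat) s : nat := Num.truncn (2 ^+ n * s).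
Definition dyadic_point (n k : nat) : R := k%:R * 2^-1 ^+ n.

Lemma dyadic_index_itv n s : 0 <= s ->
  dyadic_point n (dyadic_index n s) <= s < dyadic_point n (dyadic_index n s) + 2^-1 ^+ n.
Proof.
move=> s0; have p0 : 0 < 2 ^+ n :> R by rewrite exprn_gt0.
have := @truncn_itv _ (2 ^+ n * s); rewrite mulr_ge0 ?(ltW p0)// => /(_ isT).
rewrite -/(dyadic_index n s) /dyadic_point exprVn ler_pdivrMr// -ltrBlDr ltr_pdivlMr//.
by rewrite (mulrC s) -natr1 => /andP[-> h]/=; rewrite mulrBl mulVf ?gt_eqF// mulrC; lra.
Qed.

Lemma dyadic_indexS n s : 0 <= s ->
  dyadic_index n.+1 s = (2 * dyadic_index n s)%N \/
  dyadic_index n.+1 s = (2 * dyadic_index n s).+1.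
Proof.
move=> s0.
have i n' : (dyadic_index n' s)%:R <= 2 ^+ n' * s < (dyadic_index n' s).+1%:R.
  by apply: truncn_itv; rewrite mulr_ge0// exprn_ge0.
have /andP[h1 h2] := i n; have /andP[] := i n.+1; rewrite exprS -mulrA => h3 h4.
have e1 : (dyadic_index n.+1 s < (2 * dyadic_index n s).+2)%N.
  rewrite -(ltr_nat R); apply: le_lt_trans h3 _.
  have -> : (2 * dyadic_index n s).+2%:R = 2 * (dyadic_index n s).+1%:R :> R.
    by rewrite -natrM mulnS.
  by rewrite ltr_pM2l.
have e2 : (2 * dyadic_index n s < (dyadic_index n.+1 s).+1)%N.
  by rewrite -(ltr_nat R); apply: le_lt_trans h4; rewrite natrM ler_pM2l.
lia.
Qed.

Lemma dyadic_index_le n s : 0 <= s <= 1 -> (dyadic_index n s <= 2 ^ n)%N.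
Proof.
move=> /andP[s0 s1]; have p0 : 0 <= 2 ^+ n :> R by rewrite exprn_ge0.
rewrite -(ler_nat R) natrX; apply: (@le_trans _ _ (2 ^+ n * s)).
  by rewrite truncn_le mulr_ge0.
by rewrite -[leRHS]mulr1 ler_wpM2l.
Qed.

Lemma dyadic_point_in01 n k : (k <= 2 ^ n)%N -> dyadic_point n k \in `[0, 1].
Proof.
move=> kn; rewrite in_itv/= /dyadic_point mulr_ge0 ?exprn_ge0//=.
by rewrite exprVn ler_pdivrMr ?exprn_gt0// mul1r -natrX ler_nat.
Qed.

Definition small_increments X q (N : nat) : Prop := forall n k, (N <= n)%N ->
  (k < 2 ^ n)%N -> `|X (dyadic_point n k.+1) - X (dyadic_point n k)| <= q ^+ n.

(** From one generation to the next the dyadic point below [s] stays or moves to its right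
    neighbour, at cost [q^(m+1)]. Summing the geometric series from [n] on gives the bound, and
    continuity passes from dyadic points to [s]. *)
Lemma dyadic_chain X q N n s : 0 < q < 1 -> {within `[0, 1], continuous X} ->
  small_increments X q N -> s \in `[0, 1] -> (N <= n)%N ->
  `|X s - X (dyadic_point n (dyadic_index n s))| <= q / (1 - q) * q ^+ n.
Proof.
move=> /andP[q0 q1] cX sX s01 Nn.
have /andP[s0 s1] : 0 <= s <= 1 by move: s01; rewrite in_itv.
pose p m := dyadic_point m (dyadic_index m s).
have q1' : 0 < 1 - q by rewrite subr_gt0.
have c0 : 0 <= q / (1 - q) * q ^+ n by rewrite mulr_ge0 ?exprn_ge0 ?divr_ge0 ?(ltW q0)// ltW.
have step m : (N <= m)%N -> `|X (p m.+1) - X (p m)| <= q ^+ m.+1.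
  move=> Nm; rewrite /p.
  have -> : dyadic_point m (dyadic_index m s) = dyadic_point m.+1 (2 * dyadic_index m s).
    by rewrite /dyadic_point exprS natrM; field.
  have := @dyadic_index_le m.+1 s; rewrite s0 s1 => /(_ isT).
  have [E1|E1] := dyadic_indexS m s0; rewrite E1.
    by move=> _; rewrite subrr normr0 exprn_ge0// ltW.
  by apply: sX; exact: leqW.
have chain m : `|X (p (n + m)%N) - X (p n)| <= q / (1 - q) * q ^+ n * (1 - q ^+ m).
  elim: m => [|m IH]; first by rewrite addn0 !subrr normr0 mulr0.
  have h1 : (N <= n + m)%N by exact: leq_trans Nn (leq_addr _ _).
  have -> : X (p (n + m.+1)%N) - X (p n) = (X (p (n + m).+1) - X (p (n + m)%N)) +
      (X (p (n + m)%N) - X (p n)) by rewrite addnS; ring.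
  apply: le_trans (ler_normD _ _) _.
  apply: (@le_trans _ _ (q ^+ (n + m).+1 + q / (1 - q) * q ^+ n * (1 - q ^+ m))).
    by apply: lerD => //; exact: step.
  rewrite le_eqVlt; apply/orP; left; apply/eqP.
  rewrite exprS exprD [q ^+ m.+1]exprS; field; by rewrite gt_eqF.
suff small (e : R) : 0 < e -> `|X s - X (p n)| <= q / (1 - q) * q ^+ n + e.
  by apply/ler_addgt0Pr => e e0; exact: small.
move=> e0.
have := (subspace_continuousP _ _).1 cX s s01.
move/cvgrPdist_lt => /(_ _ e0) /= near_s.
have [dl /= dl0 hdl] := (nbhs_ballP _ _).1 near_s.
have [m mdl] := exprn_half_le dl0.
have nm : 2^-1 ^+ (n + m) <= dl by apply: le_trans mdl; apply: ler_exprn_half; exact: leq_addl.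
have /andP[i1 i2] := dyadic_index_itv (n + m) s0.
have h1 : `|X s - X (p (n + m)%N)| < e.
  apply: hdl; last by apply: dyadic_point_in01; apply: dyadic_index_le; rewrite s0.
  rewrite /ball/= ger0_norm ?subr_ge0//; apply: lt_le_trans nm.
  by rewrite ltrBlDl.
have h2 := chain m.
have h3 : q / (1 - q) * q ^+ n * (1 - q ^+ m) <= q / (1 - q) * q ^+ n.
  by rewrite -[leRHS]mulr1 ler_wpM2l// gerBl exprn_ge0// ltW.
have -> : X s - X (p n) = (X s - X (p (n + m)%N)) + (X (p (n + m)%N) - X (p n)) by ring.
apply: le_trans (ler_normD _ _) _; rewrite addrC; apply: lerD; last exact: ltW.
exact: le_trans h2 h3.
Qed.

End dyadic_chaining.

Section fbm_increments.
Context {R : realType} {disp : measure_display} {T : measurableType disp}.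
Variables (P : probability T R) (H : R) (X : R -> {RV P >-> R}).
Hypotheses (H01 : 0 < H < 1) (fbmX : is_fbm H X).

Lemma fbm_increment_law (s t : R) A : s \in `[0, 1] -> t \in `[0, 1] -> measurable A ->
  P ((fun w => X t w - X s w) @^-1` A) = gaussian_law 0 (`|t - s| `^ H) A.
Proof.
move=> s01 t01 mA; have [H0 _] := andP H01.
have [_ /(_ A mA)] := fbm_comb_law fbmX (-1) 1 s01 t01.
rewrite (_ : (fun w => -1 * X s w + 1 * X t w) = (fun w => X t w - X s w)); last first.
  by apply/funext => w; rewrite mulN1r mul1r addrC.
move=> ->; congr gaussian_law.
have -> : fbm_var2 H s t (-1) 1 = (`|t - s| `^ H) ^+ 2.
  have H2 : 2 * H != 0 by rewrite mulf_neq0 ?gt_eqF.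
  rewrite -powR_mulrn ?powR_ge0// -powRrM mulrC /fbm_var2 /fbm_cov !subrr !normr0 powR0//.
  by field.
by rewrite sqrtr_sqr ger0_norm ?powR_ge0.
Qed.

Lemma measurable_increment_gt (s t x : R) : measurable [set w | x < `|X t w - X s w|].
Proof.
have mn : measurable_fun setT (fun w => `|X t w - X s w|).
  by apply: measurableT_comp => //; apply: measurable_funB.
rewrite (_ : [set _ | _] = (fun w => `|X t w - X s w|) @^-1` `]x, +oo[%classic).
  by rewrite -[X in measurable X]setTI; exact: mn.
by apply/seteqP; split => w /=; rewrite in_itv/= andbT.
Qed.

Lemma fbm_increment_tail (s t x : R) : s \in `[0, 1] -> t \in `[0, 1] -> s != t -> 0 <= x ->
  (P [set w | (x < `|X t w - X s w|)%R] <=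
   (2 * expR (- (x / `|t - s| `^ H) ^+ 2 / 4))%:E)%E.
Proof.
move=> s01 t01 st x0.
apply: (@gaussian_tail_le _ _ _ P (fun w => X t w - X s w)) => //.
  by apply: powR_gt0; rewrite normr_gt0 subr_eq0 eq_sym.
by move=> A mA; rewrite fbm_increment_law.
Qed.

Lemma measurable_small_increments (q : R) (N : nat) :
  measurable [set w | small_increments (fun t => X t w) q N].
Proof.
rewrite (_ : [set _ | _] = \bigcap_n \bigcap_k (if ((N <= n) && (k < 2 ^ n))%N then
   ~` [set w | q ^+ n < `|X (dyadic_point n k.+1) w - X (dyadic_point n k) w|] else setT)).
  apply: bigcapT_measurable => n; apply: bigcapT_measurable => k.
  case: ifP => // _; apply: measurableC; exact: measurable_increment_gt.
apply/seteqP; split => w h.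
  move=> n _ k _; case: ifP => // /andP[Nn kn] /=; rewrite ltNge h//.
move=> n k Nn kn; have := h n I k I; rewrite Nn kn/= => /negP; by rewrite -leNgt.
Qed.

End fbm_increments.

(** The threshold [2^(-nh)] is [y = 2^(n(H-h))] deviations of the increment. A union bound over the
    [2^n] increments of generation [n], each of probability [O(4^-n)], leaves the summable
    [2^-n]. *)
Lemma small_increments_prob {R : realType} (H h : R) : 0 < h -> h < H -> H < 1 ->
  exists2 c : R, 0 < c & forall (disp : measure_display) (T : measurableType disp)
    (P : probability T R) (X : R -> {RV P >-> R}), is_fbm H X -> forall N : nat,
  (P (~` [set w | small_increments (fun t => X t w) (2^-1 `^ h) N]) <=
     (c * 2^-1 ^+ N)%:E)%E.
Proof.
move=> h0 hH H1.
have H0 : 0 < H by exact: lt_trans hH.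
have H01 : 0 < H < 1 by rewrite H0.
set q : R := 2^-1 `^ h.
have q0 : 0 < q by exact: powR_gt0.
(* Then [y^(2m) >= 4^n], which is the decay needed from [exp(-y^2/4) <= (4m/y^2)^m]. *)
have [m m0 mH] : exists2 m : nat, (0 < m)%N & 1 <= (H - h) * m%:R.
  have Hh : 0 < H - h by rewrite subr_gt0.
  have [m hm] : exists m : nat, (H - h)^-1 < m%:R.
    by exists (Num.bound (H - h)^-1); apply: archi_boundP; rewrite invr_ge0 ltW.
  exists m.
    by rewrite -(ltr_nat R); apply: lt_trans hm; rewrite invr_gt0.
  by rewrite mulrC -ler_pdivrMr// mul1r ltW.
pose c0 : R := 2 * (4 * m%:R) ^+ m.
have c00 : 0 < c0 by rewrite mulr_gt0// exprn_gt0// mulr_gt0// ltr0n.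
exists (2 * c0); first by rewrite mulr_gt0.
move=> disp T P X fbmX N.
pose bad n k := [set w | q ^+ n < `|X (dyadic_point n k.+1) w - X (dyadic_point n k) w|].
have mbad n k : measurable (bad n k) by exact: measurable_increment_gt.
have Pbad n k : (k < 2 ^ n)%N -> (P (bad n k) <= (c0 * 4^-1 ^+ n)%:E)%E.
  move=> kn.
  have dk : dyadic_point n k.+1 - dyadic_point n k = 2^-1 ^+ n :> R.
    by rewrite /dyadic_point -natr1; ring.
  have p0 : 0 < 2^-1 ^+ n :> R by rewrite exprn_gt0.
  apply: le_trans (fbm_increment_tail H01 fbmX _ _ _ _) _.
  - by apply: dyadic_point_in01; exact: ltnW.
  - exact: dyadic_point_in01.
  - by rewrite -subr_eq0 -opprB dk oppr_eq0 gt_eqF.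
  - by rewrite exprn_ge0// ltW.
  rewrite dk (gtr0_norm p0) lee_fin -mulrA; apply: ler_wpM2l => //.
  have -> : q ^+ n / (2^-1 ^+ n) `^ H = (2 ^+ n) `^ (H - h).
    have e1 (z : R) : (2 ^+ n) `^ z = (2^-1 ^+ n) `^ (- z).
      by rewrite exprVn -powR_inv1 ?exprn_ge0// -powRrM mulN1r opprK.
    have e2 : q ^+ n = (2^-1 ^+ n) `^ h.
      have half0 : 0 <= 2^-1 :> R by rewrite invr_ge0.
      by rewrite -(powR_mulrn n (ltW q0)) -(powR_mulrn n half0) -!powRrM mulrC.
    by rewrite e1 opprB powRB ?(gt_eqF p0) ?implybT// e2.
  set y := (2 ^+ n) `^ (H - h).
  have y0 : 0 < y by rewrite powR_gt0// exprn_gt0.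
  rewrite mulNr; apply: le_trans (expRN_le m0 _) _; first by rewrite divr_gt0// exprn_gt0.
  have -> : m%:R / (y ^+ 2 / 4) = 4 * m%:R * (y ^+ 2)^-1 by field; rewrite gt_eqF.
  rewrite exprMn; apply: ler_wpM2l; first by rewrite exprn_ge0// mulr_ge0.
  rewrite !exprVn lef_pV2 ?posrE ?exprn_gt0//.
  have -> : 4 = 2 ^+ 2 :> R by rewrite -natrX.
  rewrite [leLHS]exprAC [leRHS]exprAC; apply: lerXn2r; rewrite ?nnegrE ?exprn_ge0 ?(ltW y0)//.
  rewrite -(powR_mulrn m (ltW y0)) -powRrM -[leLHS]powRr1 ?exprn_ge0//.
  by apply: ler_powR => //; rewrite exprn_ege1// ler1n.
pose badn j := \big[setU/set0]_(k < 2 ^ (N + j)) bad (N + j)%N k.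
have mbadn j : measurable (badn j) by exact: bigsetU_measurable.
have Pbadn j : (P (badn j) <= (c0 * 2^-1 ^+ N * 2^-1 ^+ j)%:E)%E.
  have h1 := @le_mu_bigsetU _ _ _ P (bad (N + j)%N) (2 ^ (N + j)) (fun i _ => mbad (N + j)%N i).
  apply: le_trans h1 _.
  apply: (@le_trans _ _ (\sum_(k < 2 ^ (N + j)) (c0 * 4^-1 ^+ (N + j))%:E)%E).
    by apply: lee_sum => k _; exact: Pbad.
  rewrite sumEFin sumr_const card_ord lee_fin -[leLHS]mulr_natl natrX -mulrA -exprD mulrCA.
  rewrite ler_pM2l// -exprMn_comm; last exact: mulrC.
  by have -> : 2 * 4^-1 = 2^-1 :> R by field.
have sub : ~` [set w | small_increments (fun t => X t w) q N] `<=` \bigcup_j badn j.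
  move=> w /= nw; apply: contrapT => nb; apply: nw => n k Nn kn.
  rewrite leNgt; apply/negP => hw; apply: nb; exists (n - N)%N => //.
  rewrite /badn subnKC// -(bigcup_mkord (2 ^ n) (bad n)); exists k => //.
have mS : measurable (~` [set w | small_increments (fun t => X t w) q N]).
  by apply: measurableC; exact: measurable_small_increments.
apply: le_trans (@measure_sigma_subadditive _ _ _ P _ _ mbadn mS sub) _.
apply: lime_le; first exact: is_cvg_nneseries.
apply: nearW => n; rewrite big_mkord.
apply: (@le_trans _ _ (\sum_(j < n) (c0 * 2^-1 ^+ N * 2^-1 ^+ j)%:E)%E).
  by apply: lee_sum => j _; exact: Pbadn.
rewrite sumEFin lee_fin -mulr_sumr mulrC -mulrA ler_wpM2r// ?sum_exprn_half_le//.
by rewrite mulr_ge0 ?exprn_ge0// ltW.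
Qed.

Lemma measure_exists_le {R : realType} {disp : measure_display} {T : measurableType disp}
    (P : probability T R) (I : eqType) (s : seq I) (A : I -> set T) (c : R) :
  (forall i, measurable (A i)) -> (forall i, (P (A i) <= c%:E)%E) ->
  measurable [set w | exists2 i, i \in s & A i w] /\
  (P [set w | exists2 i, i \in s & A i w] <= ((size s)%:R * c)%:E)%E.
Proof.
move=> mA PA; elim: s => [|i s [mS PS]].
  rewrite (_ : [set _ | _] = set0); last by apply/seteqP; split => // w [].
  by rewrite measure0 mul0r.
rewrite (_ : [set _ | _] = A i `|` [set w | exists2 i, i \in s & A i w]).
  split; first exact: measurableU.
  apply: (le_trans (measureU2 _ _ _)) => //=.
  by rewrite -natr1 mulrDl mul1r addrC EFinD; exact: leeD.
apply/seteqP; split => w.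
  by move=> [j]; rewrite in_cons => /orP[/eqP->|js] Aj; [left|right; exists j].
by move=> [Ai|[j js Aj]]; [exists i; rewrite ?mem_head|exists j; rewrite // in_cons js orbT].
Qed.

(** * Hitting probabilities of short time intervals *)

Section upper_bound.
Context {R : realType} {d : nat}.
Variables (a b H K : R) (E : set R) (F : set 'rV[R]_d).
Hypotheses (a_gt0 : 0 < a) (b_le1 : b <= 1) (H01 : 0 < H < 1) (K_ge0 : 0 <= K).
Hypotheses (sE : E `<=` `[a, b]).

Let H_gt0 : 0 < H. Proof. by case/andP: H01. Qed.

Let E01 s : E s -> a <= s <= 1.
Proof. by move=> /sE /=; rewrite in_itv/= => /andP[-> sb] /=; exact: le_trans sb b_le1. Qed.

Variables (disp : measure_display) (T : measurableType disp) (P : probability T R).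
Variables (B : 'I_d -> R -> {RV P >-> R}) (f : R -> 'rV[R]_d).
Hypotheses (fbmB : is_fbm_vector H B).
Hypothesis fH : forall s t, s \in `[a, b] -> t \in `[a, b] ->
  euclidean_norm (f t - f s) <= K * `|t - s| `^ H.

Definition modulus_event (q : R) (N : nat) : set T :=
  [set w | forall i, small_increments (fun t => B i t w) q N].

Definition hit_from (J : set R) : set T :=
  [set w | exists s, [/\ E s, J s & F (sample_path B w s + f s)]].

(** A hit in the cell forces [B] at its left endpoint to be close to one of [m] shifted net points.
    The three terms of the constant are the chaining error, the net radius and the drift. The
    measurable [V] avoids any claim on the measurability of [hit_from]. *)
Lemma hit_from_cell (h : R) (N n m : nat) (y : 'I_m -> 'rV[R]_d) (k : nat) :
  0 < h -> h <= H -> (N <= n)%N -> 2^-1 ^+ n <= a / 2 ->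
  F `<=` \bigcup_i metric_ball (@euclidean_dist R d) (y i) ((2^-1 ^+ n) `^ h) ->
  exists2 V : set T, measurable V &
    modulus_event (2^-1 `^ h) N `&` hit_from [set s | dyadic_index n s = k] `<=` V /\
    (P V <= (m%:R * ((2^-1 `^ h / (1 - 2^-1 `^ h) + 1 + K) * (2^-1 ^+ n) `^ h
               / (a / 2) `^ H) ^+ d)%:E)%E.
Proof.
move=> h0 hH Nn na Fy; set q := 2^-1 `^ h; set p := (2^-1 ^+ n) `^ h.
have pE : q ^+ n = p.
  have half0 : 0 <= 2^-1 :> R by rewrite invr_ge0.
  by rewrite -(powR_mulrn n (powR_ge0 _ h)) /p -(powR_mulrn n half0) -!powRrM mulrC.
have q0 : 0 < q by exact: powR_gt0.
have half1 : 2^-1 < 1 :> R by lra.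
have q1 : q < 1.
  have -> : 1 = 1 `^ h :> R by rewrite powR1.
  by apply: gt0_ltr_powR half1 => //; rewrite nnegrE ?invr_ge0.
have t0 : 0 < 2^-1 ^+ n :> R by rewrite exprn_gt0.
have t1 : 2^-1 ^+ n <= 1 :> R by rewrite exprn_ile1// ltW.
have p0 : 0 < p by exact: powR_gt0.
set C3 := q / (1 - q) + 1 + K.
have C30 : 0 < C3.
  by rewrite ltr_wpDr// addr_gt0// divr_gt0// subr_gt0.
have tHp : (2^-1 ^+ n) `^ H <= p.
  have -> : H = h + (H - h) by ring.
  rewrite powRD; last by rewrite (gt_eqF t0) implybT.
  rewrite -[leRHS]mulr1 -/p ler_wpM2l ?(ltW p0)//.
  have one : 1 `^ (H - h) = 1 :> R by rewrite powR1.
  rewrite -[leRHS]one.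
  by apply: ge0_ler_powR; rewrite ?nnegrE ?subr_ge0// ltW.
have bnd0 : 0 <= C3 * p / (a / 2) `^ H.
  by rewrite divr_ge0 ?powR_ge0// mulr_ge0// ltW.
have [[s0 [Es0 ks0]]|nos] := pselect (exists s, E s /\ dyadic_index n s = k); last first.
  exists set0 => //; split; last by rewrite measure0 lee_fin mulr_ge0// exprn_ge0.
  by move=> w [_ [s [Es ks _]]]; apply: nos; exists s.
set u := dyadic_point n k : R.
have cell s : E s -> dyadic_index n s = k -> u <= s < u + 2^-1 ^+ n.
  move=> Es ks; rewrite /u -ks; apply: dyadic_index_itv.
  by have /andP[+ _] := E01 Es; exact: le_trans (ltW a_gt0).
have /andP[us0 s0u] := cell _ Es0 ks0.
have /andP[as0 s01] := E01 Es0.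
have ua : a / 2 <= u by lra.
have u01 : 0 < u <= 1 by rewrite (lt_le_trans _ ua) ?divr_gt0//= (le_trans us0).
(* The drift is evaluated at [s0] in [E], since [u] may lie below [a], where [f] is not controlled;
   [u >= a / 2] still bounds the deviation of [B] from below. *)
pose A (j : 'I_m) := ball_event B (fun i => y j ord0 i - f s0 ord0 i) u (C3 * p).
have [] := @measure_exists_le _ _ _ P _ (enum 'I_m) A ((C3 * p / (a / 2) `^ H) ^+ d).
- by move=> j; exact: measurable_ball_event.
- move=> j; apply: le_trans (ball_event_le H01 fbmB _ u01 _) _.
    by rewrite mulr_ge0// ltW.
  have a2 : 0 < (a / 2) `^ H by rewrite powR_gt0// divr_gt0.
  have uH : 0 < u `^ H by rewrite powR_gt0//; case/andP: u01.
  rewrite lee_fin; apply: lerXn2r; rewrite ?nnegrE//.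
    by rewrite divr_ge0 ?(ltW uH)// mulr_ge0// ltW.
  apply: ler_wpM2l; first by rewrite mulr_ge0// ltW.
  rewrite lef_pV2 ?posrE//; apply: ge0_ler_powR; rewrite ?nnegrE ?(ltW H_gt0)//.
    by rewrite divr_ge0// ltW.
  by case/andP: u01 => /ltW.
rewrite size_enum_ord => mV PV.
exists [set w | exists2 j, j \in enum 'I_m & A j w] => //; split => //.
move=> w [mod_w [s [Es ks Fs]]].
have [j _ yj] := Fy _ Fs; exists j; rewrite ?mem_enum// => i.
have /andP[us su] := cell _ Es ks.
have b1 : `|B i s w - B i u w| <= q / (1 - q) * p.
  rewrite -pE /u -ks; apply: (@dyadic_chain _ (fun t => B i t w) q N) => //.
  - by rewrite q0.
  - by have [_ _ _] := fbmB.1 i; exact.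
  by have /andP[/(le_trans (ltW a_gt0)) ? ?] := E01 Es; rewrite in_itv/=; apply/andP.
have b2 : `|y j ord0 i - (B i s w + f s ord0 i)| <= p.
  have := coord_le_euclidean_norm (y j - (sample_path B w s + f s)) i.
  rewrite !mxE => h1; apply: le_trans h1 _; exact: ltW.
have b3 : `|f s0 ord0 i - f s ord0 i| <= K * p.
  have := coord_le_euclidean_norm (f s0 - f s) i; rewrite !mxE => h1.
  apply: le_trans h1 _; apply: le_trans (fH (sE Es) (sE Es0)) _.
  apply: ler_wpM2l => //; apply: le_trans tHp.
  apply: ge0_ler_powR; rewrite ?nnegrE ?(ltW H_gt0) ?(ltW t0)//.
  rewrite ler_norml; apply/andP; split; lra.
have -> : B i u w - (y j ord0 i - f s0 ord0 i) = - (B i s w - B i u w) -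
   (y j ord0 i - (B i s w + f s ord0 i)) + (f s0 ord0 i - f s ord0 i) by ring.
apply: le_trans (ler_normD _ _) _.
rewrite /C3 mulrDl; apply: lerD => //.
apply: le_trans (ler_normB _ _) _.
by rewrite normrN mulrDl mul1r; apply: lerD.
Qed.

Lemma dyadic_scale (rho : R) : 0 < rho -> rho < 1 ->
  exists n, 2^-1 ^+ n.+1 <= rho < 2^-1 ^+ n.
Proof.
move=> r0 r1.
have ex : exists n, 2^-1 ^+ n.+1 <= rho.
  have [n hn] := exprn_half_le r0; exists n; apply: le_trans hn.
  exact: ler_exprn_half.
case: (ex_minnP ex) => [[|n] hn mn]; first by exists 0%N; rewrite hn expr0.
exists n.+1; rewrite hn ltNge; apply/negP => h.
by have := mn n h; rewrite ltnn.
Qed.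

(** An interval no longer than a cell meets at most two consecutive cells, whence the factor 2. The
    left end is cut at 0, where the cell index starts. *)
Lemma hit_from_interval (h : R) (N n m : nat) (y : 'I_m -> 'rV[R]_d) (x r : R) :
  0 < h -> h <= H -> (N <= n)%N -> 2^-1 ^+ n <= a / 2 -> 2 * r <= 2^-1 ^+ n ->
  F `<=` \bigcup_i metric_ball (@euclidean_dist R d) (y i) ((2^-1 ^+ n) `^ h) ->
  exists2 V : set T, measurable V &
    modulus_event (2^-1 `^ h) N `&` hit_from (metric_ball (@real_dist R) x r) `<=` V /\
    (P V <= (2 * (m%:R * ((2^-1 `^ h / (1 - 2^-1 `^ h) + 1 + K) * (2^-1 ^+ n) `^ h
               / (a / 2) `^ H) ^+ d))%:E)%E.
Proof.
move=> h0 hH Nn na rn Fy.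
pose s0 := Num.max 0 (x - r); pose k := dyadic_index n s0.
have s00 : 0 <= s0 by rewrite le_max lexx.
have [V mV [sV PV]] := hit_from_cell k h0 hH Nn na Fy.
have [W mW [sW PW]] := hit_from_cell k.+1 h0 hH Nn na Fy.
exists (V `|` W); first exact: measurableU.
split; last first.
  apply: (le_trans (measureU2 _ _ _)) => //.
  rewrite mulr_natl mulr2n EFinD; exact: leeD.
move=> w [Gw [s [Es /= xs Fs]]].
have /andP[sa _] := E01 Es; have s_ge0 := le_trans (ltW a_gt0) sa.
move: xs; rewrite /metric_ball/= /real_dist ltr_norml => /andP[xs1 xs2].
have s0s : s0 <= s by rewrite ge_max s_ge0; lra.
have ss0 : s < s0 + 2^-1 ^+ n.
  have : x - r <= s0 by rewrite le_max lexx orbT.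
  by move=> hx; apply: lt_le_trans (lerD hx rn); lra.
have pn : 0 < 2 ^+ n :> R by rewrite exprn_gt0.
have k1 : (k <= dyadic_index n s)%N by apply: le_truncn; rewrite ler_pM2l.
have k2 : (dyadic_index n s < k.+2)%N.
  rewrite -(ltr_nat R).
  have i1 : (dyadic_index n s)%:R <= 2 ^+ n * s.
    by rewrite truncn_le mulr_ge0// ltW.
  have /andP[_ i2] : k%:R <= 2 ^+ n * s0 < k.+1%:R.
    by apply: truncn_itv; rewrite mulr_ge0// ltW.
  apply: le_lt_trans i1 _; rewrite -[k.+2%:R]natr1.
  apply: (@lt_trans _ _ (2 ^+ n * (s0 + 2^-1 ^+ n))); first by rewrite ltr_pM2l.
  by rewrite mulrDr exprVn mulfV ?gt_eqF// ltrD2r.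
move: k2; rewrite ltnS leq_eqVlt ltnS => /orP[/eqP e1|e1].
  by right; apply: sW; split => //; exists s.
by left; apply: sV; split => //; exists s; split => //; apply/eqP; rewrite eqn_leq e1.
Qed.

Hypotheses (cE : compact E) (cF : compact F).

Lemma hitting_event_null (g : R) : g < d%:R ->
  (upper_minkowski_dim (@euclidean_dist R d) F < g%:E)%E ->
  hausdorff_measure (@real_dist R) (H * (d%:R - g)) E = 0%E ->
  P (hitting_event B f E F) = 0%E.
Proof.
move=> gd /upper_minkowski_dim_lt[g' [r0 [g'g r00 Fnet]]] HE.
have dg : 0 < d%:R - g by rewrite subr_gt0.
have dg' : 0 < d%:R - g' by rewrite subr_gt0 (lt_trans g'g).
pose h := H * (d%:R - g) / (d%:R - g').
have h0 : 0 < h by rewrite divr_gt0// mulr_gt0.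
have hH : h < H by rewrite /h -mulrA gtr_pMr// ltr_pdivrMr// mul1r ltrD2l ltrN2.
have hg : h * (d%:R - g') = H * (d%:R - g) by rewrite /h mulfVK ?gt_eqF.
set be := H * (d%:R - g) in HE hg.
have be0 : 0 < be by rewrite mulr_gt0.
set q := 2^-1 `^ h : R.
have H1 : H < 1 by case/andP: H01.
have [c c0 hc] := small_increments_prob h0 hH H1.
pose hit := hitting_event B f E F.
have mhit : measurable hit.
  apply: (measurable_hitting_event a_gt0 b_le1 H_gt0 fH) => // i.
  by have [] := fbmB.1 i.
have mG N : measurable (modulus_event q N).
  rewrite (_ : modulus_event q N = \bigcap_(i in [set: 'I_d])
     [set w | small_increments (fun t => B i t w) q N]); last first.
    by apply/seteqP; split => [w hw i _|w hw i]; exact: hw.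
  by apply: fin_bigcap_measurable => // i _; exact: measurable_small_increments.
have PG N : (P (~` modulus_event q N) <= (d%:R * (c * 2^-1 ^+ N))%:E)%E.
  have [] := @measure_exists_le _ _ _ P _ (enum 'I_d)
     (fun i => ~` [set w | small_increments (fun t => B i t w) q N]) (c * 2^-1 ^+ N).
  - by move=> i; apply: measurableC; exact: measurable_small_increments.
  - by move=> i; apply: hc; exact: fbmB.1.
  rewrite size_enum_ord => mS; apply: le_trans; apply: le_measure; rewrite ?inE//.
    exact: measurableC.
  move=> w /= nG; apply: contrapT => nS; apply: nG => i; apply: contrapT => ni.
  by apply: nS; exists i; rewrite // mem_enum.
pose D := ((q / (1 - q) + 1 + K) / (a / 2) `^ H) ^+ d.
have D0 : 0 <= D.
  apply: exprn_ge0; apply: divr_ge0; rewrite ?powR_ge0//.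
  have q1 : 0 <= 1 - q.
    rewrite subr_ge0 /q.
    have one : 1 `^ h = 1 :> R by rewrite powR1.
    rewrite -[leRHS]one; apply: ge0_ler_powR; rewrite ?nnegrE ?(ltW h0) ?invr_ge0//; lra.
  by rewrite addr_ge0// addr_ge0// divr_ge0// powR_ge0.
(* One factor 2 for the two cells, one for the size of the net, and [2^be] because [2^-n] is at most
   twice [2 r j]. *)
pose C6 := 4 * D * 2 `^ be.
have C60 : 0 <= C6 by rewrite mulr_ge0 ?powR_ge0// mulr_ge0.
have PhitG N eta : 0 < eta -> (P (hit `&` modulus_event q N) <= (C6 * eta)%:E)%E.
  move=> eta0.
  (* A cell length below [e0] keeps cells away from time 0, makes the net radius smaller than [r0],
     and forces [n >= N]. Covering radii up to [e0 / 4] ensure it, as [2^-n <= 4 r j]. *)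
  pose e0 := Num.min (a / 2) (Num.min ((r0 / 2) `^ h^-1) (2^-1 ^+ N)).
  have e00 : 0 < e0.
    rewrite !lt_min divr_gt0//=; apply/andP; split; last by rewrite exprn_gt0.
    by apply: powR_gt0; rewrite divr_gt0.
  have [||x [r [Ex rd sr]]] := @hausdorff_measure0_cover R R _ be eta (e0 / 4) E HE => //.
    by rewrite divr_gt0.
  have cellj j : exists V : set T, [/\ measurable V,
      modulus_event q N `&` hit_from (metric_ball (@real_dist R) (x j) (r j)) `<=` V &
      (P V <= (C6 * (2 * r j) `^ be)%:E)%E].
    have /andP[rj0 rje] := rd j.
    have [rj|rj] := eqVneq (r j) 0.
      exists set0; split => //.
        move=> w [_ [s [_ + _]]]; rewrite /metric_ball/= rj /real_dist.
        by rewrite ltNge normr_ge0.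
      by rewrite measure0 rj mulr0 powR0 ?mulr0// gt_eqF.
    have rj_gt0 : 0 < 2 * r j by rewrite mulr_gt0// lt_neqAle eq_sym rj.
    have e01 : e0 <= 1.
      by apply: (@le_trans _ _ (2^-1 ^+ N)); rewrite ?ge_min ?lexx ?orbT// exprn_ile1//; lra.
    have [|n /andP[n1 n2]] := dyadic_scale rj_gt0; first by lra.
    have n3 : 2^-1 ^+ n <= e0.
      by move: n1; rewrite exprS; lra.
    have na : 2^-1 ^+ n <= a / 2 by apply: le_trans n3 _; rewrite ge_min lexx.
    have nN : (N <= n)%N.
      have : 2^-1 ^+ n <= 2^-1 ^+ N :> R.
        by apply: le_trans n3 _; rewrite !ge_min lexx !orbT.
      by rewrite ler_iXn2l//; lra.
    have t0 : 0 < 2^-1 ^+ n :> R by rewrite exprn_gt0.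
    set p := (2^-1 ^+ n) `^ h.
    have p0 : 0 < p by exact: powR_gt0.
    have pr0 : p < r0.
      apply: (@le_lt_trans _ _ (r0 / 2)); last by lra.
      have -> : r0 / 2 = ((r0 / 2) `^ h^-1) `^ h.
        by rewrite -powRrM mulVf ?gt_eqF// powRr1// divr_ge0// ltW.
      apply: ge0_ler_powR; rewrite ?nnegrE ?powR_ge0 ?(ltW t0) ?(ltW h0)//.
      by apply: le_trans n3 _; rewrite !ge_min lexx orbT.
    have [m [y [Fy my]]] := Fnet _ p0 pr0.
    have [V mV [sV PV]] := hit_from_interval (x j) h0 (ltW hH) nN na (ltW n2) Fy.
    exists V; split => //; apply: le_trans PV _; rewrite lee_fin -/q -/p.
    set A := q / (1 - q) + 1 + K in D C6 D0 C60 *.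
    have -> : A * p / (a / 2) `^ H = A / (a / 2) `^ H * p by ring.
    rewrite exprMn -/A -/D.
    have pd : 0 <= p ^+ d by rewrite exprn_ge0// ltW.
    apply: (@le_trans _ _ (4 * D * (p `^ (- g') * p ^+ d))).
      have -> : 2 * (m%:R * (D * p ^+ d)) = 2 * D * p ^+ d * m%:R by ring.
      have -> : 4 * D * (p `^ (- g') * p ^+ d) = 2 * D * p ^+ d * (2 * p `^ (- g')) by ring.
      by apply: ler_wpM2l => //; rewrite mulr_ge0// mulr_ge0.
    rewrite /C6 -[leRHS]mulrA; apply: ler_wpM2l; first by rewrite mulr_ge0.
    rewrite -(powR_mulrn d (ltW p0)) -powRD; last by rewrite (gt_eqF p0) implybT.
    rewrite addrC /p -powRrM hg -powRM ?(ltW rj_gt0)//.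
    apply: ge0_ler_powR; rewrite ?nnegrE ?(ltW be0) ?(ltW t0)//.
      by rewrite mulr_ge0// ltW.
    by move: n1; rewrite exprS; lra.
  have /choice[V hV] := cellj.
  have mV j : measurable (V j) by have [] := hV j.
  apply: le_trans (@measure_sigma_subadditive _ _ _ P _ V mV _ _) _.
  - exact: measurableI.
  - move=> w [[z [[s Es sz] Fz]] Gw]; have [j _ xj] := Ex _ Es; exists j => //.
    have [_ + _] := hV j; apply; split => //; exists s; split => //; by rewrite sz.
  apply: (@le_trans _ _ (\sum_(0 <= j <oo) (C6%:E * ((2 * r j) `^ be)%:E))%E).
    by apply: lee_nneseries => // j _; have [_ _] := hV j; rewrite EFinM.
  rewrite nneseriesZl//; last by move=> j _; rewrite lee_fin powR_ge0.
  by rewrite [leRHS]EFinM; apply: lee_pmul; rewrite ?lee_fin ?(ltW sr)//; apply: nneseries_ge0 => j _ _; rewrite lee_fin powR_ge0.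
apply/eqP; rewrite eq_le measure_ge0 andbT; apply/lee_addgt0Pr => e e0; rewrite add0e.
have C61 : 0 < C6 + 1 by rewrite ltr_wpDl.
have dc1 : 0 < d%:R * c + 1 by rewrite ltr_wpDl// mulr_ge0// ltW.
have e2 : 0 < e / 2 by rewrite divr_gt0.
(* [N] is fixed first, through the failure of the modulus; the cover of [E] is then chosen with
   weight small against [C6], which does not depend on [N]. *)
have [N hN] := exprn_half_le (divr_gt0 e2 dc1).
have h1 := PhitG N _ (divr_gt0 e2 C61).
have h2 := PG N.
have h3 : hit `<=` (hit `&` modulus_event q N) `|` ~` modulus_event q N.
  by move=> w hw; have [Gw|Gw] := pselect (modulus_event q N w); [left|right].
apply: (@le_trans _ _ (P ((hit `&` modulus_event q N) `|` ~` modulus_event q N))).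
  apply: le_measure; rewrite ?inE//; apply: measurableU; last exact: measurableC.
  exact: measurableI.
apply: (le_trans (measureU2 _ _ _)); [exact: measurableI|exact: measurableC|].
apply: le_trans (leeD h1 h2) _; rewrite -EFinD lee_fin.
have small (u v : R) : 0 <= u -> 0 < v -> u * (v / (u + 1)) <= v.
  move=> u0 v0; have u1 : 0 < u + 1 by rewrite ltr_wpDl.
  rewrite mulrA ler_pdivrMr// mulrDr mulr1 mulrC lerDl; exact: ltW.
have ee : e / 2 + e / 2 = e by field.
rewrite -[leRHS]ee; apply: lerD; first exact: small.
have dc0 : 0 <= d%:R * c by rewrite mulr_ge0// ltW.
rewrite mulrA; apply: le_trans (small _ _ dc0 e2).
exact: ler_wpM2l.
Qed.

End upper_bound.

Theorem proposition3p6 (R : realType) (d : nat) (a b H : R)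
    (hab : [/\ 0 < a, a < b & b <= 1]) (hH : 0 < H < 1)
    (E : set R) (F : set 'rV[R]_d)
    (cE : compact E) (sE : E `<=` `[a, b]) (cF : compact F)
    (hF : (0 < hausdorff_dim (@euclidean_dist R d) F
             <= upper_minkowski_dim (@euclidean_dist R d) F)%E)
    (hFd : (upper_minkowski_dim (@euclidean_dist R d) F < d%:R%:E)%E)
    (gamma gamma' : R)
    (hgamma0 : 0 < gamma)
    (hgamma : (gamma%:E < hausdorff_dim (@euclidean_dist R d) F)%E)
    (hgamma' : (upper_minkowski_dim (@euclidean_dist R d) F < gamma'%:E)%E)
    (hgammad : gamma' < d%:R)
    (K : R) :
  exists c4 : R, 0 < c4 /\
    forall f : R -> 'rV[R]_d,
      is_holder a b H f -> holder_norm a b H f = K%:E ->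
    forall (disp : measure_display) (T : measurableType disp)
      (P : probability T R) (B : 'I_d -> R -> {RV P >-> R}),
      measure_is_complete P -> is_fbm_vector H B ->
      ((c4^-1)%:E * capacity (H * (d%:R - gamma)) E
         <= P (hitting_event B f E F)
         <= c4%:E * hausdorff_measure (@real_dist R) (H * (d%:R - gamma')) E)%E.
Proof.
case: hab => a0 ab b1; have a1 : a <= 1 by exact: le_trans (ltW ab) b1.
have H0 : 0 < H by case/andP: hH.
(* A negative [K] is the norm of no [f], so any constant works. *)
have [K0|K0] := ltP K 0.
  exists 1; split => // f _ /(holder_norm_bounds ab)[Kge0 _ _].
  by move: K0; rewrite ltNge Kge0.
have [_ dim_le] := andP hF.
have gd : gamma <= d%:R.
  by apply: ltW; rewrite -lte_fin; apply: lt_trans hgamma (le_lt_trans dim_le hFd).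
have HF : hausdorff_measure (@euclidean_dist R d) gamma F <> 0%E.
  move=> HF; move: hgamma; rewrite ltNge => /negP; apply.
  by apply: ereal_inf_lbound; exists gamma.
have mE : measurable E by apply: closed_measurable; exact: compact_closed.
have [c c0 lower] := hit_within_energy_ge a0 a1 b1 hH K0 hgamma0 gd cF mE sE HF.
set be' := H * (d%:R - gamma').
set m := hausdorff_measure (@real_dist R) be' E.
have m0 : (0 <= m)%E.
  apply: le_trans (hausdorff_content_le_measure _ _ _ (ltr01 : 0 < 1 :> R)).
  exact: hausdorff_content_ge0.
(* [fine] sends an infinite measure to 0, whose inverse is 0, so the second entry matters only when
   [m] is positive and finite; it then makes the upper bound at least 1. *)
pose c4 := Num.max c^-1 (fine m)^-1.
have c40 : 0 < c4 by rewrite lt_max invr_gt0 c0.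
have c4c : c4^-1 <= c.
  by rewrite -[leRHS]invrK lef_pV2 ?posrE ?invr_gt0// le_max lexx.
exists c4; split => // f _ Kf disp T P B _ fbmB.
have [_ fK fH] := holder_norm_bounds ab Kf.
have cB i w : {within `[0, 1], continuous (fun t => B i t w)} by have [_ _ _] := fbmB.1 i; exact.
have mhit := measurable_hitting_event a0 b1 H0 fH cB sE cE cF.
have fin_hit : P (hitting_event B f E F) \is a fin_num by exact: fin_num_measure.
apply/andP; split.
  rewrite -[leRHS](fineK fin_hit); apply: capacity_le; first by rewrite invr_gt0.
    move=> mu I h muE enI h0.
    have I0 : 0 <= I by rewrite -lee_fin -enI energy_ge0.
    apply: (@le_trans _ _ (c / (I + h))).
      by apply: ler_wpM2r => //; rewrite invr_ge0 addr_ge0// ltW.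
    rewrite -lee_fin (fineK fin_hit).
    by apply: (hitting_event_ge a0 b1 H0 fH cB) => // r r0; exact: (lower _ _ _ _ _ fK fH fbmB mu).
  exact: fine_ge0.
have [mz|mz] := eqVneq m 0%E.
  rewrite mz mule0.
  by rewrite (hitting_event_null a0 b1 hH K0 sE fbmB fH cE cF hgammad hgamma' mz).
apply: le_trans (probability_le1 _ mhit) _.
case mE' : m m0 mz => [y| |]//= m0 mz; last by rewrite mulry gtr0_sg// mul1e leey.
have y0 : 0 < y by rewrite lt_neqAle eq_sym -eqe mz/= -lee_fin.
rewrite -EFinM lee_fin -ler_pdivrMr// mul1r /c4 mE' /= le_max lexx orbT.
exact: isT.
Qed.
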